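(* For all $n\in\mathbb N$, $L>0$, $z\in\mathbb C\setminus[0,\infty)$ and $\psi_1,\psi_2\in L^2(\mathbb R^d)$, $$T_{n,L}[z;\psi_1,\psi_2]=\int_{(\Lambda_L^* )^{n+1}}\sum_{A\in\mathcal A_n}\mathcal P_{A,L}(k_1,\dots,k_{n+1})\,\overline{\hat\psi_{1,\#}(k_1)}\,\hat\psi_{2,\#}(k_{n+1})\prod_{j=1}^{n+1}(\nu(k_j)-z)^{-1}\,d(k_1,\dots,k_{n+1}).$$
   Context: For $L>0$: $\Lambda_L=[-L/2,L/2)^d$, $\Lambda_L^*=(\frac1L\mathbb Z)^d$, and for $g$ on $(\Lambda_L^* )^m$, $\int_{(\Lambda_L^* )^m}g(k)dk:=|\Lambda_L|^{-m}\sum_{k\in(\Lambda_L^* )^m}g(k)$. For $h:\mathbb R^d\to\mathbb C$, $h_\#$ is the $L$-periodic extension of $h|_{\Lambda_L}$ and $\hat h_\#(p)=\int_{\Lambda_L}e^{-2\pi ip\cdot x}h(x)dx$, $p\in\Lambda_L^*$. Inner products on $L^2(\Lambda_L)$ are antilinear in the first argument. $\nu(p)=\frac12|p|^2$; $K_L$ is the self-adjoint operator with $\widehat{K_Lf}(p)=\nu(p)\hat f(p)$ on $\{f:\nu\hat f\in\ell^2(\Lambda_L^* )\}$, $R_L(z)=(K_L-z)^{-1}$. $B$ is a real Schwartz function on $\mathbb R^d$ with compact support or invariant under each reflection $x_j\mapsto-x_j$. $M$ Poisson with mean $|\Lambda_L|$, $y_{L,\gamma}$ i.i.d. uniform on $\Lambda_L$,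 $v_\gamma$ i.i.d. real with $m_k=\mathbf E v_\gamma^k<\infty$ for all $k$, all independent; $V_L(x)=\sum_{\gamma=1}^Mv_\gamma B_\#(x-y_{L,\gamma})$; $\mathbf E_L$ joint expectation; $T_{n,L}[z;\psi_1,\psi_2]:=\mathbf E_L\langle\psi_{1,\#},R_L(z)[V_LR_L(z)]^n\psi_{2,\#}\rangle$. $\mathcal A_n$ is the set of partitions of $\{1,\dots,n\}$; $\delta_{*,L}(u)=|\Lambda_L|$ if $u=0$ and $0$ otherwise; for $A\in\mathcal A_n$ and $k=(k_1,\dots,k_{n+1})\in(\Lambda_L^* )^{n+1}$, $\mathcal P_{A,L}(k)=\prod_{a\in A}\Big\{m_{|a|}\,\delta_{*,L}\Big(\sum_{l\in a}(k_l-k_{l+1})\Big)\prod_{l\in a}\hat B_\#(k_l-k_{l+1})\Big\}$. *)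

(* Defs.v *)
From HB Require Import structures.
From mathcomp Require Import all_boot all_order all_algebra.
From mathcomp Require Import all_classical all_reals all_analysis.
From mathcomp Require Import complex.
From Stdlib Require Import ClassicalEpsilon.

Set Implicit Arguments.
Unset Strict Implicit.
Unset Printing Implicit Defensive.

Import Order.TTheory GRing.Theory Num.Theory.
Import numFieldNormedType.Exports.
Local Open Scope ring_scope.
Local Open Scope complex_scope.

Definition setc (R : realType) (d : nat) (x : 'rV[R]_d) (k : nat) (t : R)
  : 'rV[R]_d := \row_j (if (j : nat) == k then t else x 0 j).

(* iterated Lebesgue integral over the coordinates 0..k-1 (nonnegative
   integrands: by Tonelli this is the integral w.r.t. Lebesgue measure on R^k) *)
Fixpoint iint_aux (R : realType) (d : nat) (k : nat)
    (f : 'rV[R]_d -> \bar R) (x : 'rV[R]_d) : \bar R :=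
  match k with
  | 0 => f x
  | k'.+1 => (\int[@lebesgue_measure R]_t iint_aux k' f (setc x k' t))%E
  end.

Definition nnint (R : realType) (d : nat) (f : 'rV[R]_d -> \bar R) : \bar R :=
  iint_aux d f 0.

Definition rint (R : realType) (d : nat) (f : 'rV[R]_d -> R) : R :=
  fine (nnint (fun x => (Num.max (f x) 0)%:E)) -
  fine (nnint (fun x => (Num.max (- f x) 0)%:E)).

Definition cint (R : realType) (d : nat) (f : 'rV[R]_d -> R[i]) : R[i] :=
  (rint (fun x => complex.Re (f x))) +i* (rint (fun x => complex.Im (f x))).

Definition sqn (R : realType) (z : R[i]) : R := complex.Re z ^+ 2 + complex.Im z ^+ 2.

(* Borel measurability on R^d (product sigma-algebra of the coordinates) *)
Definition rmeas (R : realType) (d : nat) (f : 'rV[R]_d -> R) : Prop :=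
  measurable_fun setT (fun t : d.-tuple R => f (\row_j tnth t j)).

Definition cmeas (R : realType) (d : nat) (f : 'rV[R]_d -> R[i]) : Prop :=
  rmeas (fun x => complex.Re (f x)) /\ rmeas (fun x => complex.Im (f x)).

Definition L2Rd (R : realType) (d : nat) (f : 'rV[R]_d -> R[i]) : Prop :=
  cmeas f /\ (nnint (fun x => (sqn (f x))%:E) < +oo)%E.

Definition boxb (R : realType) (d : nat) (L : R) (x : 'rV[R]_d) : bool :=
  [forall j, (- (L / 2) <= x 0 j) && (x 0 j < L / 2)].

Definition vol (R : realType) (d : nat) (L : R) : R := L ^+ d.

(* h_# : the L-periodic extension of h restricted to Lambda_L *)
Definition per (R : realType) (d : nat) (L : R) (T : Type)
    (h : 'rV[R]_d -> T) (x : 'rV[R]_d) : T :=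
  h (\row_j (x 0 j - L * (Num.floor ((x 0 j + L / 2) / L))%:~R)).

(* the point k / L of Lambda_L^*, for k in Z^d *)
Definition dual (R : realType) (d : nat) (L : R) (k : 'rV[int]_d) : 'rV[R]_d :=
  \row_j ((k 0 j)%:~R / L).

Definition dotp (R : realType) (d : nat) (p x : 'rV[R]_d) : R :=
  \sum_j p 0 j * x 0 j.

Definition expi (R : realType) (theta : R) : R[i] := cos theta +i* sin theta.

Definition hatper (R : realType) (d : nat) (L : R) (h : 'rV[R]_d -> R[i])
    (k : 'rV[int]_d) : R[i] :=
  cint (fun x => if boxb L x
                 then expi (- (2 * pi * dotp (dual L k) x)) * h x
                 else 0).

Definition nu (R : realType) (d : nat) (p : 'rV[R]_d) : R :=
  (\sum_j p 0 j ^+ 2) / 2.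

Definition innerL (R : realType) (d : nat) (L : R) (f g : 'rV[R]_d -> R[i])
  : R[i] :=
  cint (fun x => if boxb L x then conjc (f x) * g x else 0).

Definition L2box (R : realType) (d : nat) (L : R) (g : 'rV[R]_d -> R[i]) : Prop :=
  cmeas g /\
  (nnint (fun x => if boxb L x then (sqn (g x))%:E else 0%E) < +oo)%E.

(* g = R_L(z) f : the element of L^2(Lambda_L) whose Fourier coefficients
   are hat f(p) / (nu(p) - z), i.e. (K_L - z) g = f with K_L the Fourier
   multiplier by nu. *)
Definition is_res (R : realType) (d : nat) (L : R) (z : R[i])
    (f g : 'rV[R]_d -> R[i]) : Prop :=
  L2box L g /\
  forall k : 'rV[int]_d,
    hatper L g k = hatper L f k / ((nu (dual L k))%:C - z).

(* R_L(z) f (a representative of the a.e.-unique solution) *)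
Definition resolv (R : realType) (d : nat) (L : R) (z : R[i])
    (f : 'rV[R]_d -> R[i]) : 'rV[R]_d -> R[i] :=
  epsilon (inhabits (fun _ => 0)) (is_res L z f).

(* a configuration: the list of pairs (y_gamma, v_gamma), gamma = 1..M *)
Definition config (R : realType) (d : nat) := seq ('rV[R]_d * R).

Definition Vpot (R : realType) (d : nat) (L : R) (B : 'rV[R]_d -> R)
    (s : config R d) (x : 'rV[R]_d) : R :=
  \sum_(q <- s) q.2 * per L B (x - q.1).

Fixpoint chain (R : realType) (d : nat) (L : R) (z : R[i]) (B : 'rV[R]_d -> R)
    (s : config R d) (f : 'rV[R]_d -> R[i]) (n : nat) : 'rV[R]_d -> R[i] :=
  match n with
  | 0 => resolv L z f
  | n'.+1 => resolv L z (fun x => (Vpot L B s x)%:C * chain L z B s f n' x)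
  end.

Fixpoint sint (R : realType) (d : nat) (L : R) (mu : probability R R)
    (m : nat) (F : config R d -> \bar R) : \bar R :=
  match m with
  | 0 => F [::]
  | m'.+1 =>
      (\int[mu]_v nnint (fun y : 'rV[R]_d =>
          if boxb L y
          then ((vol d L)^-1)%:E * sint L mu m' (fun s => F ((y, v) :: s))
          else 0))%E
  end.

(* E_L of a nonnegative functional of the configuration:
   M ~ Poisson(|Lambda_L|), y_gamma iid uniform on Lambda_L,
   v_gamma iid with law mu, all independent *)
Definition nnE (R : realType) (d : nat) (L : R) (mu : probability R R)
    (F : config R d -> \bar R) : \bar R :=
  (\sum_(0 <= m <oo)
     ((expR (- vol d L) * vol d L ^+ m / (m`!)%:R)%:E * sint L mu m F))%E.

Definition rE (R : realType) (d : nat) (L : R) (mu : probability R R)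
    (F : config R d -> R) : R :=
  fine (nnE L mu (fun s => (Num.max (F s) 0)%:E)) -
  fine (nnE L mu (fun s => (Num.max (- F s) 0)%:E)).

Definition cE (R : realType) (d : nat) (L : R) (mu : probability R R)
    (F : config R d -> R[i]) : R[i] :=
  (rE L mu (fun s => complex.Re (F s))) +i* (rE L mu (fun s => complex.Im (F s))).

Definition Tn (R : realType) (d : nat) (n : nat) (L : R) (z : R[i])
    (mu : probability R R) (B : 'rV[R]_d -> R) (psi1 psi2 : 'rV[R]_d -> R[i])
  : R[i] :=
  cE L mu (fun s => innerL L (per L psi1) (chain L z B s (per L psi2) n)).

Definition moment (R : realType) (mu : probability R R) (k : nat) : R :=
  fine (\int[mu]_x (x ^+ k)%:E)%E.

Definition csum (R : realType) (T : choiceType) (g : T -> R[i]) : R[i] :=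
  (fine (esum setT (fun k => (Num.max (complex.Re (g k)) 0)%:E)) -
   fine (esum setT (fun k => (Num.max (- complex.Re (g k)) 0)%:E))) +i*
  (fine (esum setT (fun k => (Num.max (complex.Im (g k)) 0)%:E)) -
   fine (esum setT (fun k => (Num.max (- complex.Im (g k)) 0)%:E))).

Definition deltaL (R : realType) (d : nat) (L : R) (u : 'rV[int]_d) : R :=
  if u == 0 then vol d L else 0.

(* k_l - k_{l+1}, for l in {1..n} encoded as l-1 : 'I_n, and
   k = (k_1,...,k_{n+1}) encoded as k : {ffun 'I_n.+1 -> Z^d} (k_j at j-1) *)
Definition kdiff (d n : nat) (k : {ffun 'I_n.+1 -> 'rV[int]_d}) (l : 'I_n)
  : 'rV[int]_d := k (widen_ord (leqnSn n) l) - k (lift ord0 l).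

Definition PAL (R : realType) (d n : nat) (L : R) (mu : probability R R)
    (B : 'rV[R]_d -> R) (A : {set {set 'I_n}})
    (k : {ffun 'I_n.+1 -> 'rV[int]_d}) : R[i] :=
  \prod_(a in A)
     ((moment mu #|a|)%:C * (deltaL L (\sum_(l in a) kdiff k l))%:C *
      \prod_(l in a) hatper L (fun x => (per L B x)%:C) (kdiff k l)).

Definition Tpart (R : realType) (d : nat) (n : nat) (L : R) (z : R[i])
    (mu : probability R R) (B : 'rV[R]_d -> R) (psi1 psi2 : 'rV[R]_d -> R[i])
  : R[i] :=
  ((vol d L ^- n.+1)%:C) *
  csum (fun k : {ffun 'I_n.+1 -> 'rV[int]_d} =>
    (\sum_(A : {set {set 'I_n}} | finset.partition A [set: 'I_n]) PAL L mu B A k) *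
    conjc (hatper L (per L psi1) (k ord0)) *
    hatper L (per L psi2) (k ord_max) *
    \prod_(j < n.+1) ((nu (dual L (k j)))%:C - z)^-1).

Fixpoint dder (R : realType) (d : nat) (vs : seq 'rV[R]_d)
    (f : 'rV[R]_d -> R) : 'rV[R]_d -> R :=
  match vs with
  | [::] => f
  | v :: vs' => 'D_v (dder vs' f)
  end.

Definition schwartz (R : realType) (d : nat) (f : 'rV[R]_d -> R) : Prop :=
  forall vs : seq 'rV[R]_d,
    (forall x v : 'rV[R]_d, derivable (dder vs f) x v) /\
    continuous (dder vs f : 'rV[R]_d -> R) /\
    (forall r : nat, exists C : R, forall x : 'rV[R]_d,
        (1 + `|x|) ^+ r * `|dder vs f x| <= C).

Definition compact_support (R : realType) (d : nat) (f : 'rV[R]_d -> R) : Prop :=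
  exists r : R, forall x : 'rV[R]_d, r < `|x| -> f x = 0.

Definition reflect_coord (R : realType) (d : nat) (j : 'I_d) (x : 'rV[R]_d)
  : 'rV[R]_d := \row_i (if i == j then - x 0 i else x 0 i).

Definition reflection_invariant (R : realType) (d : nat) (f : 'rV[R]_d -> R)
  : Prop := forall (j : 'I_d) (x : 'rV[R]_d), f (reflect_coord j x) = f x.

(* Main.v *)
(* In Fourier coefficients, multiplication by the potential V_s of a configuration
   s is convolution with lambda^-1 V_s^, where lambda = |Lambda_L| and
   V_s^(p) = (sum_gamma v_gamma e^(-2 pi i p.y_gamma)) B_#^(p), and the resolvent is
   multiplication by 1 / (nu - z).  By Parseval the inner product is therefore an
   iterated sum over k_1, ..., k_(n+1) whose dependence on s is the product of the
   factors sum_gamma v_gamma e^(-2 pi i (k_l - k_(l+1)).y_gamma).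

   The iterated sum converges absolutely, with a bound (2 sum_gamma |v_gamma|)^n times
   a constant, so it commutes with E_L.  Indeed B_#^(p) = O(prod_j 1 / (1 + |p_j|)),
   which is all that the jumps of B_# across the faces of the box allow, while
   1 / |nu - z| = O(prod_j (1 + |k_j|)^(-2/d)).  Sharing this factor between the two
   neighbouring steps gives a kernel with bounded row and column sums (Schur's
   test), because the sum over m in Z of (1 + |m|)^(-1-1/d) converges.

   For the expectation of a product over l in S of sums over gamma, condition on
   the number M of points and expand the product over the block of a fixed l0 in
   S.  Since m e^(-lambda) lambda^m / m! = lambda e^(-lambda) lambda^(m-1) / (m-1)!,
   the Poisson average satisfies the recursion that defines the sum over
   partitions A of S of prod_(a in A) lambda E[v^|a|] 1[sum_(l in a) p_l = 0]. *)
Require Import Defs.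
From HB Require Import structures.
From mathcomp Require Import all_boot all_order all_algebra.
From mathcomp Require Import all_classical all_reals all_analysis.
From mathcomp Require Import measurable_realfun complex.
From mathcomp Require Import ring lra.
From Stdlib Require Import ClassicalEpsilon.

Set Implicit Arguments.
Unset Strict Implicit.
Unset Printing Implicit Defensive.

Import Order.TTheory GRing.Theory Num.Theory.
Import numFieldNormedType.Exports.
Local Open Scope classical_set_scope.
Local Open Scope ring_scope.
Local Open Scope complex_scope.

(** * Complex numbers with the norm |Re| + |Im| *)

(** Integrals, sums and expectations of the statement are built from [fine] of positive and negative
    parts, so a divergent quantity becomes 0 without notice, and every exchange of limits must be
    preceded by a bound. [resolv] is a choice among almost everywhere equal solutions and carries no
    regularity in the configuration; measurability of the inner product is therefore read off from
    its explicit series. That series rests on Riesz-Fischer and Parseval, hence on completeness of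
    the characters. Completeness is obtained by measure theory: the functions by which one may
    multiply without leaving the annihilator of the characters form an algebra closed under bounded
    limits, and iterating a cubic polynomial produces indicators of sets from sines and cosines. The
    decay of the coefficients of [B_#] is obtained by shifting by half a period in every coordinate
    of nonzero frequency: the points that wrap around the box are so few that they cost no more than
    the smooth part. *)

Section ComplexAux.
Variable R : realType.
Implicit Types z w : R[i].

Lemma ReD z w : complex.Re (z + w) = complex.Re z + complex.Re w.
Proof. by case: z; case: w. Qed.

Lemma ImD z w : complex.Im (z + w) = complex.Im z + complex.Im w.
Proof. by case: z; case: w. Qed.

Lemma ReN z : complex.Re (- z) = - complex.Re z.
Proof. by case: z. Qed.

Lemma ImN z : complex.Im (- z) = - complex.Im z.
Proof. by case: z. Qed.

Lemma ReM z w :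
  complex.Re (z * w) = complex.Re z * complex.Re w - complex.Im z * complex.Im w.
Proof. by case: z; case: w. Qed.

Lemma ImM z w :
  complex.Im (z * w) = complex.Re z * complex.Im w + complex.Im z * complex.Re w.
Proof. by case: z; case: w. Qed.

Lemma ReJ z : complex.Re (conjc z) = complex.Re z.
Proof. by case: z. Qed.

Lemma ImJ z : complex.Im (conjc z) = - complex.Im z.
Proof. by case: z. Qed.

Definition ReImE := (ReD, ImD, ReN, ImN, ReM, ImM, ReJ, ImJ).

Lemma complex_ext z w :
  complex.Re z = complex.Re w -> complex.Im z = complex.Im w -> z = w.
Proof. by case: z; case: w => a b c e /= -> ->. Qed.

Lemma Re_sum (I : Type) (s : seq I) (P : pred I) (F : I -> R[i]) :
  complex.Re (\sum_(i <- s | P i) F i) = \sum_(i <- s | P i) complex.Re (F i).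
Proof. exact: (big_morph _ ReD). Qed.

Lemma Im_sum (I : Type) (s : seq I) (P : pred I) (F : I -> R[i]) :
  complex.Im (\sum_(i <- s | P i) F i) = \sum_(i <- s | P i) complex.Im (F i).
Proof. exact: (big_morph _ ImD). Qed.

(* A real-valued norm on C, equivalent to the modulus and more convenient here
   than the R[i]-valued one. *)
Definition na z : R := `|complex.Re z| + `|complex.Im z|.

Lemma na_ge0 z : 0 <= na z.
Proof. by rewrite addr_ge0. Qed.

Lemma na0 : na 0 = 0.
Proof. by rewrite /na /= normr0 addr0. Qed.

Lemma naJ z : na (conjc z) = na z.
Proof. by rewrite /na !ReImE !normrN. Qed.

Lemma na_real (x : R) : na x%:C = `|x|.
Proof. by rewrite /na /= normr0 addr0. Qed.

Lemma naD z w : na (z + w) <= na z + na w.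
Proof.
rewrite /na !ReImE addrACA; apply: lerD; exact: ler_normD.
Qed.

Lemma naM z w : na (z * w) <= na z * na w.
Proof.
rewrite /na !ReImE.
have := ler_normB (complex.Re z * complex.Re w) (complex.Im z * complex.Im w).
have := ler_normD (complex.Re z * complex.Im w) (complex.Im z * complex.Re w).
by rewrite !normrM; lra.
Qed.

Lemma na_sum (I : Type) (s : seq I) (P : pred I) (F : I -> R[i]) :
  na (\sum_(i <- s | P i) F i) <= \sum_(i <- s | P i) na (F i).
Proof.
elim/big_rec2: _ => [|i y x _ le]; first by rewrite na0.
by apply: (le_trans (naD _ _)); rewrite lerD2l.
Qed.

Lemma na_prod (I : Type) (s : seq I) (P : pred I) (F : I -> R[i]) :
  na (\prod_(i <- s | P i) F i) <= \prod_(i <- s | P i) na (F i).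
Proof.
elim/big_rec2: _ => [|i y x _ le]; first by rewrite /na /= normr0 addr0 normr1.
by apply: (le_trans (naM _ _)); rewrite ler_wpM2l ?na_ge0.
Qed.

Lemma na_Re z : `|complex.Re z| <= na z.
Proof. by rewrite lerDl. Qed.

Lemma na_Im z : `|complex.Im z| <= na z.
Proof. by rewrite lerDr. Qed.

Lemma sqn_ge0 z : 0 <= sqn z.
Proof. by rewrite addr_ge0 ?sqr_ge0. Qed.

Lemma sqn_le_na z : sqn z <= na z ^+ 2.
Proof.
rewrite /sqn /na -(real_normK (num_real (complex.Re z))).
rewrite -(real_normK (num_real (complex.Im z))).
have : 0 <= `|complex.Re z| * `|complex.Im z| by rewrite mulr_ge0.
by nra.
Qed.

Lemma na_le_sqn z : na z ^+ 2 <= 2 * sqn z.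
Proof.
rewrite /sqn /na -(real_normK (num_real (complex.Re z))).
rewrite -(real_normK (num_real (complex.Im z))).
by have := sqr_ge0 (`|complex.Re z| - `|complex.Im z|); nra.
Qed.

Lemma sqnM z w : sqn (z * w) = sqn z * sqn w.
Proof. by rewrite /sqn !ReImE; ring. Qed.

Lemma sqnE z : (sqn z)%:C = conjc z * z.
Proof. by apply: complex_ext; rewrite /sqn !ReImE /=; ring. Qed.

Lemma sqnD z w : sqn (z + w) <= 2 * sqn z + 2 * sqn w.
Proof.
rewrite /sqn !ReImE.
have := sqr_ge0 (complex.Re z - complex.Re w).
by have := sqr_ge0 (complex.Im z - complex.Im w); nra.
Qed.

Lemma na_expi (t : R) : na (expi t) <= 2.
Proof.
rewrite -[2]/(1 + 1 : R) /na /=; apply: lerD.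
  by rewrite ler_norml cos_geN1 cos_le1.
by rewrite ler_norml sin_geN1 sin_le1.
Qed.

Lemma expiD (s t : R) : expi (s + t) = expi s * expi t.
Proof.
by apply: complex_ext; rewrite ReImE /= ?cosD ?sinD //; ring.
Qed.

Lemma expi0 : expi (0 : R) = 1.
Proof. by rewrite /expi cos0 sin0. Qed.

Lemma expiN (t : R) : expi (- t) = conjc (expi t).
Proof. by rewrite /expi cosN sinN. Qed.

Lemma sqn_expi (t : R) : sqn (expi t) = 1.
Proof. by rewrite /sqn /= cos2Dsin2. Qed.

(* Coordinatewise convergence, which avoids the R[i]-topology. *)
Definition ccvg (u : nat -> R[i]) (l : R[i]) : Prop :=
  ((fun n => complex.Re (u n)) @ \oo --> complex.Re l) /\
  ((fun n => complex.Im (u n)) @ \oo --> complex.Im l).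

Lemma ccvg_cst l : ccvg (fun=> l) l.
Proof. by split; exact: cvg_cst. Qed.

Lemma ccvgD u v l m : ccvg u l -> ccvg v m -> ccvg (fun n => u n + v n) (l + m).
Proof.
move=> [u1 u2] [v1 v2]; split.
  under eq_fun do rewrite ReD.
  by rewrite ReD; exact: cvgD.
under eq_fun do rewrite ImD.
by rewrite ImD; exact: cvgD.
Qed.

Lemma ccvgM u v l m : ccvg u l -> ccvg v m -> ccvg (fun n => u n * v n) (l * m).
Proof.
move=> [u1 u2] [v1 v2]; split.
  under eq_fun do rewrite ReM.
  by rewrite ReM; apply: cvgB; exact: cvgM.
under eq_fun do rewrite ImM.
by rewrite ImM; apply: cvgD; exact: cvgM.
Qed.

Lemma ccvg_sum (I : Type) (s : seq I) (P : pred I) (u : I -> nat -> R[i]) l :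
  (forall i, P i -> ccvg (u i) (l i)) ->
  ccvg (fun n => \sum_(i <- s | P i) u i n) (\sum_(i <- s | P i) l i).
Proof.
move=> ul; elim: s => [|i s IH].
  by rewrite big_nil; under eq_fun do rewrite big_nil; exact: ccvg_cst.
rewrite big_cons; under eq_fun do rewrite big_cons.
by case: ifP => // Pi; apply: ccvgD => //; exact: ul.
Qed.

Lemma ccvg_unique u l m : ccvg u l -> ccvg u m -> l = m.
Proof.
move=> [u1 u2] [v1 v2]; apply: complex_ext.
  exact: (cvg_unique _ u1 v1).
exact: (cvg_unique _ u2 v2).
Qed.

End ComplexAux.

(** * Complex-valued integrals *)

Section ComplexIntegral.
Context d (T : measurableType d) (R : realType).
Implicit Types (f g : T -> R[i]).

Definition cmf f : Prop :=
  measurable_fun setT (fun x => complex.Re (f x)) /\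
  measurable_fun setT (fun x => complex.Im (f x)).

Lemma cmf_cst (z : R[i]) : cmf (fun=> z).
Proof. by split; exact: measurable_cst. Qed.

Lemma cmfD f g : cmf f -> cmf g -> cmf (fun x => f x + g x).
Proof.
move=> [f1 f2] [g1 g2]; split.
  by under eq_fun do rewrite ReD; exact: measurable_funD.
by under eq_fun do rewrite ImD; exact: measurable_funD.
Qed.

Lemma cmfM f g : cmf f -> cmf g -> cmf (fun x => f x * g x).
Proof.
move=> [f1 f2] [g1 g2]; split.
  by under eq_fun do rewrite ReM; apply: measurable_funB; exact: measurable_funM.
by under eq_fun do rewrite ImM; apply: measurable_funD; exact: measurable_funM.
Qed.

Lemma cmfN f : cmf f -> cmf (fun x => - f x).
Proof.
move=> [f1 f2]; split.
  by under eq_fun do rewrite ReN; exact: measurable_funN.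
by under eq_fun do rewrite ImN; exact: measurable_funN.
Qed.

Lemma cmfB f g : cmf f -> cmf g -> cmf (fun x => f x - g x).
Proof. by move=> mf mg; apply: cmfD => //; exact: cmfN. Qed.

Lemma cmfJ f : cmf f -> cmf (fun x => conjc (f x)).
Proof.
move=> [f1 f2]; split.
  by under eq_fun do rewrite ReJ.
by under eq_fun do rewrite ImJ; exact: measurable_funN.
Qed.

Lemma cmf_sum (I : Type) (s : seq I) (P : pred I) (F : I -> T -> R[i]) :
  (forall i, P i -> cmf (F i)) -> cmf (fun x => \sum_(i <- s | P i) F i x).
Proof.
move=> mF; elim: s => [|i s IH].
  by under eq_fun do rewrite big_nil; exact: cmf_cst.
under eq_fun do rewrite big_cons.
by case Pi: (P i) => //; apply: cmfD => //; exact: mF.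
Qed.

Lemma cmf_prod (I : Type) (s : seq I) (P : pred I) (F : I -> T -> R[i]) :
  (forall i, P i -> cmf (F i)) -> cmf (fun x => \prod_(i <- s | P i) F i x).
Proof.
move=> mF; elim: s => [|i s IH].
  by under eq_fun do rewrite big_nil; exact: cmf_cst.
under eq_fun do rewrite big_cons.
by case Pi: (P i) => //; apply: cmfM => //; exact: mF.
Qed.

Lemma cmf_real (h : T -> R) : measurable_fun setT h -> cmf (fun x => (h x)%:C).
Proof. by move=> mh; split => //; exact: measurable_cst. Qed.

Lemma cmf_expi (h : T -> R) : measurable_fun setT h -> cmf (fun x => expi (h x)).
Proof.
move=> mh; split => /=.
  apply: (measurableT_comp _ mh); apply: continuous_measurable_fun.
  exact: continuous_cos.
apply: (measurableT_comp _ mh); apply: continuous_measurable_fun.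
exact: continuous_sin.
Qed.

Lemma measurable_na f : cmf f -> measurable_fun setT (fun x => na (f x)).
Proof.
by move=> [f1 f2]; apply: measurable_funD; exact: measurableT_comp.
Qed.

Lemma measurable_sqn f : cmf f -> measurable_fun setT (fun x => sqn (f x)).
Proof.
by move=> [f1 f2]; apply: measurable_funD; exact: measurable_funX.
Qed.

Lemma cmf_cvg (u : nat -> T -> R[i]) f : (forall n, cmf (u n)) ->
  (forall x, ccvg (u ^~ x) (f x)) -> cmf f.
Proof.
move=> mu uf; split.
  by apply: (measurable_fun_cvg (fun n => (mu n).1)) => x _; exact: (uf x).1.
by apply: (measurable_fun_cvg (fun n => (mu n).2)) => x _; exact: (uf x).2.
Qed.

Variable mu : {measure set T -> \bar R}.

Definition cintegral f : R[i] :=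
  Rintegral mu setT (fun x => complex.Re (f x)) +i*
  Rintegral mu setT (fun x => complex.Im (f x)).

Definition cintegrable f : Prop :=
  cmf f /\ (\int[mu]_x (na (f x))%:E < +oo)%E.

Lemma cintegrableP f : cintegrable f ->
  mu.-integrable setT (fun x => (complex.Re (f x))%:E) /\
  mu.-integrable setT (fun x => (complex.Im (f x))%:E).
Proof.
move=> [mf fi].
have ni : mu.-integrable setT (fun x => (na (f x))%:E).
  apply/integrableP; split.
    by apply/measurable_EFinP; exact: measurable_na.
  apply: le_lt_trans fi; rewrite le_eqVlt; apply/orP; left; apply/eqP.
  by apply: eq_integral => x _; rewrite gee0_abs// lee_fin na_ge0.
split; apply: le_integrable ni => //.
- by apply/measurable_EFinP; exact: mf.1.
- by move=> x _ /=; rewrite lee_fin [leRHS]ger0_norm ?na_ge0// na_Re.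
- by apply/measurable_EFinP; exact: mf.2.
- by move=> x _ /=; rewrite lee_fin [leRHS]ger0_norm ?na_ge0// na_Im.
Qed.

Lemma cintegrable_of f :
  mu.-integrable setT (fun x => (complex.Re (f x))%:E) ->
  mu.-integrable setT (fun x => (complex.Im (f x))%:E) -> cintegrable f.
Proof.
move=> i1 i2.
have m1 := measurable_int mu i1; have m2 := measurable_int mu i2.
split; first by split; apply/measurable_EFinP.
have /integrableP[_] := integrableD measurableT (integrable_abse i1) (integrable_abse i2).
apply: le_lt_trans; rewrite le_eqVlt; apply/orP; left; apply/eqP.
apply: eq_integral => x _ /=.
by rewrite ger0_norm ?addr_ge0.
Qed.

Lemma le_cintegrable f (g : T -> R) : cmf f ->
  mu.-integrable setT (EFin \o g) ->
  (forall x, na (f x) <= g x) -> cintegrable f.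
Proof.
move=> mf gi fg; split=> //.
move/integrableP : gi => [mg]; apply: le_lt_trans.
apply: ge0_le_integral => //.
- by move=> x _; rewrite lee_fin na_ge0.
- by apply/measurable_EFinP; exact: measurable_na.
- exact: measurableT_comp.
- move=> x _ /=; rewrite lee_fin; apply: (le_trans (fg x)); exact: ler_norm.
Qed.

Lemma na_integrable f : cintegrable f ->
  mu.-integrable setT (fun x => (na (f x))%:E).
Proof.
move=> [mf fi]; apply/integrableP; split.
  by apply/measurable_EFinP; exact: measurable_na.
apply: le_lt_trans fi; rewrite le_eqVlt; apply/orP; left; apply/eqP.
by apply: eq_integral => x _; rewrite gee0_abs// lee_fin na_ge0.
Qed.

Lemma cintegrableD f g : cintegrable f -> cintegrable g ->
  cintegrable (fun x => f x + g x).
Proof.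
move=> fi gi; apply: (@le_cintegrable _ (fun x => na (f x) + na (g x))).
- by apply: cmfD; [exact: fi.1|exact: gi.1].
- exact: (integrableD measurableT (na_integrable fi) (na_integrable gi)).
- by move=> x; exact: naD.
Qed.

Lemma cintegrableZ (z : R[i]) f : cintegrable f -> cintegrable (fun x => z * f x).
Proof.
move=> fi; apply: (@le_cintegrable _ (fun x => na z * na (f x))).
- by apply: cmfM; [exact: cmf_cst|exact: fi.1].
- by apply: (integrableZl measurableT (na z) (na_integrable fi)).
- by move=> x; exact: naM.
Qed.

Lemma cintegrableN f : cintegrable f -> cintegrable (fun x => - f x).
Proof.
move=> fi; under eq_fun do rewrite -mulN1r; exact: cintegrableZ.
Qed.

Lemma cintegrableJ f : cintegrable f -> cintegrable (fun x => conjc (f x)).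
Proof.
move=> [mf fi]; split; first exact: cmfJ.
by under eq_integral do rewrite naJ.
Qed.

Lemma cintegrable_bM (h : T -> R[i]) f (C : R) : cmf h ->
  (forall x, na (h x) <= C) -> cintegrable f -> cintegrable (fun x => h x * f x).
Proof.
move=> mh hC fi; apply: (@le_cintegrable _ (fun x => C * na (f x))).
- by apply: cmfM => //; exact: fi.1.
- by apply: (integrableZl measurableT C (na_integrable fi)).
- move=> x; apply: (le_trans (naM _ _)); apply: ler_wpM2r => //; exact: na_ge0.
Qed.

Lemma cintegrable_sum (I : Type) (s : seq I) (P : pred I) (F : I -> T -> R[i]) :
  (forall i, P i -> cintegrable (F i)) ->
  cintegrable (fun x => \sum_(i <- s | P i) F i x).
Proof.
move=> mF; elim: s => [|i s IH].
  under eq_fun do rewrite big_nil; split; first exact: cmf_cst.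
  by under eq_integral do rewrite na0; rewrite integral0.
under eq_fun do rewrite big_cons.
by case Pi: (P i) => //; apply: cintegrableD => //; exact: mF.
Qed.

Lemma cintegralD f g : cintegrable f -> cintegrable g ->
  cintegral (fun x => f x + g x) = cintegral f + cintegral g.
Proof.
move=> /cintegrableP[f1 f2] /cintegrableP[g1 g2]; apply: complex_ext => /=.
  by under eq_Rintegral do rewrite ReD; rewrite RintegralD.
by under eq_Rintegral do rewrite ImD; rewrite RintegralD.
Qed.

Lemma cintegralZ (z : R[i]) f : cintegrable f ->
  cintegral (fun x => z * f x) = z * cintegral f.
Proof.
move=> /cintegrableP[f1 f2].
have Zi (k : R) (h : T -> R) : mu.-integrable setT (fun x => (h x)%:E) ->
  mu.-integrable setT (EFin \o (fun x => k * h x)).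
  by move=> hi; exact: (integrableZl measurableT k hi).
apply: complex_ext.
  rewrite ReM /=; under eq_Rintegral do rewrite ReM.
  by rewrite RintegralB ?RintegralZl//; exact: Zi.
rewrite ImM /=; under eq_Rintegral do rewrite ImM.
by rewrite RintegralD ?RintegralZl//; exact: Zi.
Qed.

Lemma cintegralN f : cintegrable f -> cintegral (fun x => - f x) = - cintegral f.
Proof.
move=> fi; under eq_fun do rewrite -mulN1r.
by rewrite cintegralZ// mulN1r.
Qed.

Lemma cintegralB f g : cintegrable f -> cintegrable g ->
  cintegral (fun x => f x - g x) = cintegral f - cintegral g.
Proof.
by move=> fi gi; rewrite cintegralD ?cintegralN//; exact: cintegrableN.
Qed.

Lemma cintegralJ f : cintegrable f ->
  cintegral (fun x => conjc (f x)) = conjc (cintegral f).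
Proof.
move=> /cintegrableP[f1 f2]; apply: complex_ext; rewrite /= ?ReJ ?ImJ /=.
  by under eq_Rintegral do rewrite ReJ.
under eq_Rintegral do rewrite ImJ -mulN1r.
by rewrite RintegralZl// mulN1r.
Qed.

Lemma cintegral_sum (I : Type) (s : seq I) (P : pred I) (F : I -> T -> R[i]) :
  (forall i, P i -> cintegrable (F i)) ->
  cintegral (fun x => \sum_(i <- s | P i) F i x) =
  \sum_(i <- s | P i) cintegral (F i).
Proof.
move=> mF; elim: s => [|i s IH].
  rewrite big_nil; under eq_fun do rewrite big_nil.
  by rewrite /cintegral /Rintegral !integral0.
rewrite big_cons; under eq_fun do rewrite big_cons.
case: ifP => // Pi; rewrite cintegralD ?IH//; first exact: mF.
exact: cintegrable_sum.
Qed.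

Lemma na_cintegral f : cintegrable f ->
  ((na (cintegral f))%:E <= \int[mu]_x (na (f x))%:E)%E.
Proof.
move=> /cintegrableP[f1 f2].
rewrite /na /= EFinD !EFin_normr_Rintegral//.
under [leRHS]eq_integral do rewrite EFinD.
rewrite ge0_integralD//; last 2 first.
- by apply: measurableT_comp => //; apply/measurableT_comp => //; apply/measurable_EFinP; exact: measurable_int f1.
- by apply: measurableT_comp => //; apply/measurableT_comp => //; apply/measurable_EFinP; exact: measurable_int f2.
by apply: leeD; apply: le_abse_integral => //; [exact: measurable_int f1|exact: measurable_int f2].
Qed.

Lemma ae_eq_cintegral f g : cmf f -> cmf g ->
  {ae mu, forall x, f x = g x} -> cintegral f = cintegral g.
Proof.
move=> mf mg fg; rewrite /cintegral /Rintegral; congr (fine _ +i* fine _).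
  apply: ae_eq_integral => //; try by apply/measurable_EFinP; [exact: mf.1|exact: mg.1].
  - by apply/measurable_EFinP; exact: mf.1.
  - by apply/measurable_EFinP; exact: mg.1.
  - by apply: filterS fg => x -> _.
apply: ae_eq_integral => //.
- by apply/measurable_EFinP; exact: mf.2.
- by apply/measurable_EFinP; exact: mg.2.
- by apply: filterS fg => x -> _.
Qed.

Lemma dominated_ccvg (u : nat -> T -> R[i]) f (g : T -> R) :
  (forall n, cmf (u n)) -> (forall x, ccvg (u ^~ x) (f x)) ->
  mu.-integrable setT (EFin \o g) -> (forall n x, na (u n x) <= g x) ->
  ccvg (fun n => cintegral (u n)) (cintegral f).
Proof.
move=> mu_ uf gi ug; have mf := cmf_cvg mu_ uf.
(* Real and imaginary parts are handled at once, as coordinates [h] dominated by [na]. *)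
have key (h : R[i] -> R) : (forall z, `|h z| <= na z) ->
    (forall n, measurable_fun setT (h \o u n)) -> measurable_fun setT (h \o f) ->
    (forall x, (fun n => h (u n x)) @ \oo --> h (f x)) ->
    (fun n => \int[mu]_x h (u n x)) @ \oo --> \int[mu]_x h (f x).
  move=> hna mhu mhf hcvg.
  have [] := @dominated_convergence _ _ _ mu _ measurableT
    (fun n x => (h (u n x))%:E) (fun x => (h (f x))%:E) (EFin \o g).
  - by move=> n; apply/measurable_EFinP; exact: mhu.
  - by apply/measurable_EFinP; exact: mhf.
  - by apply: nearW => x _; apply/fine_cvgP; split; [exact: nearW|exact: hcvg].
  - exact: gi.
  - by apply: nearW => x n _ /=; rewrite lee_fin (le_trans (hna _)).
  move=> fi _; rewrite /Rintegral -[X in _ --> X -> _]fineK ?integrable_fin_num//.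
  by move/fine_cvg.
split; apply: key.
- exact: na_Re.
- by move=> n; exact: (mu_ n).1.
- exact: mf.1.
- by move=> x; exact: (uf x).1.
- exact: na_Im.
- by move=> n; exact: (mu_ n).2.
- exact: mf.2.
- by move=> x; exact: (uf x).2.
Qed.

Lemma dominated_cintegrable (u : nat -> T -> R[i]) f (g : T -> R) :
  (forall n, cmf (u n)) -> (forall x, ccvg (u ^~ x) (f x)) ->
  mu.-integrable setT (EFin \o g) -> (forall n x, na (u n x) <= g x) ->
  cintegrable f.
Proof.
move=> mu_ uf gi ug.
apply: (@le_cintegrable _ g) => //; first exact: (cmf_cvg mu_ uf).
move=> x; have [h1 h2] := uf x.
have h : (fun n => na (u n x)) @ \oo --> na (f x).
  by apply: cvgD; exact: cvg_norm.
by apply: (cvgr_to_le h); apply: nearW => n; exact: ug.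
Qed.

Lemma finite_cintegrable f (C : R) : (mu setT < +oo)%E -> cmf f ->
  (forall x, na (f x) <= C) -> cintegrable f.
Proof.
move=> fmu mf fC; apply: (@le_cintegrable _ (fun=> C)) => //.
apply/integrableP; split; first by apply/measurable_EFinP; exact: measurable_cst.
by rewrite /= integral_cst// lte_mul_pinfty.
Qed.

End ComplexIntegral.

(** * Finite powers of a finite measure *)

Section PowerMeasure.
Context d (T : measurableType d) (R : realType).

Definition tcons m (x : T * m.-tuple T) : m.+1.-tuple T := [tuple of x.1 :: x.2].

Lemma measurable_tcons m : measurable_fun setT (@tcons m).
Proof.
by apply: (@measurable_cons _ _ _ _ fst m snd).
Qed.

Lemma measurable_tcons2 m (u : T) :
  measurable_fun setT (fun t : m.-tuple T => tcons (u, t)).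
Proof. by apply: measurableT_comp; [exact: measurable_tcons|]. Qed.

Variable P : {finite_measure set T -> \bar R}.

Section Succ.
Variables (m : nat) (Q : {finite_measure set (m.-tuple T) -> \bar R}).

(** Transporting the product measure along [tcons] keeps powers of a measure on genuine tuples, and
    [pw] then unfolds by Tonelli one coordinate at a time. The total mass may differ from 1, as it
    does for the box. *)
Definition pwS : set (m.+1.-tuple T) -> \bar R := pushforward (P \x Q)%E (@tcons m).

Let pwS0 : pwS set0 = 0%E.
Proof. by rewrite /pwS /pushforward preimage_set0 measure0. Qed.

Let pwS_ge0 A : (0 <= pwS A)%E.
Proof. exact: (measure_ge0 (P \x Q)%E). Qed.

Let pwS_add : semi_sigma_additive pwS.
Proof.
have mtc A : measurable A -> measurable (@tcons m @^-1` A).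
  by move=> mA; rewrite -[X in measurable X]setTI; exact: measurable_tcons.
move=> F mF tF mUF; rewrite /pwS /pushforward preimage_bigcup.
apply: measure_semi_sigma_additive.
- by move=> n; exact: mtc.
- apply/trivIsetP => /= i j _ _ ij; rewrite -preimage_setI.
  by move/trivIsetP : tF => /(_ _ _ _ _ ij) ->//; rewrite preimage_set0.
- by rewrite -preimage_bigcup; exact: mtc.
Qed.

HB.instance Definition _ := isMeasure.Build _ _ _ pwS pwS0 pwS_ge0 pwS_add.
Let pwS_fin : fin_num_fun pwS.
Proof.
move=> A mA; rewrite ge0_fin_numE//.
apply: (@le_lt_trans _ _ (pwS setT)); first by apply: le_measure => //; rewrite inE.
rewrite /pwS /pushforward preimage_setT -setXTT product_measure1E//.
by rewrite lte_mul_pinfty// -?ge0_fin_numE// fin_num_measure.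
Qed.

HB.instance Definition _ := Measure_isFinite.Build _ _ _ pwS pwS_fin.

End Succ.

Fixpoint pw m : {finite_measure set (m.-tuple T) -> \bar R} :=
  if m is m'.+1 then pwS (pw m') else dirac [tuple].

Lemma integral_pw0 (f : 0.-tuple T -> \bar R) : measurable_fun setT f ->
  (\int[pw 0]_t f t = f [tuple])%E.
Proof. by move=> mf; rewrite integral_dirac// diracT mul1e. Qed.

Local Open Scope ereal_scope.

Lemma integral_pw_prod m (f : m.+1.-tuple T -> \bar R) : measurable_fun setT f ->
  \int[pw m.+1]_t f t = \int[(P \x pw m)%E]_x f (tcons x).
Proof.
move=> mf.
have key (g : m.+1.-tuple T -> \bar R) : measurable_fun setT g -> (forall t, 0 <= g t) ->
    \int[pw m.+1]_t g t = \int[(P \x pw m)%E]_x g (tcons x).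
  move=> mg g0.
  by rewrite -(@ge0_integral_pushforward _ _ _ _ _ _ (@measurable_tcons m) _ setT g).
rewrite integralE (key f^\+) ?(key f^\-).
- by rewrite [RHS]integralE; congr (_ - _); apply: eq_integral => x _; rewrite ?funeposE ?funenegE.
- exact: measurable_funeneg.
- by move=> t; exact: funeneg_ge0.
- exact: measurable_funepos.
- by move=> t; exact: funepos_ge0.
Qed.

Lemma integral_pwS m (f : m.+1.-tuple T -> \bar R) : measurable_fun setT f ->
  (forall t, 0 <= f t) ->
  \int[pw m.+1]_t f t = \int[P]_u \int[pw m]_t f (tcons (u, t)).
Proof.
move=> mf f0; rewrite integral_pw_prod//.
have mft : measurable_fun setT (f \o @tcons m).
  by apply: measurableT_comp => //; exact: measurable_tcons.
have ft0 x : 0 <= (f \o @tcons m) x by exact: f0.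
exact: fubini_tonelli1.
Qed.

Lemma measurable_pw_tcons m (f : m.+1.-tuple T -> \bar R) : measurable_fun setT f ->
  (forall t, 0 <= f t) ->
  measurable_fun setT (fun u => \int[pw m]_t f (tcons (u, t))).
Proof.
move=> mf f0.
have mft : measurable_fun setT (f \o @tcons m).
  by apply: measurableT_comp => //; exact: measurable_tcons.
have ft0 x : 0 <= (f \o @tcons m) x by exact: f0.
exact: (@measurable_fun_fubini_tonelli_F _ _ _ _ _ (pw m) (f \o @tcons m)).
Qed.

Opaque pw.

Definition trcons m (t : m.-tuple T) (u : T) : m.+1.-tuple T := [tuple of rcons t u].

Lemma measurable_trcons m :
  measurable_fun setT (fun x : T * m.-tuple T => trcons x.2 x.1).
Proof.
apply/measurable_fun_tnthP => i.
have [im|im] := ltnP i m.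
  rewrite (_ : _ \o _ = (@tnth _ T ^~ (Ordinal im)) \o snd).
    by apply: measurableT_comp => //; exact: measurable_tnth.
  apply/funext => -[u t] /=; rewrite (tnth_nth u) /= nth_rcons size_tuple im.
  by rewrite (tnth_nth u).
rewrite (_ : _ \o _ = fst)//.
apply/funext => -[u t] /=; rewrite (tnth_nth u) /= nth_rcons size_tuple ltnNge im /=.
by rewrite (_ : _ == _ = true)//; apply/eqP/anti_leq; rewrite im -ltnS ltn_ord.
Qed.

Lemma trcons_tcons m (a u : T) (t : m.-tuple T) :
  trcons (tcons (a, t)) u = tcons (a, trcons t u).
Proof. exact/val_inj. Qed.

(** [pw] peels off the first coordinate, whereas the outermost integral of [iint_aux] runs over the
    last one; this reconciles the two. In the induction Tonelli swaps the first and the last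
    coordinate. *)
Lemma integral_pw_trcons m (f : m.+1.-tuple T -> \bar R) : measurable_fun setT f ->
  (forall t, 0 <= f t) ->
  \int[pw m.+1]_t f t = \int[P]_u \int[pw m]_t f (trcons t u).
Proof.
elim: m f => [|m IH] f mf f0.
  rewrite (integral_pwS mf f0); apply: eq_integral => u _.
  rewrite !integral_pw0.
  - by congr f; apply/val_inj.
  - by apply: measurableT_comp => //; exact: (measurableT_comp (@measurable_trcons _) (pair1_measurable u)).
  - by apply: measurableT_comp => //; exact: measurable_tcons2.
rewrite (integral_pwS mf f0).
transitivity (\int[P]_a \int[P]_u \int[pw m]_t f (tcons (a, trcons t u))).
  apply: eq_integral => a _; rewrite (IH (fun t => f (tcons (a, t))))//.
  by apply: measurableT_comp => //; exact: measurable_tcons2.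
have mg : measurable_fun setT
    (fun x : (T * T) * m.-tuple T => f (tcons (x.1.1, trcons x.2 x.1.2))).
  apply: measurableT_comp => //.
  apply: (@measurableT_comp _ _ _ _ _ _ (@tcons m.+1)); first exact: measurable_tcons.
  apply/measurable_fun_pairP; split => /=.
    exact: (measurableT_comp measurable_fst measurable_fst).
  apply: (@measurableT_comp _ _ _ _ _ _ (fun x : T * m.-tuple T => trcons x.2 x.1) _
    (fun x : (T * T) * m.-tuple T => (x.1.2, x.2))); first exact: measurable_trcons.
  apply: measurable_fun_pair => //.
  exact: (measurableT_comp measurable_snd measurable_fst).
have mh : measurable_fun setT
    (fun x : T * T => \int[pw m]_t f (tcons (x.1, trcons t x.2))).
  apply: (@measurable_fun_fubini_tonelli_F _ _ _ _ _ (pw m)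
    (fun x : (T * T) * m.-tuple T => f (tcons (x.1.1, trcons x.2 x.1.2)))) => //.
rewrite (@fubini_tonelli _ _ _ _ _ P P
  (fun x : T * T => \int[pw m]_t f (tcons (x.1, trcons t x.2))))//=; last first.
  by move=> x; apply: integral_ge0 => *; exact: f0.
apply: eq_integral => u _; rewrite integral_pwS.
- by under eq_integral do under eq_integral do rewrite -trcons_tcons.
- apply: measurableT_comp => //.
  exact: (measurableT_comp (@measurable_trcons _) (pair1_measurable u)).
- by move=> t; exact: f0.
Qed.

(** The maps are indexed by [nat] rather than by ['I_m], so that removing the first coordinate only
    shifts the index. *)
Definition tmap m (tau : nat -> T -> T) (t : m.-tuple T) : m.-tuple T :=
  [tuple tau i (tnth t i) | i < m].

Lemma measurable_tmap m (tau : nat -> T -> T) :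
  (forall i, measurable_fun setT (tau i)) -> measurable_fun setT (@tmap m tau).
Proof.
move=> mtau; apply/measurable_fun_tnthP => i.
rewrite (_ : _ \o _ = tau i \o (@tnth _ T ^~ i)).
  by apply: measurableT_comp => //; exact: measurable_tnth.
by apply/funext => t /=; rewrite tnth_mktuple.
Qed.

Lemma tmap_tcons m (tau : nat -> T -> T) u (t : m.-tuple T) :
  tmap tau (tcons (u, t)) = tcons (tau 0%N u, tmap (fun i => tau i.+1) t).
Proof.
apply: eq_from_tnth => i; rewrite tnth_mktuple.
have [j ->|->] := unliftP ord0 i; last by [].
by rewrite !tnthS tnth_mktuple.
Qed.

(** Invariance passes from one factor to the power, one coordinate at a time. Both translations and
    the reduction to the box are treated this way. *)
Lemma integral_pw_tmap m (tau : nat -> T -> T) (f : m.-tuple T -> \bar R) :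
  (forall i, measurable_fun setT (tau i)) ->
  (forall i (h : T -> \bar R), measurable_fun setT h -> (forall u, 0 <= h u) ->
    \int[P]_u h (tau i u) = \int[P]_u h u) ->
  measurable_fun setT f -> (forall t, 0 <= f t) ->
  \int[pw m]_t f (tmap tau t) = \int[pw m]_t f t.
Proof.
elim: m tau f => [|m IH] tau f mtau itau mf f0.
  rewrite !integral_pw0//; first by rewrite (tuple0 (tmap tau _)).
  by apply: measurableT_comp => //; exact: measurable_tmap.
have mft : measurable_fun setT (f \o tmap tau).
  by apply: measurableT_comp => //; exact: measurable_tmap.
rewrite (integral_pwS mft)//; last by move=> t; exact: f0.
under eq_integral do under eq_integral do rewrite /= tmap_tcons.
rewrite [RHS](integral_pwS mf f0).
rewrite -(itau 0%N (fun u => \int[pw m]_t f (tcons (u, t)))); last 2 first.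
- exact: measurable_pw_tcons.
- by move=> u; apply: integral_ge0 => *; exact: f0.
apply: eq_integral => u _.
rewrite (IH (fun i => tau i.+1) (fun t => f (tcons (tau 0%N u, t))))//.
- by move=> i h mh h0; exact: itau.
- by apply: measurableT_comp => //; exact: measurable_tcons2.
Qed.

Lemma pw_setT m : pw m setT = P setT ^+ m.
Transparent pw.
Proof.
elim: m => [|m IH]; first exact: diracT.
rewrite -[LHS]/((P \x pw m) (@tcons m @^-1` setT)).
rewrite preimage_setT -setXTT product_measure1E// expeS.
by congr (_ * _); exact: IH.
Qed.

Opaque pw.

Lemma measurable_thead m : measurable_fun setT (fun t : m.+1.-tuple T => thead t).
Proof. exact: (@measurable_tnth _ _ _ ord0). Qed.

Definition tbehead m (t : m.+1.-tuple T) : m.-tuple T := [tuple of behead t].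

Lemma tcons_eta m (t : m.+1.-tuple T) : t = tcons (thead t, tbehead t).
Proof. by rewrite [LHS]tuple_eta; exact/val_inj. Qed.

Lemma tbehead_tcons m u (t : m.-tuple T) : tbehead (tcons (u, t)) = t.
Proof. exact/val_inj. Qed.

Local Close Scope ereal_scope.

Lemma Rintegral_prodM d' (T' : measurableType d') (Q : {finite_measure set T' -> \bar R})
    (a : T -> R) (b : T' -> R) :
  P.-integrable setT (EFin \o a) -> Q.-integrable setT (EFin \o b) ->
  (P \x Q)%E.-integrable setT (EFin \o (fun x => a x.1 * b x.2)) /\
  \int[(P \x Q)%E]_x (a x.1 * b x.2) = (\int[P]_x a x) * (\int[Q]_x b x).
Proof.
move=> ia ib.
have ma : measurable_fun setT a by apply/measurable_EFinP; exact: measurable_int ia.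
have mb : measurable_fun setT b by apply/measurable_EFinP; exact: measurable_int ib.
have mab : measurable_fun setT (fun x : T * T' => (a x.1 * b x.2)%:E).
  apply/measurable_EFinP; apply: measurable_funM.
    exact: (measurableT_comp ma measurable_fst).
  exact: (measurableT_comp mb measurable_snd).
have iab : (P \x Q)%E.-integrable setT (fun x => (a x.1 * b x.2)%:E).
  apply: (@integrable12ltyP _ _ _ _ _ P Q _ mab).2 => /=.
  under eq_integral do under eq_integral do rewrite normrM EFinM.
  under eq_integral => x _.
    rewrite integralZl//; last exact: (integrable_abse ib).
    over.
  have /integrableP[_ fa] := ia; have /integrableP[_ fb] := ib.
  rewrite ge0_integralZr//.
  - rewrite lte_mul_pinfty//.
    + by apply: integral_ge0.
    + by rewrite ge0_fin_numE//; apply: integral_ge0.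
  - by apply/measurable_EFinP; exact: measurableT_comp.
  - exact: integral_ge0.
split=> //.
have e x : (\int[Q]_y (a x * b y)%:E = (a x)%:E * (\int[Q]_y b y)%:E)%E.
  under eq_integral do rewrite EFinM.
  by rewrite integralZl// [X in (_ * X)%E = _](esym (fineK _))//; exact: integrable_fin_num.
rewrite [LHS]/Rintegral -(integral12_prod_meas1 iab).
rewrite (eq_integral (fun x => (a x)%:E * (\int[Q]_y b y)%:E)%E); last by move=> x _; exact: e.
by rewrite integralZr// fineM//; exact: integrable_fin_num.
Qed.

Lemma cintegral_prodM d' (T' : measurableType d') (Q : {finite_measure set T' -> \bar R})
    (a : T -> R[i]) (b : T' -> R[i]) :
  cintegrable P a -> cintegrable Q b ->
  cintegrable (P \x Q)%E (fun x => a x.1 * b x.2) /\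
  cintegral (P \x Q)%E (fun x => a x.1 * b x.2) = cintegral P a * cintegral Q b.
Proof.
move=> /cintegrableP[a1 a2] /cintegrableP[b1 b2].
have [i11 e11] := Rintegral_prodM a1 b1; have [i12 e12] := Rintegral_prodM a1 b2.
have [i21 e21] := Rintegral_prodM a2 b1; have [i22 e22] := Rintegral_prodM a2 b2.
split.
  apply: cintegrable_of.
    by under eq_fun do rewrite ReM; exact: (integrableB measurableT i11 i22).
  by under eq_fun do rewrite ImM; exact: (integrableD measurableT i12 i21).
apply: complex_ext; rewrite ?ReM ?ImM /=.
  by under [LHS]eq_Rintegral do rewrite ReM; rewrite RintegralB// e11 e22.
by under [LHS]eq_Rintegral do rewrite ImM; rewrite RintegralD// e12 e21.
Qed.

(** Independence of the first point and the remaining ones, in the form in which products over all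
    points are expanded later. *)
Lemma cintegral_pwSM m (a : T -> R[i]) (b : m.-tuple T -> R[i]) :
  cintegrable P a -> cintegrable (pw m) b ->
  cintegrable (pw m.+1) (fun t => a (thead t) * b (tbehead t)) /\
  cintegral (pw m.+1) (fun t => a (thead t) * b (tbehead t)) =
  cintegral P a * cintegral (pw m) b.
Proof.
move=> ia ib; have [iab <-] := cintegral_prodM ia ib.
have mab : cmf (fun t : m.+1.-tuple T => a (thead t) * b (tbehead t)).
  apply: cmfM.
    split; [exact: (measurableT_comp ia.1.1 (@measurable_thead m))|].
    exact: (measurableT_comp ia.1.2 (@measurable_thead m)).
  split; [exact: (measurableT_comp ib.1.1 (@measurable_behead _ _ m))|].
  exact: (measurableT_comp ib.1.2 (@measurable_behead _ _ m)).
have tb (x : T * m.-tuple T) : a (thead (tcons x)) * b (tbehead (tcons x)) = a x.1 * b x.2.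
  by case: x => u t; rewrite tbehead_tcons.
split.
  split => //.
  rewrite integral_pw_prod; last by apply/measurable_EFinP; exact: measurable_na.
  rewrite (eq_integral (fun x => (na (a x.1 * b x.2))%:E)); last by move=> x _; rewrite tb.
  exact: iab.2.
apply: complex_ext; rewrite /= /Rintegral; congr fine.
  rewrite integral_pw_prod; last by apply/measurable_EFinP; exact: mab.1.
  by apply: eq_integral => x _; rewrite tb.
rewrite integral_pw_prod; last by apply/measurable_EFinP; exact: mab.2.
by apply: eq_integral => x _; rewrite tb.
Qed.

End PowerMeasure.

(** * The circle R / LZ *)

Section Circle.
Context (R : realType).

Local Notation leb := (@lebesgue_measure R).
Local Notation mR := (measurableTypeR R).

(** The translated measure agrees with Lebesgue measure on half-open intervals, and these determine
    it. *)
Lemma lebesgue_measureDr (c : R) (A : set mR) : measurable A ->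
  leb ((fun x : mR => x + c : mR) @^-1` A) = leb A.
Proof.
move=> mA; have mc : measurable_fun setT (fun x : mR => x + c : mR).
  exact: measurable_funD.
pose nu := pushforward leb (fun x : mR => x + c : mR).
have nu_meas : exists nu' : {measure set mR -> \bar R}, forall B, nu' B = nu B.
  pose nu' : {measure set mR -> \bar R} := nu.
  by exists (nu' mc).
have [nu' nuE] := nu_meas.
rewrite -[LHS]nuE; apply/esym; apply: (@lebesgue_measure_unique R nu') => // _ [[a b]] _ <-.
rewrite nuE /= /nu /pushforward.
rewrite (_ : _ @^-1` _ = `]a - c, b - c]%classic); last first.
  by apply/seteqP; split => x /=; rewrite !in_itv /= ltrBlDr lerBrDr.
by rewrite !lebesgue_measure_itv/= !lte_fin ltrD2r; case: ifP => // _; rewrite -!EFinD; congr EFin; ring.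
Qed.

Variables (L : R) (hL : 0 < L).

Definition box1 : set R := `[- (L / 2), (L / 2)[%classic.

Lemma measurable_box1 : measurable box1.
Proof. exact: measurable_itv. Qed.

Let half_gt0 : 0 < L / 2. Proof. by rewrite divr_gt0. Qed.

Lemma lebesgue_box1 : leb box1 = L%:E.
Proof.
rewrite /box1 lebesgue_measure_itv /= lte_fin gtrN//.
by rewrite -EFinD; congr EFin; field.
Qed.

(* [lebesgue_measure] lives on [measurableTypeR R], whose display differs from
   the one of [R] itself; [mu1] is a measure on [R]. *)
Definition mu1_fun : set R -> \bar R := fun A => leb (A `&` box1).

Let mu1_0 : mu1_fun set0 = 0%E.
Proof. by rewrite /mu1_fun set0I measure0. Qed.

Let mu1_ge0 A : (0 <= mu1_fun A)%E.
Proof. exact: measure_ge0. Qed.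

Let mu1_add : semi_sigma_additive mu1_fun.
Proof.
exact: (@measure_semi_sigma_additive _ _ _ (@mrestr _ mR R box1 leb measurable_box1)).
Qed.

HB.instance Definition _ := isMeasure.Build _ _ _ mu1_fun mu1_0 mu1_ge0 mu1_add.

Let mu1_fin : fin_num_fun mu1_fun.
Proof.
move=> A mA; rewrite ge0_fin_numE//; apply: (@le_lt_trans _ _ (leb box1)).
  apply: le_measure => //; rewrite inE; last exact: measurable_box1.
  by apply: measurableI => //; exact: measurable_box1.
by rewrite lebesgue_box1 ltry.
Qed.

HB.instance Definition _ := Measure_isFinite.Build _ _ _ mu1_fun mu1_fin.

Definition mu1 : {finite_measure set R -> \bar R} := mu1_fun.

Lemma mu1E A : mu1 A = leb (A `&` box1).
Proof. by []. Qed.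

Lemma mu1_setT : mu1 setT = L%:E.
Proof. by rewrite mu1E setTI lebesgue_box1. Qed.

Lemma integral_mu1 (f : R -> \bar R) : measurable_fun setT f -> (forall u, 0 <= f u)%E ->
  (\int[mu1]_u f u = \int[leb]_(u in box1) f u)%E.
Proof.
move=> mf f0.
have mid : measurable_fun setT (fun x : mR => x : R).
  by move=> _ A mA; rewrite setTI.
pose mm : {measure set mR -> \bar R} := @mrestr _ mR R box1 leb measurable_box1.
have mf' : measurable_fun setT (f : mR -> \bar R) := mf.
transitivity (\int[mm]_u f u)%E.
  by rewrite -(@ge0_integral_pushforward _ _ _ _ _ (fun x : mR => x : R) mid mm setT f).
have mmC : mm (~` box1) = 0%E by rewrite /mm /= /mrestr setICl measure0.
have mC : measurable (~` box1 : set mR) by apply: measurableC; exact: measurable_box1.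
rewrite [LHS](@ge0_negligible_integral _ mR R mm setT (~` box1) f mC measurableT)//.
rewrite setTD setCK; apply: eq_measure_integral => A mA AD.
by rewrite /= /mrestr setIidl.
Qed.

(** One coordinate of the reduction to the box inside [per]. *)
Definition wrap1 (u : R) : R := u - L * (Num.floor ((u + L / 2) / L))%:~R.

Lemma measurable_wrap1 : measurable_fun setT wrap1.
Proof.
apply: measurable_funB => //; apply: measurable_funM => //.
apply: nondecreasing_measurable => // x y xy.
rewrite ler_int; apply: le_floor.
by rewrite ler_pM2r ?invr_gt0// lerD2r.
Qed.

Lemma box1P u : (u \in box1) = (- (L / 2) <= u) && (u < L / 2).
Proof. by apply/idP/idP; rewrite ?inE /box1 /= in_itv. Qed.

Lemma wrap1_in u : wrap1 u \in box1.
Proof.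
rewrite box1P /wrap1.
have /andP[h1 h2] := floor_itv ((u + L / 2) / L).
rewrite -(ler_pM2r hL) divfK ?gt_eqF// in h1.
rewrite -(ltr_pM2r hL) divfK ?gt_eqF// intrD mulrDl mul1r in h2.
by apply/andP; split; lra.
Qed.

Lemma wrap1_shift u (q : int) : wrap1 (u + L * q%:~R) = wrap1 u.
Proof.
rewrite /wrap1 (_ : (u + L * q%:~R + L / 2) / L = (u + L / 2) / L + q%:~R); last first.
  by field; rewrite gt_eqF.
by rewrite floorDrz// intrKfloor intrD; ring.
Qed.

Lemma wrap1_box u : u \in box1 -> wrap1 u = u.
Proof.
rewrite box1P => /andP[u1 u2]; rewrite /wrap1.
rewrite (_ : Num.floor _ = 0) ?mulr0 ?subr0//.
apply: floor_def; rewrite add0r; apply/andP; split.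
  by rewrite divr_ge0//; [lra|exact: ltW].
by rewrite ltr_pdivrMr// mul1r; lra.
Qed.

Lemma wrap1E u q : u - L * q%:~R \in box1 -> wrap1 u = u - L * q%:~R.
Proof.
move=> h; rewrite -[RHS](wrap1_box h) -[RHS](wrap1_shift _ q).
by congr wrap1; ring.
Qed.

Lemma wrap1_wrapD u v : wrap1 (wrap1 u + v) = wrap1 (u + v).
Proof.
rewrite -[RHS](wrap1_shift _ (- Num.floor ((u + L / 2) / L))).
by congr wrap1; rewrite /wrap1 rmorphN /=; ring.
Qed.

(** Lebesgue measure on the box is Haar measure of the circle: the shift cuts the box into an arc
    that stays and an arc that wraps around, and each is moved by a plain translation. *)
Lemma mu1_shift (s : R) (A : set R) : measurable A ->
  mu1 ((fun u => wrap1 (u + s)) @^-1` A) = mu1 A.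
Proof.
move=> mA.
(* Only [s] modulo [L] matters. Since [wrap1] lands in [[-L/2, L/2)], conjugating it with a shift by
   [L/2] gives the representative in [[0, L)]. *)
have [r [/andP[r0 rL] rs]] : exists r, (0 <= r) && (r < L) /\
    forall u, wrap1 (u + s) = wrap1 (u + r).
  exists (wrap1 (s - L / 2) + L / 2); split.
    have := wrap1_in (s - L / 2); rewrite box1P => /andP[h1 h2].
    by apply/andP; split; lra.
  move=> u; rewrite [RHS](_ : _ = wrap1 (wrap1 (s - L / 2) + (u + L / 2))).
    by rewrite wrap1_wrapD; congr wrap1; ring.
  by congr wrap1; ring.
have mBr : measurable (A `&` `[- (L / 2) + r, (L / 2)[%classic) by exact: measurableI.
have mBl : measurable (A `&` `[- (L / 2), - (L / 2) + r[%classic) by exact: measurableI.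
(* Points with [u + r < L/2] stay in the box, the others come back translated by [-L]; the images
   are the right and the left part of the box, separated at [-L/2 + r]. *)
have tE : (fun u => wrap1 (u + s)) @^-1` A `&` box1 =
  ((fun x : mR => x + r : mR) @^-1` (A `&` `[- (L / 2) + r, (L / 2)[%classic)) `|`
  ((fun x : mR => x + (r - L) : mR) @^-1` (A `&` `[- (L / 2), - (L / 2) + r[%classic)).
  apply/seteqP; split => u /=.
    rewrite rs /box1 /= !in_itv /= => -[Au /andP[u1 u2]].
    have [h|h] := ltP (u + r) (L / 2).
      left; split; last by lra.
      move: Au; rewrite wrap1_box// box1P; apply/andP; split; lra.
    right; split; last by lra.
    move: Au; rewrite (wrap1E (q := 1)) ?mulr1 ?addrA//.
    by rewrite box1P; apply/andP; split; lra.
  rewrite rs /box1 /= !in_itv /= => -[[Au /andP[u1 u2]]|[Au /andP[u1 u2]]].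
    split; last by lra.
    by rewrite wrap1_box// box1P; apply/andP; split; lra.
  split; last by lra.
  rewrite (wrap1E (q := 1)) ?mulr1 -?addrA//.
  by rewrite box1P; apply/andP; split; lra.
rewrite !mu1E tE.
have mp (c : R) (B : set mR) : measurable B -> measurable ((fun x : mR => x + c : mR) @^-1` B).
  by move=> mB; rewrite -[X in measurable X]setTI; exact: (measurable_funD _ _ measurableT).
transitivity (leb ((fun x : mR => (x + r)%R : mR) @^-1` (A `&` `[(- (L / 2) + r)%R, (L / 2)%R[%classic)) +
  leb ((fun x : mR => (x + (r - L))%R : mR) @^-1` (A `&` `[(- (L / 2))%R, (- (L / 2) + r)%R[%classic)))%E.
  apply: measureU; [exact: mp|exact: mp|].
  apply/seteqP; split => // u /= []; rewrite !in_itv /= => -[_ /andP[u1 u2]] [_ /andP[u3 u4]].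
  by lra.
rewrite !lebesgue_measureDr//.
transitivity (leb ((A `&` `[- (L / 2) + r, (L / 2)[%classic) `|` (A `&` `[- (L / 2), - (L / 2) + r[%classic))).
  apply/esym; apply: measureU => //.
  apply/seteqP; split => // u /= []; rewrite !in_itv /= => -[_ /andP[u1 u2]] [_ /andP[u3 u4]].
  by lra.
congr (leb _); rewrite -setIUr; congr (_ `&` _).
apply/seteqP; split => u; rewrite /box1 /= !in_itv /=.
  by case=> /andP[u1 u2]; apply/andP; split; lra.
move=> /andP[u1 u2].
by have [h|h] := ltP u (- (L / 2) + r); [right|left]; apply/andP; split; lra.
Qed.

Lemma measurable_shift1 (s : R) : measurable_fun setT (fun u : R => wrap1 (u + s)).
Proof. by apply: (measurableT_comp measurable_wrap1); exact: measurable_funD. Qed.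

Lemma integral_mu1_shift (s : R) (f : R -> \bar R) : measurable_fun setT f ->
  (forall u, 0 <= f u)%E -> (\int[mu1]_u f (wrap1 (u + s)) = \int[mu1]_u f u)%E.
Proof.
move=> mf f0; have ms := measurable_shift1 s.
rewrite -[LHS](@ge0_integral_pushforward _ _ _ _ _ _ ms mu1 setT f)//.
by apply: eq_measure_integral => A mA _; exact: mu1_shift.
Qed.

End Circle.

(** * Square-integrable functions *)

Section SquareIntegrable.
Context d (T : measurableType d) (R : realType) (mu : {finite_measure set T -> \bar R}).
Implicit Types f g h : T -> R[i].

Definition sqint f : Prop := cmf f /\ (\int[mu]_x (sqn (f x))%:E < +oo)%E.

Definition ip f g : R[i] := cintegral mu (fun x => conjc (f x) * g x).

Definition nrm2 f : R := \int[mu]_x sqn (f x).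

Lemma sqint_integrable f : sqint f -> mu.-integrable setT (EFin \o (fun x => sqn (f x))).
Proof.
move=> [mf fi]; apply/integrableP; split.
  by apply/measurable_EFinP; exact: measurable_sqn.
apply: le_lt_trans fi; rewrite le_eqVlt; apply/orP; left; apply/eqP.
by apply: eq_integral => x _; rewrite gee0_abs// lee_fin sqn_ge0.
Qed.

Lemma le_sqint f (G : T -> R) : cmf f -> mu.-integrable setT (EFin \o G) ->
  (forall x, sqn (f x) <= G x) -> sqint f.
Proof.
move=> mf /integrableP[mG Gi] fG; split => //; apply: le_lt_trans Gi.
apply: ge0_le_integral => //.
- by move=> x _; rewrite lee_fin sqn_ge0.
- by apply/measurable_EFinP; exact: measurable_sqn.
- exact: measurableT_comp.
- by move=> x _ /=; rewrite lee_fin (le_trans (fG x))// ler_norm.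
Qed.

Lemma nrm2E f : sqint f -> (\int[mu]_x (sqn (f x))%:E)%E = (nrm2 f)%:E.
Proof.
by move=> /sqint_integrable fi; rewrite /nrm2 /Rintegral fineK//; exact: integrable_fin_num.
Qed.

Lemma nrm2_ge0 f : 0 <= nrm2 f.
Proof. by apply: Rintegral_ge0 => x _; exact: sqn_ge0. Qed.

Lemma sqintZ_integrable (k : R) f : sqint f ->
  mu.-integrable setT (EFin \o (fun x => k * sqn (f x))).
Proof. by move=> /sqint_integrable fi; exact: (integrableZl measurableT k fi). Qed.

Lemma sqintD f g : sqint f -> sqint g -> sqint (fun x => f x + g x).
Proof.
move=> fi gi; apply: (@le_sqint _ (fun x => 2 * sqn (f x) + 2 * sqn (g x))).
- by apply: cmfD; [exact: fi.1|exact: gi.1].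
- exact: (integrableD measurableT (sqintZ_integrable 2 fi) (sqintZ_integrable 2 gi)).
- by move=> x; exact: sqnD.
Qed.

Lemma sqint_bM h f (C : R) : cmf h -> (forall x, na (h x) <= C) -> sqint f ->
  sqint (fun x => h x * f x).
Proof.
move=> mh hC fi; apply: (@le_sqint _ (fun x => C ^+ 2 * sqn (f x))).
- by apply: cmfM => //; exact: fi.1.
- exact: sqintZ_integrable.
- move=> x; rewrite sqnM ler_wpM2r ?sqn_ge0//.
  apply: (le_trans (sqn_le_na _)); rewrite ler_pXn2r// ?nnegrE ?na_ge0//.
  exact: le_trans (na_ge0 _) (hC x).
Qed.

Lemma sqintZ (z : R[i]) f : sqint f -> sqint (fun x => z * f x).
Proof. by apply: (@sqint_bM _ _ (na z)) => //; exact: cmf_cst. Qed.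

Lemma sqintB f g : sqint f -> sqint g -> sqint (fun x => f x - g x).
Proof.
move=> fi gi; apply: sqintD => //.
by under eq_fun do rewrite -mulN1r; exact: sqintZ.
Qed.

Lemma bounded_sqint f (C : R) : cmf f -> (forall x, na (f x) <= C) -> sqint f.
Proof.
move=> mf fC; apply: (@le_sqint _ (fun=> C ^+ 2)) => //.
  apply/integrableP; split; first by apply/measurable_EFinP; exact: measurable_cst.
  by rewrite /= integral_cst// lte_mul_pinfty// -ge0_fin_numE// fin_num_measure.
move=> x; apply: (le_trans (sqn_le_na _)).
by rewrite ler_pXn2r// ?nnegrE ?na_ge0// (le_trans (na_ge0 _) (fC x)).
Qed.

Lemma sqint_sum (I : Type) (s : seq I) (P : pred I) (F : I -> T -> R[i]) :
  (forall i, P i -> sqint (F i)) -> sqint (fun x => \sum_(i <- s | P i) F i x).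
Proof.
move=> mF; elim: s => [|i s IH].
  under eq_fun do rewrite big_nil.
  by apply: (@bounded_sqint _ 0); [exact: cmf_cst|move=> x; rewrite na0].
under eq_fun do rewrite big_cons.
by case Pi: (P i) => //; apply: sqintD => //; exact: mF.
Qed.

(* AM-GM with a free parameter replaces the Cauchy-Schwarz inequality. *)
Lemma na_le_sqnD (z : R[i]) (e : R) : 0 < e -> na z <= e + 2 * e^-1 * sqn z.
Proof.
move=> e0; have h := na_le_sqn z.
have h2 : na z <= e + e^-1 * na z ^+ 2.
  have : 0 <= e^-1 * (e ^+ 2 - e * na z + na z ^+ 2).
    apply: mulr_ge0; first by rewrite invr_ge0 ltW.
    by have := mulr_ge0 (ltW e0) (na_ge0 z); have := sqr_ge0 (e - na z); nra.
  rewrite (_ : e^-1 * _ = e - na z + e^-1 * na z ^+ 2); first by lra.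
  by field; rewrite gt_eqF.
apply: (le_trans h2); rewrite lerD2l (mulrC 2) -mulrA ler_wpM2l// invr_ge0 ltW//.
Qed.

Lemma sqint_cintegrable f : sqint f -> cintegrable mu f.
Proof.
move=> fi; apply: (@le_cintegrable _ _ _ _ _ (fun x => 1 + 2 * 1^-1 * sqn (f x))).
- exact: fi.1.
- apply: (integrableD measurableT (f := EFin \o (fun=> 1)) _ (sqintZ_integrable _ fi)).
  exact: finite_measure_integrable_cst.
- by move=> x; exact: na_le_sqnD.
Qed.

(** With [e] of the order of the square root of [nrm2 mu f] this is Cauchy-Schwarz up to a constant,
    so smallness in L2 gives smallness in L1. *)
Lemma integral_na_sqint f (e : R) : 0 < e -> sqint f ->
  (\int[mu]_x (na (f x))%:E <= (e * fine (mu setT) + 2 * e^-1 * nrm2 f)%:E)%E.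
Proof.
move=> e0 fi.
apply: (@le_trans _ _ (\int[mu]_x (e%:E + (2 * e^-1 * sqn (f x))%:E))%E).
  apply: ge0_le_integral => //.
  - by move=> x _; rewrite lee_fin na_ge0.
  - by apply/measurable_EFinP; apply: measurable_na; exact: fi.1.
  - apply: emeasurable_funD => //; apply/measurable_EFinP; apply: measurable_funM => //.
    by apply: measurable_sqn; exact: fi.1.
  - by move=> x _; rewrite -EFinD lee_fin; exact: na_le_sqnD.
rewrite ge0_integralD//.
- rewrite integral_cst// EFinD EFinM fineK ?fin_num_measure// leeD2l//.
  under eq_integral do rewrite EFinM.
  rewrite ge0_integralZl//.
  + by rewrite nrm2E.
  + by apply/measurable_EFinP; apply: measurable_sqn; exact: fi.1.
  + by move=> x _; rewrite lee_fin sqn_ge0.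
  + by rewrite lee_fin mulr_ge0// invr_ge0 ltW.
- by move=> x _; rewrite lee_fin ltW.
- by move=> x _; rewrite lee_fin mulr_ge0// ?sqn_ge0// mulr_ge0// invr_ge0 ltW.
- apply/measurable_EFinP; apply: measurable_funM => //.
  by apply: measurable_sqn; exact: fi.1.
Qed.

Lemma ip_cintegrable f g : sqint f -> sqint g ->
  cintegrable mu (fun x => conjc (f x) * g x).
Proof.
move=> fi gi.
apply: (@le_cintegrable _ _ _ _ _ (fun x => 2 * sqn (f x) + 2 * sqn (g x))).
- by apply: cmfM; [apply: cmfJ; exact: fi.1|exact: gi.1].
- exact: (integrableD measurableT (sqintZ_integrable 2 fi) (sqintZ_integrable 2 gi)).
- move=> x; apply: (le_trans (naM _ _)); rewrite naJ.
  have := na_le_sqn (f x); have := na_le_sqn (g x).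
  have := sqr_ge0 (na (f x) - na (g x)); have := sqr_ge0 (na (f x) + na (g x)).
  by nra.
Qed.

Lemma ipDr f g h : sqint f -> sqint g -> sqint h ->
  ip f (fun x => g x + h x) = ip f g + ip f h.
Proof.
move=> fi gi hi; rewrite /ip -cintegralD; try exact: ip_cintegrable.
by congr cintegral; apply/funext => x; rewrite mulrDr.
Qed.

Lemma ipZr f g z : sqint f -> sqint g -> ip f (fun x => z * g x) = z * ip f g.
Proof.
move=> fi gi; rewrite /ip -cintegralZ; last exact: ip_cintegrable.
by congr cintegral; apply/funext => x; rewrite mulrCA.
Qed.

Lemma ipC f g : sqint f -> sqint g -> ip g f = conjc (ip f g).
Proof.
move=> fi gi; rewrite /ip -cintegralJ; last exact: ip_cintegrable.
by congr cintegral; apply/funext => x; rewrite rmorphM /= conjcK mulrC.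
Qed.

Lemma ip_sumr (I : Type) (s : seq I) (P : pred I) f (F : I -> T -> R[i]) :
  sqint f -> (forall i, P i -> sqint (F i)) ->
  ip f (fun x => \sum_(i <- s | P i) F i x) = \sum_(i <- s | P i) ip f (F i).
Proof.
move=> fi Fi; rewrite /ip -cintegral_sum.
  by congr cintegral; apply/funext => x; rewrite mulr_sumr.
by move=> i Pi; apply: ip_cintegrable => //; exact: Fi.
Qed.

Lemma ip_self f : sqint f -> ip f f = (nrm2 f)%:C.
Proof.
move=> fi; rewrite /ip /nrm2; under eq_fun do rewrite -sqnE.
by apply: complex_ext => //=; rewrite /Rintegral /= integral0.
Qed.

Lemma nrm2D f g : sqint f -> sqint g ->
  nrm2 (fun x => f x + g x) = nrm2 f + nrm2 g + 2 * complex.Re (ip f g).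
Proof.
move=> fi gi; have fg := sqintD fi gi.
have /(congr1 (@complex.Re R)) := ip_self fg.
rewrite [RHS]/= => <-.
rewrite ipDr// ReD (ipC fi fg) (ipC gi fg) !ipDr// !ReJ !ReD !ip_self// (ipC fi gi).
by rewrite ReJ [complex.Re (nrm2 f)%:C]/= [complex.Re (nrm2 g)%:C]/=; ring.
Qed.

Lemma ae_nrm2 f g : cmf f -> cmf g -> {ae mu, forall x, f x = g x} ->
  nrm2 f = nrm2 g.
Proof.
move=> mf mg fg; rewrite /nrm2 /Rintegral; congr fine; apply: ge0_ae_eq_integral => //.
- by apply/measurable_EFinP; exact: measurable_sqn.
- by apply/measurable_EFinP; exact: measurable_sqn.
- by move=> x _; rewrite lee_fin sqn_ge0.
- by move=> x _; rewrite lee_fin sqn_ge0.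
- by apply: filterS fg => x -> _.
Qed.

End SquareIntegrable.

(** * Orthogonal families *)

Lemma Re_realM (R : realType) (a : R) (z : R[i]) : complex.Re (a%:C * z) = a * complex.Re z.
Proof. by case: z => x y /=; ring. Qed.

Lemma Im_realM (R : realType) (a : R) (z : R[i]) : complex.Im (a%:C * z) = a * complex.Im z.
Proof. by case: z => x y /=; ring. Qed.

Lemma limn_einf_le (R : realType) (v : nat -> \bar R) (B : \bar R) :
  (forall n, v n <= B)%E -> (limn_einf v <= B)%E.
Proof.
move=> vB; rewrite limn_einf_lim; apply: lime_le; first exact: is_cvg_einfs.
apply: nearW => n; apply: le_trans (vB n).
by apply: ereal_inf_lbound; exists n => /=.
Qed.

Section OrthogonalFamily.
Context d (T : measurableType d) (R : realType) (mu : {finite_measure set T -> \bar R}).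
(** The family comes from a countable index set listed along its codes: [b n] says that [n] is a
    code, and at the other indices [e n] is the zero function. The members have squared norm [lam],
    not 1. *)
Variables (e : nat -> T -> R[i]) (b : nat -> bool) (lam C : R).
Hypothesis lam0 : 0 < lam.
Hypothesis me : forall n, cmf (e n).
Hypothesis eC : forall n x, na (e n x) <= C.
Hypothesis e0 : forall n x, ~~ b n -> e n x = 0.
Hypothesis eorth : forall m n, ip mu (e m) (e n) = if (m == n) && b n then lam%:C else 0.

Let ei n : sqint mu (e n). Proof. exact: bounded_sqint. Qed.

Definition psum (c : nat -> R[i]) (N M : nat) (x : T) : R[i] :=
  \sum_(N <= n < M) c n * e n x.

Lemma psum_sqint c N M : sqint mu (psum c N M).
Proof. by apply: sqint_sum => n _; exact: sqintZ. Qed.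

Lemma psumB c N M K : (N <= M <= K)%N -> forall x,
  psum c N K x = psum c N M x + psum c M K x.
Proof. by move=> /andP[NM MK] x; rewrite /psum (big_cat_nat NM MK). Qed.

Lemma ip_psum c N M n : b n ->
  ip mu (e n) (psum c N M) = if (N <= n < M)%N then lam%:C * c n else 0.
Proof.
move=> bn; rewrite /psum ip_sumr//; last by move=> i _; exact: sqintZ.
under eq_bigr do rewrite ipZr// eorth.
case: ifPn => h.
  rewrite (bigD1_seq n) /= ?mem_index_iota ?iota_uniq// eqxx bn /= big1 ?addr0 1?mulrC//.
  by move=> i /negbTE; rewrite eq_sym => -> /=; rewrite mulr0.
rewrite big_nat big1// => i hi; case: eqP => [ni|_]; last by rewrite mulr0.
by move: h; rewrite ni hi.
Qed.

Lemma nrm2_psum c N M : (forall n, ~~ b n -> c n = 0) ->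
  nrm2 mu (psum c N M) = lam * \sum_(N <= n < M) sqn (c n).
Proof.
move=> c0; have := ip_self (psum_sqint c N M).
rewrite {2}/psum ip_sumr//; last 2 first.
- exact: psum_sqint.
- by move=> i _; exact: sqintZ.
rewrite (eq_big_nat _ _ (F2 := fun n => (lam * sqn (c n))%:C)); last first.
  move=> n nNM; rewrite ipZr//; last exact: psum_sqint.
  have [bn|bn] := boolP (b n); last first.
    by rewrite c0// mul0r /sqn /= expr0n /= addr0 mulr0.
  rewrite (ipC (ei n) (psum_sqint c N M)) ip_psum// nNM.
  by apply: complex_ext; rewrite /sqn !ReImE /=; ring.
by rewrite -rmorph_sum /= => -[<-]; rewrite mulr_sumr.
Qed.

(** The classical subsequence argument: along [phi] the increments [D k] of the partial sums are
    summable in L1, so the partial sums converge almost everywhere; Fatou's lemma then bounds the L2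
    distance to the limit by a tail of the coefficient series. *)
Lemma Riesz_Fischer (c : nat -> R[i]) : (forall n, ~~ b n -> c n = 0) ->
  cvgn (series (fun n => sqn (c n))) ->
  exists g, [/\ sqint mu g, (forall n, ip mu (e n) g = lam%:C * c n) &
    (fun N => nrm2 mu (fun x => g x - psum c 0 N x)) @ \oo --> (0 : R)].
Proof.
move=> c0 cvc.
pose l := limn (series (fun n => sqn (c n))).
pose r N := l - series (fun n => sqn (c n)) N.
have ndS : nondecreasing_seq (series (fun n => sqn (c n))).
  by apply/nondecreasing_seqP => n; rewrite seriesSr lerDl sqn_ge0.
have tail N M : (N <= M)%N -> \sum_(N <= n < M) sqn (c n) <= r N.
  move=> NM; rewrite /r lerBrDr.
  have := nondecreasing_cvgn_le ndS cvc M; apply: le_trans.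
  by rewrite /series /= (big_cat_nat (leq0n N) NM) /= addrC.
have r_cvg : r @ \oo --> (0 : R).
  rewrite -(subrr l); apply: cvgB; [exact: cvg_cst|exact: cvc].
have [f fP] : exists f : nat -> nat, forall k M, (f k <= M)%N -> r M <= 4^-1 ^+ k.
  apply: (choice (fun k N => forall M, (N <= M)%N -> r M <= 4^-1 ^+ k)) => k.
  have /cvgrPdist_le/(_ (4^-1 ^+ k)) := r_cvg.
  rewrite exprn_gt0// => /(_ isT)[N _ hN]; exists N => M NM.
  by have := hN M NM; rewrite sub0r normrN; apply: le_trans; exact: ler_norm.
(* The sum makes [phi] nondecreasing and at least [f k]; the summand [k] makes it tend to
   infinity. *)
pose phi k := (\sum_(i < k.+1) f i + k)%N.
have phi_nd k : (phi k <= phi k.+1)%N.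
  by rewrite /phi [in leqRHS]big_ord_recr /=; apply: leq_add; rewrite ?leq_addr.
have phi_ge k : (k <= phi k)%N by rewrite leq_addl.
have phi_mono k j : (k <= j)%N -> (phi k <= phi j)%N.
  by elim: j => [|j IH]; [rewrite leqn0 => /eqP->|rewrite leq_eqVlt => /predU1P[->//|/IH kj]; exact: leq_trans (phi_nd j)].
have f_phi k : (f k <= phi k)%N.
  by rewrite /phi big_ord_recr /= -addnA addnC -addnA leq_addr.
pose D k := psum c (phi k) (phi k.+1).
have Dn k : nrm2 mu (D k) <= lam * 4^-1 ^+ k.
  rewrite nrm2_psum// ler_pM2l//; apply: (le_trans (tail _ _ (phi_nd k))).
  exact: fP.
(* This is [integral_na_sqint] with [e = 2^-k] and squared norm at most [lam 4^-k]; the factor 2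
   compensates for the exponent [k.+1] of [epsilon_trick]. *)
pose A := 2 * (fine (mu setT) + 2 * lam).
have DA k : (\int[mu]_x (na (D k x))%:E <= (A / (2 ^ k.+1)%:R)%:E)%E.
  have h2 : 0 < 2^-1 ^+ k :> R by rewrite exprn_gt0.
  apply: (le_trans (integral_na_sqint h2 (psum_sqint _ _ _))).
  rewrite lee_fin -/(D k).
  have -> : A / (2 ^ k.+1)%:R = 2^-1 ^+ k * fine (mu setT) + 2 * (2^-1 ^+ k)^-1 * (lam * 4^-1 ^+ k).
    rewrite /A natrX exprS (_ : 4^-1 = 2^-1 * 2^-1 :> R); last by rewrite -invfM -natrM.
    rewrite exprMn !exprVn invrK; field.
    by rewrite expf_neq0.
  by rewrite lerD2l ler_wpM2l// mulr_ge0// invr_ge0 ltW.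
pose G x := (\sum_(0 <= k <oo) (na (D k x))%:E)%E.
have mD k : measurable_fun setT (fun x => (na (D k x))%:E).
  by apply/measurable_EFinP/measurable_na; exact: (psum_sqint _ _ _).1.
have mG : measurable_fun setT G.
  by apply: ge0_emeasurable_sum => // k x _ _; rewrite lee_fin na_ge0.
have Gi : (\int[mu]_x G x < +oo)%E.
  rewrite integral_nneseries//; last by move=> k x _; rewrite lee_fin na_ge0.
  apply: (@le_lt_trans _ _ (\sum_(0 <= k <oo) (0%E + (A / (2 ^ k.+1)%:R)%:E))%E).
    apply: lee_nneseries => [k _ _|k _]; last by rewrite add0e.
    by apply: integral_ge0 => x _; rewrite lee_fin na_ge0.
  apply: (@le_lt_trans _ _ (\sum_(0 <= k <oo) (0%E : \bar R) + A%:E)%E).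
    apply: epsilon_trick => //.
    by rewrite /A mulr_ge0// addr_ge0 ?fine_ge0// mulr_ge0// ltW.
  by rewrite eseries0// add0e ltry.
have G0 x : (0 <= G x)%E by apply: nneseries_ge0 => k _ _; rewrite lee_fin na_ge0.
have Gint : mu.-integrable setT G.
  apply/integrableP; split => //.
  by under eq_integral do rewrite gee0_abs//.
have Gfin : {ae mu, forall x, (G x < +oo)%E}.
  apply: filterS (integrable_ae measurableT Gint) => x /(_ I).
  by rewrite ge0_fin_numE.
(* Cutting the partial sums off outside [Aset], a set of full measure, makes them converge at every
   point, as [cmf_cvg] requires of a sequence with measurable limit. *)
pose Aset := [set x | (G x < +oo)%E].
have mA : measurable Aset.
  rewrite /Aset -[X in measurable X]setTI; exact: emeasurable_fun_infty_o.
pose u j x := (\1_Aset x)%:C * psum c 0 (phi j) x.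
have u_cvg x : exists z, ccvg (u^~ x) z.
  rewrite /u indicE; have [xA|xA] := boolP (x \in Aset); last first.
    by exists 0; under eq_fun do rewrite mul0r; exact: ccvg_cst.
  have key (h : R[i] -> R) : {morph h : a b / a + b >-> a + b} -> (forall z, `|h z| <= na z) ->
      cvgn (fun j => h (psum c 0 (phi j) x)).
    move=> hD hna.
    have hs j : h (psum c 0 (phi j) x) = h (psum c 0 (phi 0) x) + series (fun k => h (D k x)) j.
      elim: j => [|j IH]; first by rewrite /series /= big_geq// addr0.
      rewrite seriesSr addrA -IH -hD -psumB//.
      by rewrite leq0n phi_nd.
    under eq_fun do rewrite hs.
    apply: is_cvgD; first exact: is_cvg_cst.
    apply: normed_cvg; apply: nondecreasing_is_cvgn.
      by apply/nondecreasing_seqP => n; rewrite /= !/series /= big_nat_recr//= lerDl.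
    exists (fine (G x)) => _ [n _ <-] /=; rewrite -lee_fin fineK; last first.
      by rewrite ge0_fin_numE//; move: xA; rewrite inE.
    rewrite /series /= -sumEFin.
    apply: (@le_trans _ _ (\sum_(0 <= k < n) (na (D k x))%:E)%E).
      by apply: lee_sum => k _; rewrite lee_fin.
    by apply: nneseries_lim_ge => k _ _; rewrite lee_fin na_ge0.
  exists (limn (fun j => complex.Re (psum c 0 (phi j) x)) +i*
          limn (fun j => complex.Im (psum c 0 (phi j) x))).
  under eq_fun do rewrite mul1r.
  split; apply: key; [exact: ReD|exact: na_Re|exact: ImD|exact: na_Im].
have [g ug] := choice (fun x z => ccvg (u^~ x) z) u_cvg.
have mu_ j : cmf (u j).
  apply: cmfM; last exact: (psum_sqint _ _ _).1.
  by apply: cmf_real; exact: measurable_indic.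
have mg : cmf g := cmf_cvg mu_ ug.
have u_ae j : {ae mu, forall x, psum c 0 (phi j) x = u j x}.
  by apply: filterS Gfin => x Gx; rewrite /u indicE mem_set// mul1r.
(* For fixed [N] the upper end of the partial sums runs to infinity along [phi], under Fatou's
   lemma. *)
have bound k N : (phi k <= N)%N ->
    (\int[mu]_x (sqn (g x - psum c 0 N x))%:E <= (lam * 4^-1 ^+ k)%:E)%E.
  move=> kN.
  have mS : cmf (psum c 0 N) := (psum_sqint _ _ _).1.
  pose F j x := (sqn (u (j + N)%N x - psum c 0 N x))%:E.
  have mF j : measurable_fun setT (F j).
    by apply/measurable_EFinP; apply: measurable_sqn; exact: cmfB.
  have F0 j x : setT x -> (0 <= F j x)%E by rewrite lee_fin sqn_ge0.
  have := fatou mu measurableT mF F0.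
  rewrite (eq_integral (fun x => (sqn (g x - psum c 0 N x))%:E)); last first.
    move=> x _; apply: (cvg_limn_einf_sup _).1; apply/fine_cvgP; split; first exact: nearW.
    have [h1 h2] := ug x.
    have h : ccvg (fun j => u (j + N)%N x - psum c 0 N x) (g x - psum c 0 N x).
      by apply: ccvgD; [split; [move: h1|move: h2]; rewrite -(cvg_shiftn N)|exact: ccvg_cst].
    by apply: cvgD; apply: cvgM; (exact: h.1 || exact: h.2).
  move/le_trans; apply; apply: limn_einf_le => j.
  have NjN : (N <= phi (j + N))%N by apply: leq_trans (phi_ge _); rewrite leq_addl.
  have SE x : psum c 0 (phi (j + N)%N) x - psum c 0 N x = psum c N (phi (j + N)%N) x.
    by rewrite (psumB c (M := N)) ?NjN// addrC addKr.
  rewrite (@ge0_ae_eq_integral _ _ _ mu _ _ (fun x => (sqn (psum c N (phi (j + N)%N) x))%:E))//.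
  - rewrite nrm2E; last exact: psum_sqint.
    rewrite lee_fin nrm2_psum// ler_pM2l//.
    apply: (le_trans (tail _ _ NjN)); apply: fP; exact: leq_trans kN.
  - by apply/measurable_EFinP; apply: measurable_sqn; exact: (psum_sqint _ _ _).1.
  - by move=> x _; rewrite lee_fin sqn_ge0.
  - by move=> x _; rewrite lee_fin sqn_ge0.
  - by apply: filterS (u_ae (j + N)%N) => x ux _; rewrite /F -ux SE.
have gS N : sqint mu (fun x => g x - psum c 0 N x).
  have h0 : sqint mu (fun x => g x - psum c 0 (phi 0) x).
    split; first by apply: cmfB => //; exact: (psum_sqint _ _ _).1.
    exact: le_lt_trans (bound 0%N (phi 0%N) (leqnn _)) (ltry _).
  have := sqintB (sqintD h0 (psum_sqint c 0 (phi 0))) (psum_sqint c 0 N).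
  by congr sqint; apply/funext => x; ring.
have gi : sqint mu g.
  have := sqintD (gS 0%N) (psum_sqint c 0 0).
  by congr sqint; apply/funext => x; ring.
have nbound k N : (phi k <= N)%N -> nrm2 mu (fun x => g x - psum c 0 N x) <= lam * 4^-1 ^+ k.
  by move=> kN; rewrite -lee_fin -nrm2E//; exact: bound.
have cvg4 : (fun k => lam * 4^-1 ^+ k) @ \oo --> (0 : R).
  rewrite -(mulr0 lam); apply: cvgM; first exact: cvg_cst.
  by apply: cvg_expr; rewrite ger0_norm// invf_lt1// ltr1n.
exists g; split => //.
- move=> n; have [bn|bn] := boolP (b n); last first.
    rewrite c0// mulr0 /ip (_ : (fun x => _) = fun=> 0); last first.
      by apply/funext => x; rewrite e0// rmorph0 mul0r.
    by apply: complex_ext; rewrite /= /Rintegral integral0.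
  apply/eqP; rewrite -subr_eq0; apply/eqP.
  (* [N > n] puts the index [n] inside the partial sum, so the error is the coefficient of
     [g - psum c 0 N], which is controlled by an L1 norm of order [2^-k]. *)
  have small k : na (ip mu (e n) g - lam%:C * c n) <= C * (2^-1 ^+ k * (fine (mu setT) + 2 * lam)).
    pose N := maxn (phi k) n.+1.
    have kN : (phi k <= N)%N by rewrite leq_maxl.
    have -> : ip mu (e n) g - lam%:C * c n = ip mu (e n) (fun x => g x - psum c 0 N x).
      under [in RHS]eq_fun do rewrite -mulN1r.
      rewrite ipDr//; last by apply: sqintZ; exact: psum_sqint.
      rewrite ipZr//; last exact: psum_sqint.
      by rewrite ip_psum// leq0n leq_maxr mulN1r.
    rewrite -lee_fin; apply: le_trans (na_cintegral _) _; first exact: ip_cintegrable.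
    apply: (@le_trans _ _ (\int[mu]_x (C%:E * (na (g x - psum c 0 N x))%:E))%E).
      apply: ge0_le_integral => //.
      - by move=> x _; rewrite lee_fin na_ge0.
      - by apply/measurable_EFinP/measurable_na; exact: (ip_cintegrable (ei n) (gS N)).1.
      - by apply: emeasurable_funM => //; apply/measurable_EFinP/measurable_na; exact: (gS N).1.
      - move=> x _; rewrite -EFinM lee_fin; apply: (le_trans (naM _ _)).
        by rewrite naJ ler_wpM2r ?na_ge0.
    have C0 : 0 <= C by apply: le_trans (na_ge0 _) (eC 0%N point).
    rewrite ge0_integralZl//; last 2 first.
    - by apply/measurable_EFinP/measurable_na; exact: (gS N).1.
    - by move=> x _; rewrite lee_fin na_ge0.
    rewrite EFinM lee_wpmul2l ?lee_fin//.
    have h2 : 0 < 2^-1 ^+ k :> R by rewrite exprn_gt0.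
    apply: (le_trans (integral_na_sqint h2 (gS N))).
    rewrite lee_fin mulrDr lerD2l.
    apply: (@le_trans _ _ (2 * (2^-1 ^+ k)^-1 * (lam * 4^-1 ^+ k))).
      by rewrite ler_wpM2l ?nbound// mulr_ge0// invr_ge0 ltW.
    rewrite (_ : 4^-1 = 2^-1 * 2^-1 :> R); last by rewrite -invfM -natrM.
    rewrite exprMn le_eqVlt; apply/orP; left; apply/eqP; field.
    by rewrite gt_eqF.
  have : na (ip mu (e n) g - lam%:C * c n) <= 0.
    have cvgB : (fun k => C * (2^-1 ^+ k * (fine (mu setT) + 2 * lam))) @ \oo --> (0 : R).
      rewrite -(mulr0 C) -(mul0r (fine (mu setT) + 2 * lam)).
      apply: cvgM; first exact: cvg_cst.
      apply: cvgM; last exact: cvg_cst.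
      by apply: cvg_expr; rewrite ger0_norm// invf_lt1// ltr1n.
    by apply: (cvgr_to_ge cvgB); apply: nearW => k; exact: small.
  move=> na_le; apply: complex_ext; apply/eqP; rewrite -normr_le0.
    exact: le_trans (na_Re _) na_le.
  exact: le_trans (na_Im _) na_le.
- apply/cvgrPdist_le => eps eps0.
  have /cvgrPdist_le/(_ eps eps0)[k _ hk] := cvg4.
  exists (phi k) => // N /= kN; rewrite sub0r normrN ger0_norm ?nrm2_ge0//.
  apply: (le_trans (nbound k N kN)); have := hk k (leqnn k).
  by rewrite sub0r normrN; apply: le_trans; exact: ler_norm.
Qed.

Let coef (f : T -> R[i]) n : R[i] := (lam%:C)^-1 * ip mu (e n) f.

Let lamC0 : lam%:C != 0.
Proof. by apply/eqP => -[h]; move: lam0; rewrite h ltxx. Qed.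

Let coef0 f n : ~~ b n -> coef f n = 0.
Proof.
move=> bn; rewrite /coef /ip (_ : (fun x => _) = fun=> 0); last first.
  by apply/funext => x; rewrite e0// rmorph0 mul0r.
by rewrite (_ : cintegral _ _ = 0) ?mulr0//; apply: complex_ext; rewrite /= /Rintegral integral0.
Qed.

(** The exact form of Bessel's inequality: the partial Fourier sum is an orthogonal projection of
    [f]. *)
Let nrm2_coef f N : sqint mu f ->
  nrm2 mu (fun x => f x - psum (coef f) 0 N x) =
  nrm2 mu f - lam * \sum_(0 <= n < N) sqn (coef f n).
Proof.
move=> fi; have Si := psum_sqint (coef f) 0 N.
under [in LHS]eq_fun do rewrite -mulN1r.
rewrite nrm2D//; last exact: sqintZ.
rewrite ipZr// mulN1r ReN.
have -> : nrm2 mu (fun x => -1 * psum (coef f) 0 N x) = nrm2 mu (psum (coef f) 0 N).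
  by rewrite /nrm2; apply: eq_Rintegral => x _; rewrite sqnM /sqn /= oppr0; ring.
rewrite nrm2_psum; last exact: coef0.
have -> : complex.Re (ip mu f (psum (coef f) 0 N)) = lam * \sum_(0 <= n < N) sqn (coef f n).
  rewrite /psum ip_sumr//; last by move=> i _; exact: sqintZ.
  rewrite Re_sum mulr_sumr; apply: eq_bigr => n _.
  rewrite ipZr// (ipC (ei n) fi) (_ : ip mu (e n) f = lam%:C * coef f n).
    by rewrite /sqn !ReImE /=; ring.
  by rewrite /coef mulrA mulfV// mul1r.
by ring.
Qed.

Hypothesis complete : forall f, cintegrable mu f ->
  (forall n, ip mu (e n) f = 0) -> {ae mu, forall x, f x = 0}.

(** The Riesz-Fischer limit of the Fourier series has the coefficients of [f], so completeness
    identifies it with [f] almost everywhere. The defect in Bessel's inequality is then the squared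
    distance to the limit, which tends to 0. *)
Lemma Parseval_nrm2 f : sqint mu f ->
  (fun N => lam^-1 * \sum_(0 <= n < N) sqn (ip mu (e n) f)) @ \oo --> nrm2 mu f.
Proof.
move=> fi.
have cE N : lam^-1 * \sum_(0 <= n < N) sqn (ip mu (e n) f) =
    lam * \sum_(0 <= n < N) sqn (coef f n).
  rewrite !mulr_sumr; apply: eq_bigr => n _; rewrite /coef sqnM.
  rewrite (_ : (lam%:C)^-1 = (lam^-1)%:C); last by rewrite -fmorphV.
  by rewrite {2}/sqn /=; field; rewrite gt_eqF.
have cvc : cvgn (series (fun n => sqn (coef f n))).
  apply: nondecreasing_is_cvgn.
    by apply/nondecreasing_seqP => n; rewrite seriesSr lerDl sqn_ge0.
  exists (lam^-1 * nrm2 mu f) => _ [N _ <-].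
  rewrite -(ler_pM2l lam0) mulrA mulfV ?gt_eqF// mul1r -subr_ge0.
  by rewrite /series /= -nrm2_coef// nrm2_ge0.
have [g [gi gc gn]] := Riesz_Fischer (coef0 f) cvc.
have fg : {ae mu, forall x, f x = g x}.
  have := complete (sqint_cintegrable (sqintB fi gi)).
  have h n : ip mu (e n) (fun x => f x - g x) = 0.
    under eq_fun do rewrite -[- g _]mulN1r.
    rewrite ipDr//; last exact: sqintZ.
    by rewrite ipZr// gc /coef (mulrA lam%:C) mulfV// mul1r mulN1r subrr.
  by move=> /(_ h); apply: filterS => x /eqP; rewrite subr_eq0 => /eqP.
under eq_fun do rewrite cE.
have : (fun N => nrm2 mu f - nrm2 mu (fun x => g x - psum (coef f) 0 N x)) @ \oo --> nrm2 mu f - 0.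
  by apply: cvgB => //; exact: cvg_cst.
rewrite subr0; apply: cvg_trans; apply: near_eq_cvg; apply: nearW => N.
rewrite (_ : nrm2 mu (fun x => g x - _) = nrm2 mu (fun x => f x - psum (coef f) 0 N x)).
  by rewrite nrm2_coef// opprB addrC subrK.
have mS : cmf (psum (coef f) 0 N) := (psum_sqint _ _ _).1.
apply: ae_nrm2.
- by apply: cmfB => //; exact: gi.1.
- by apply: cmfB => //; exact: fi.1.
- by apply: filterS fg => x ->.
Qed.

Lemma Parseval f h : sqint mu f -> sqint mu h ->
  ccvg (fun N => (lam^-1)%:C * \sum_(0 <= n < N) conjc (ip mu (e n) f) * ip mu (e n) h)
    (ip mu f h).
Proof.
move=> fi hi.
have reP (g : T -> R[i]) : sqint mu g ->
  (fun N => complex.Re ((lam^-1)%:C * \sum_(0 <= n < N) conjc (ip mu (e n) f) * ip mu (e n) g))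
    @ \oo --> complex.Re (ip mu f g).
  move=> gi.
  pose s h N := lam^-1 * \sum_(0 <= n < N) sqn (ip mu (e n) h).
  have : (fun N => 2^-1 * (s (fun x => f x + g x) N - s f N - s g N)) @ \oo -->
      2^-1 * (nrm2 mu (fun x => f x + g x) - nrm2 mu f - nrm2 mu g).
    apply: cvgM; first exact: cvg_cst.
    by apply: cvgB; [apply: cvgB|]; apply: Parseval_nrm2 => //; exact: sqintD.
  rewrite nrm2D//.
  rewrite (_ : 2^-1 * _ = complex.Re (ip mu f g)); last by field.
  apply: cvg_trans; apply: near_eq_cvg; apply: nearW => N.
  rewrite /s -!mulrBr mulrCA -!sumrB Re_realM; congr (_ * _).
  rewrite Re_sum mulr_sumr; apply: eq_bigr => n _.
  rewrite ipDr//; case: (ip mu (e n) f) => a1 b1; case: (ip mu (e n) g) => a2 b2.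
  by rewrite /sqn /=; field.
split; first exact: reP.
(* Polarization only yields the real part; multiplying [h] by [-i] moves the imaginary part of the
   inner product into the real part. *)
pose k := fun x => (0 -i* 1) * h x.
have ki : sqint mu k by exact: sqintZ.
have := reP k ki.
rewrite /k ipZr// (_ : complex.Re _ = complex.Im (ip mu f h)); last by case: (ip mu f h) => x y /=; ring.
apply: cvg_trans.
apply: near_eq_cvg; apply: nearW => N; rewrite Re_realM Im_realM.
congr (_ * _); rewrite Re_sum Im_sum; apply: eq_bigr => n _.
rewrite ipZr//; case: (ip mu (e n) f) => a1 b1; case: (ip mu (e n) h) => a2 b2 /=.
by ring.
Qed.

End OrthogonalFamily.

(** The Newton-Schulz map. Its fixed points are -1, 0 and 1, and on [[-1, 1]] its iterates tend to
    the sign, which is thus a bounded pointwise limit of polynomials; this is how an algebra of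
    functions yields indicators. *)
Definition sgn_step (R : realType) (y : R) : R := y * (3 - y ^+ 2) / 2.

Lemma sgn_step_itv (R : realType) (y : R) : -1 <= y <= 1 -> -1 <= sgn_step y <= 1.
Proof.
rewrite /sgn_step => /andP[y1 y2]; apply/andP; split.
  have : 0 <= (1 + y) ^+ 2 * (2 - y) by apply: mulr_ge0; [exact: sqr_ge0|lra].
  by rewrite (_ : (1 + y) ^+ 2 * (2 - y) = 2 + y * (3 - y ^+ 2)); [lra|ring].
have : 0 <= (1 - y) ^+ 2 * (2 + y) by apply: mulr_ge0; [exact: sqr_ge0|lra].
by rewrite (_ : (1 - y) ^+ 2 * (2 + y) = 2 - y * (3 - y ^+ 2)); [lra|ring].
Qed.

Lemma sgn_iter_itv (R : realType) (x : R) n :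
  -1 <= x <= 1 -> -1 <= iter n (@sgn_step R) x <= 1.
Proof. by move=> x1; elim: n => [//|n IH]; exact: sgn_step_itv. Qed.

(** The iterates increase, because [y * (1 - y^2) >= 0], and stay in [[x, 1]]; their limit is a
    positive fixed point, hence 1. *)
Lemma sgn_iter_cvg1 (R : realType) (x : R) : 0 < x <= 1 ->
  (fun n => iter n (@sgn_step R) x) @ \oo --> (1 : R).
Proof.
move=> /andP[x0 x1]; set s := fun n => _.
have s01 n : x <= s n <= 1.
  elim: n => [|n /andP[s1 s2]]; first by rewrite /s /= lexx.
  have /andP[_ ->] : -1 <= s n.+1 <= 1 by apply: sgn_iter_itv; lra.
  rewrite andbT (le_trans s1)// /s /= -/(s n) /sgn_step.
  have : 0 <= s n * (1 - s n ^+ 2).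
    by apply: mulr_ge0; [lra|rewrite subr_ge0 expr_le1//; lra].
  by lra.
have snd : nondecreasing_seq s.
  apply/nondecreasing_seqP => n; have /andP[s1 s2] := s01 n.
  rewrite /s /= -/(s n) /sgn_step.
  have : 0 <= s n * (1 - s n ^+ 2).
    by apply: mulr_ge0; [lra|rewrite subr_ge0 expr_le1//; lra].
  by lra.
have cs : cvgn s.
  apply: nondecreasing_is_cvgn => //; exists 1 => _ [n _ <-].
  by have /andP[] := s01 n.
pose l := limn s.
have sl : s @ \oo --> l by exact: cs.
have xl : x <= l by apply: (cvgr_to_ge sl); apply: nearW => n; have /andP[] := s01 n.
have e : l = sgn_step l.
  have h1 : (fun n => s n.+1) @ \oo --> l by rewrite (cvg_shiftS s).
  apply: (cvg_unique _ h1) => //.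
  apply: cvgM; last exact: cvg_cst.
  apply: cvgM => //; apply: cvgB; first exact: cvg_cst.
  by apply: cvgM.
have : l * ((1 - l) * (1 + l)) = 0 by move: e; rewrite /sgn_step; lra.
move/eqP; rewrite !mulf_eq0 => /or3P[/eqP h|/eqP h|/eqP h]; try lra.
by rewrite (_ : 1 = l)//; lra.
Qed.

Lemma sgn_iterN (R : realType) (x : R) n :
  iter n (@sgn_step R) (- x) = - iter n (@sgn_step R) x.
Proof.
elim: n => [//|n IH] /=; rewrite IH /sgn_step sqrrN.
by rewrite !mulNr.
Qed.

Lemma sgn_iter_cvg (R : realType) (x : R) : -1 <= x <= 1 ->
  (fun n => iter n (@sgn_step R) x) @ \oo --> Num.sg x.
Proof.
move=> /andP[x1 x2]; have [x0|x0|<-] := ltgtP 0 x.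
- by rewrite gtr0_sg//; apply: sgn_iter_cvg1; rewrite x0.
- rewrite ltr0_sg// -[x]opprK; under eq_fun do rewrite sgn_iterN.
  by apply: cvgN; apply: sgn_iter_cvg1; lra.
- rewrite sgr0; under eq_fun => n.
    rewrite (_ : iter n _ _ = 0); last by elim: n => //= n ->; rewrite /sgn_step !mul0r.
    over.
  exact: cvg_cst.
Qed.

Lemma measurable_gt d (T : measurableType d) (R : realType) (g : T -> R) (c : R) :
  measurable_fun setT g -> measurable [set t | c < g t].
Proof.
move=> mg; have := mg measurableT `]c, +oo[%classic (measurable_itv _).
by rewrite setTI; congr measurable; apply/seteqP; split => t /=; rewrite in_itv /= andbT.
Qed.

(** * Absolutely summable families *)

Section CountableSums.
Variable R : realType.

(** Turns sums over a countable type into series over [nat], to which the convergence theorems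
    apply; [z] fills the indices that code nothing. *)
Definition enum_ext (T : countType) (V : Type) (z : V) (g : T -> V) (n : nat) : V :=
  if pickle_inv n is Some k then g k else z.

Lemma enum_ext_pickle (T : countType) (V : Type) (z : V) (g : T -> V) k :
  enum_ext z g (pickle k) = g k.
Proof. by rewrite /enum_ext pickleK_inv. Qed.

Lemma enum_ext_comp (T : countType) (V W : Type) (z : V) (w : W) (h : V -> W) (g : T -> V) n :
  h z = w -> h (enum_ext z g n) = enum_ext w (h \o g) n.
Proof. by rewrite /enum_ext => <-; case: pickle_inv. Qed.

Lemma enum_ext_ge0 (T : countType) (a : T -> \bar R) n : (forall k, 0 <= a k)%E ->
  (0 <= enum_ext 0 a n)%E.
Proof. by rewrite /enum_ext => a0; case: (pickle_inv n). Qed.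

Lemma esum_enum (T : countType) (a : T -> \bar R) : (forall k, 0 <= a k)%E ->
  esum setT a = (\sum_(0 <= n <oo) enum_ext 0 a n)%E.
Proof.
move=> a0; rewrite nneseries_esumT; last by move=> n; exact: enum_ext_ge0.
rewrite (esumID (range (@pickle T))); last by move=> n _; exact: enum_ext_ge0.
rewrite [X in (_ + X)%E]esum1 ?adde0; last first.
  move=> n [_ hn]; rewrite /enum_ext; case E : (pickle_inv n) => [k|//].
  by exfalso; apply: hn; exists k => //; have := @pickle_invK T n; rewrite E.
rewrite setTI (@reindex_esum R T nat setT (range (@pickle T)) pickle).
  by apply: eq_esum => k _; rewrite enum_ext_pickle.
split => //.
Qed.

Lemma esum_pair (T1 T2 : choiceType) (a : T1 * T2 -> \bar R) : (forall k, 0 <= a k)%E ->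
  esum setT a = esum setT (fun x => esum setT (fun y => a (x, y))).
Proof.
move=> a0; rewrite (esum_esum (a := fun x y => a (x, y))); last by move=> *; exact: a0.
have -> : [set: T1] `*`` (fun=> [set: T2]) = setT by apply/seteqP; split.
by apply: eq_esum => -[].
Qed.

Lemma reindex_esum_bij (T1 T2 : choiceType) (e : T1 -> T2) (a : T2 -> \bar R) :
  bijective e -> esum setT a = esum setT (a \o e).
Proof.
move=> [e' ek e'k]; apply: reindex_esum; split => //.
- by move=> x y _ _; exact: (can_inj ek).
- by move=> y _; exists (e' y).
Qed.

Lemma esum_swap (T1 T2 : choiceType) (a : T1 -> T2 -> \bar R) : (forall x y, 0 <= a x y)%E ->
  esum setT (fun x => esum setT (a x)) = esum setT (fun y => esum setT (a ^~ y)).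
Proof.
move=> a0; rewrite -(esum_pair (a := fun k => a k.1 k.2))//.
rewrite -(esum_pair (a := fun k => a k.2 k.1))//.
apply: (@reindex_esum_bij _ _ (fun k : T2 * T1 => (k.2, k.1))).
by exists (fun k : T1 * T2 => (k.2, k.1)) => -[].
Qed.

Lemma esumZl (T : countType) (c : R) (a : T -> \bar R) : 0 <= c -> (forall k, 0 <= a k)%E ->
  esum setT (fun k => c%:E * a k)%E = (c%:E * esum setT a)%E.
Proof.
move=> c0 a0; rewrite !esum_enum//; last by move=> k; rewrite mule_ge0.
rewrite -nneseriesZl; last by move=> n _; exact: enum_ext_ge0.
apply: eq_eseriesr => n _.
by rewrite (enum_ext_comp (h := fun u => (c%:E * u)%E) (w := 0%E))// mule0.
Qed.

Lemma posnegE (u : R) : Num.max u 0 - Num.max (- u) 0 = u.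
Proof. by rewrite !maxEge; case: ifPn; case: ifPn; lra. Qed.

Lemma abs_posneg (u : R) : `|u| = Num.max u 0 + Num.max (- u) 0.
Proof.
case: (leP 0 u) => h.
  by rewrite ger0_norm// [X in _ + X]max_r ?addr0// oppr_le0.
by rewrite ltr0_norm// [X in _ + X]max_l ?add0r// oppr_ge0 ltW.
Qed.

Definition csummable (T : choiceType) (g : T -> R[i]) : Prop :=
  (esum setT (fun k => (na (g k))%:E) < +oo)%E.

Lemma le_csummable (T : choiceType) (g : T -> R[i]) (b : T -> \bar R) :
  (forall k, (na (g k))%:E <= b k)%E -> (esum setT b < +oo)%E -> csummable g.
Proof. by move=> gb; apply: le_lt_trans; apply: le_esum => k _. Qed.

Lemma csummableZ (T : countType) (z : R[i]) (g : T -> R[i]) :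
  csummable g -> csummable (fun k => z * g k).
Proof.
move=> gs; apply: (@le_csummable _ _ (fun k => (na z)%:E * (na (g k))%:E)%E).
  by move=> k; rewrite -EFinM lee_fin naM.
rewrite esumZl ?na_ge0//; last by move=> k; rewrite lee_fin na_ge0.
by rewrite lte_mul_pinfty ?lee_fin ?na_ge0.
Qed.

Lemma esum_fin (T : choiceType) (a : T -> R) (g : T -> R[i]) : csummable g ->
  (forall k, 0 <= a k <= na (g k)) -> (esum setT (fun k => (a k)%:E) \is a fin_num)%E.
Proof.
move=> gs ag; rewrite ge0_fin_numE; last by apply: esum_ge0 => k _; rewrite lee_fin; have /andP[] := ag k.
by apply: le_lt_trans gs; apply: le_esum => k _; rewrite lee_fin; have /andP[] := ag k.
Qed.

Lemma max0_le_na (h : R[i] -> R) z : (forall z, `|h z| <= na z) ->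
  0 <= Num.max (h z) 0 <= na z /\ 0 <= Num.max (- h z) 0 <= na z.
Proof.
move=> hn; have := hn z; rewrite ler_norml => /andP[h1 h2].
by split; rewrite le_max lexx orbT /= ge_max na_ge0 andbT//; lra.
Qed.

Lemma csum_cvg (T : countType) (g : T -> R[i]) : csummable g ->
  ccvg (fun N => \sum_(0 <= n < N) enum_ext 0 g n) (csum g).
Proof.
move=> gs.
have pos (a : T -> R) : (forall k, 0 <= a k <= na (g k)) ->
    (fun N => \sum_(0 <= n < N) enum_ext 0 a n) @ \oo --> fine (esum setT (fun k => (a k)%:E)).
  move=> ag; have a0 k : (0 <= (a k)%:E)%E by rewrite lee_fin; have /andP[] := ag k.
  have fin := esum_fin gs ag.
  have : (fun N => (\sum_(0 <= n < N) enum_ext 0 (fun k => (a k)%:E) n)%E) @ \oo -->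
      esum setT (fun k => (a k)%:E).
    rewrite esum_enum//; apply: is_cvg_nneseries => n _ _; exact: enum_ext_ge0.
  rewrite -[esum _ _ in X in X -> _]fineK// => /fine_cvg.
  apply: cvg_trans; apply: near_eq_cvg; apply: nearW => N /=.
  rewrite (eq_bigr (fun n => (enum_ext 0 a n)%:E)); first by rewrite sumEFin.
  by move=> n _; rewrite (enum_ext_comp (h := EFin) (w := 0%E)).
have key (h : R[i] -> R) : h 0 = 0 -> (forall z, `|h z| <= na z) ->
    (fun N => \sum_(0 <= n < N) h (enum_ext 0 g n)) @ \oo -->
    fine (esum setT (fun k => (Num.max (h (g k)) 0)%:E)) -
    fine (esum setT (fun k => (Num.max (- h (g k)) 0)%:E)).
  move=> h0 hn.
  have -> : (fun N => \sum_(0 <= n < N) h (enum_ext 0 g n)) = (fun N =>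
      \sum_(0 <= n < N) enum_ext 0 (fun k => Num.max (h (g k)) 0) n -
      \sum_(0 <= n < N) enum_ext 0 (fun k => Num.max (- h (g k)) 0) n).
    apply/funext => N; rewrite -sumrB; apply: eq_bigr => n _.
    rewrite /enum_ext; case: (pickle_inv n) => [k|]; last by rewrite h0 subrr.
    by rewrite posnegE.
  by apply: cvgB; apply: pos => k; have [] := max0_le_na (g k) hn.
split.
  under eq_fun do rewrite Re_sum; apply: (key (@complex.Re R)) => //; exact: na_Re.
under eq_fun do rewrite Im_sum; apply: (key (@complex.Im R)) => //; exact: na_Im.
Qed.

Lemma csum_unique (T : countType) (g : T -> R[i]) l : csummable g ->
  ccvg (fun N => \sum_(0 <= n < N) enum_ext 0 g n) l -> csum g = l.
Proof. by move=> gs; exact: ccvg_unique (csum_cvg gs). Qed.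

Lemma csumZ (T : countType) (z : R[i]) (g : T -> R[i]) : csummable g ->
  csum (fun k => z * g k) = z * csum g.
Proof.
move=> gs; apply: csum_unique; first exact: csummableZ.
have := ccvgM (ccvg_cst z) (csum_cvg gs).
congr ccvg; apply/funext => N; rewrite mulr_sumr; apply: eq_bigr => n _ /=.
by rewrite /enum_ext; case: pickle_inv => //; rewrite mulr0.
Qed.

Lemma na_csum (T : choiceType) (g : T -> R[i]) : csummable g ->
  ((na (csum g))%:E <= esum setT (fun k => (na (g k))%:E))%E.
Proof.
move=> gs.
have f1 := esum_fin gs (fun k => (max0_le_na (g k) (@na_Re R)).1).
have f2 := esum_fin gs (fun k => (max0_le_na (g k) (@na_Re R)).2).
have f3 := esum_fin gs (fun k => (max0_le_na (g k) (@na_Im R)).1).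
have f4 := esum_fin gs (fun k => (max0_le_na (g k) (@na_Im R)).2).
have p (h : T -> R) : 0 <= fine (esum setT (fun k => (Num.max (h k) 0)%:E)).
  by rewrite fine_ge0// esum_ge0// => k _; rewrite lee_fin le_max lexx orbT.
have e : esum setT (fun k => (na (g k))%:E) =
  (fine (esum setT (fun k => (Num.max (complex.Re (g k)) 0)%:E)) +
   fine (esum setT (fun k => (Num.max (- complex.Re (g k)) 0)%:E)) +
   (fine (esum setT (fun k => (Num.max (complex.Im (g k)) 0)%:E)) +
   fine (esum setT (fun k => (Num.max (- complex.Im (g k)) 0)%:E))))%:E.
  rewrite !EFinD !fineK// -!esumD//; try by move=> *; rewrite ?adde_ge0 ?lee_fin ?le_max ?lexx ?orbT.
  by apply: eq_esum => k _; rewrite -!EFinD /na !abs_posneg.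
rewrite e lee_fin /na /csum /=.
apply: lerD.
  have := p (fun k => complex.Re (g k)); have := p (fun k => - complex.Re (g k)).
  by rewrite ler_norml; lra.
have := p (fun k => complex.Im (g k)); have := p (fun k => - complex.Im (g k)).
by rewrite ler_norml; lra.
Qed.

Lemma csummable_slice (T1 T2 : choiceType) (g : T1 * T2 -> R[i]) : csummable g ->
  forall x, csummable (fun y => g (x, y)).
Proof.
rewrite /csummable esum_pair => [gs x|k]; last by rewrite lee_fin na_ge0.
apply: le_lt_trans gs.
have e0 x' : (0 <= esum setT (fun y => (na (g (x', y)))%:E))%E.
  by apply: esum_ge0 => y _; rewrite lee_fin na_ge0.
by apply: esum_ge; exists [set x]; rewrite ?fsbig_set1//; exact: (conj (finite_set1 x)).
Qed.

Lemma csummable_outer (T1 T2 : choiceType) (g : T1 * T2 -> R[i]) : csummable g ->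
  csummable (fun x => csum (fun y => g (x, y))).
Proof.
move=> gs; have sl := csummable_slice gs.
apply: (@le_csummable _ _ (fun x => esum setT (fun y => (na (g (x, y)))%:E))).
  by move=> x; exact: na_csum.
by move: gs; rewrite /csummable esum_pair// => k; rewrite lee_fin na_ge0.
Qed.

(** Sum the identity [(p - q)^+ + q = (p - q)^- + p]. Any decomposition into summable nonnegative
    parts may then replace the positive and negative parts by which [csum] and [rE] are defined. *)
Lemma esum_posB (T : choiceType) (p q : T -> R) :
  (forall k, 0 <= p k) -> (forall k, 0 <= q k) ->
  (esum setT (fun k => (p k)%:E) \is a fin_num)%E ->
  (esum setT (fun k => (q k)%:E) \is a fin_num)%E ->
  fine (esum setT (fun k => (Num.max (p k - q k) 0)%:E)) -
  fine (esum setT (fun k => (Num.max (- (p k - q k)) 0)%:E)) =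
  fine (esum setT (fun k => (p k)%:E)) - fine (esum setT (fun k => (q k)%:E)).
Proof.
move=> p0 q0 pf qf.
have m0 (x : R) : 0 <= Num.max x 0 by rewrite le_max lexx orbT.
have fin (h : T -> R) (b : T -> R) : (forall k, Num.max (h k) 0 <= b k) ->
    (esum setT (fun k => (b k)%:E) \is a fin_num)%E ->
    (esum setT (fun k => (Num.max (h k) 0)%:E) \is a fin_num)%E.
  move=> hb bf; rewrite ge0_fin_numE; last by apply: esum_ge0 => k _; rewrite lee_fin.
  apply: (@le_lt_trans _ _ (esum setT (fun k => (b k)%:E))).
    by apply: le_esum => k _; rewrite lee_fin.
  by rewrite -ge0_fin_numE//; apply: esum_ge0 => k _; rewrite lee_fin (le_trans _ (hb k)).
have f1 : (esum setT (fun k => (Num.max (p k - q k) 0)%:E) \is a fin_num)%E.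
  by apply: (fin _ p _ pf) => k; rewrite ge_max p0 lerBlDr lerDl q0.
have f2 : (esum setT (fun k => (Num.max (- (p k - q k)) 0)%:E) \is a fin_num)%E.
  by apply: (fin _ q _ qf) => k; rewrite ge_max q0 opprB lerBlDr lerDl p0.
have e : (esum setT (fun k => (Num.max (p k - q k) 0)%:E + (q k)%:E) =
          esum setT (fun k => (Num.max (- (p k - q k)) 0)%:E + (p k)%:E))%E.
  apply: eq_esum => k _; rewrite -!EFinD; congr EFin.
  by have := posnegE (p k - q k); lra.
move: e; rewrite !esumD; try by move=> k _; rewrite lee_fin.
rewrite -(fineK f1) -(fineK f2) -(fineK pf) -(fineK qf) -!EFinD => -[].
by rewrite /=; lra.
Qed.

(** Fubini. The inner sums of positive and of negative parts are not the positive and negative parts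
    of the inner sum, which [esum_posB] repairs. *)
Lemma csum_pair (T1 T2 : choiceType) (g : T1 * T2 -> R[i]) : csummable g ->
  csum g = csum (fun x => csum (fun y => g (x, y))).
Proof.
move=> gs; have sl := csummable_slice gs.
have key (h : R[i] -> R) : (forall z, `|h z| <= na z) ->
    fine (esum setT (fun k => (Num.max (h (g k)) 0)%:E)) -
    fine (esum setT (fun k => (Num.max (- h (g k)) 0)%:E)) =
    fine (esum setT (fun x => (Num.max (fine (esum setT (fun y => (Num.max (h (g (x, y))) 0)%:E)) -
      fine (esum setT (fun y => (Num.max (- h (g (x, y))) 0)%:E))) 0)%:E)) -
    fine (esum setT (fun x => (Num.max (- (fine (esum setT (fun y => (Num.max (h (g (x, y))) 0)%:E)) -
      fine (esum setT (fun y => (Num.max (- h (g (x, y))) 0)%:E)))) 0)%:E)).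
  move=> hn.
  have it (a : T1 * T2 -> R) : (forall k, 0 <= a k <= na (g k)) ->
      esum setT (fun x => (fine (esum setT (fun y => (a (x, y))%:E)))%:E) =
      esum setT (fun k => (a k)%:E).
    move=> ag; rewrite [RHS]esum_pair; last by move=> k; rewrite lee_fin; have /andP[] := ag k.
    apply: eq_esum => x _; rewrite fineK//.
    by apply: (esum_fin (sl x)) => y; exact: ag.
  have b1 k := (max0_le_na (g k) hn).1; have b2 k := (max0_le_na (g k) hn).2.
  rewrite (esum_posB (p := fun x => fine (esum setT (fun y => (Num.max (h (g (x, y))) 0)%:E)))
     (q := fun x => fine (esum setT (fun y => (Num.max (- h (g (x, y))) 0)%:E)))).
  - by rewrite (it (fun k => Num.max (h (g k)) 0) b1) (it (fun k => Num.max (- h (g k)) 0) b2).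
  - by move=> x; rewrite fine_ge0// esum_ge0// => y _; rewrite lee_fin le_max lexx orbT.
  - by move=> x; rewrite fine_ge0// esum_ge0// => y _; rewrite lee_fin le_max lexx orbT.
  - by rewrite (it (fun k => Num.max (h (g k)) 0) b1); exact: (esum_fin gs b1).
  - by rewrite (it (fun k => Num.max (- h (g k)) 0) b2); exact: (esum_fin gs b2).
rewrite /csum; congr (_ +i* _).
  by rewrite (key (@complex.Re R))//; exact: na_Re.
by rewrite (key (@complex.Im R))//; exact: na_Im.
Qed.

Lemma csum_reindex (T1 T2 : choiceType) (e : T1 -> T2) (g : T2 -> R[i]) :
  bijective e -> csum g = csum (g \o e).
Proof. by move=> eb; rewrite /csum !(reindex_esum_bij _ eb). Qed.

Lemma csummable_reindex (T1 T2 : choiceType) (e : T1 -> T2) (g : T2 -> R[i]) :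
  bijective e -> csummable g <-> csummable (g \o e).
Proof. by move=> eb; rewrite /csummable !(reindex_esum_bij _ eb). Qed.

(** The sum [G] of the norms dominates all partial sums, and its integral is the finite sum in the
    last hypothesis; dominated convergence does the exchange. *)
Lemma csum_integral d (O : measurableType d) (mu : {measure set O -> \bar R})
    (T : countType) (F : T -> O -> R[i]) :
  (forall k, cmf (F k)) -> (forall x, csummable (F ^~ x)) ->
  (esum setT (fun k => \int[mu]_x (na (F k x))%:E) < +oo)%E ->
  [/\ cintegrable mu (fun x => csum (F ^~ x)),
      csummable (fun k => cintegral mu (F k)) &
      cintegral mu (fun x => csum (F ^~ x)) = csum (fun k => cintegral mu (F k))].
Proof.
move=> Fm Fs Fi.
have n0 k x : (0 <= (na (F k x))%:E)%E by rewrite lee_fin na_ge0.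
have i0 k : (0 <= \int[mu]_x (na (F k x))%:E)%E by apply: integral_ge0 => x _.
have Fk k : cintegrable mu (F k).
  split=> //; apply: le_lt_trans Fi.
  by apply: esum_ge; exists [set k]; rewrite ?fsbig_set1//; exact: (conj (finite_set1 k)).
pose G x := fine (esum setT (fun k => (na (F k x))%:E)).
have GE x : (G x)%:E = esum setT (fun k => (na (F k x))%:E).
  by rewrite fineK//; apply: (esum_fin (Fs x)) => k; rewrite na_ge0 lexx.
have GE' x : (G x)%:E = (\sum_(0 <= n <oo) enum_ext 0 (fun k => (na (F k x))%:E) n)%E.
  by rewrite GE esum_enum.
have em n : measurable_fun setT (fun x => enum_ext 0 (fun k => (na (F k x))%:E) n)%E.
  rewrite /enum_ext; case: pickle_inv => [k|]; last exact: measurable_cst.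
  by apply/measurable_EFinP; exact: measurable_na.
have Gi : mu.-integrable setT (EFin \o G).
  apply/integrableP; split.
    apply: (eq_measurable_fun (fun x => \sum_(0 <= n <oo) enum_ext 0 (fun k => (na (F k x))%:E) n)%E).
      by move=> x _; rewrite -GE'.
    by apply: ge0_emeasurable_sum => [n x _ _|n _]; [exact: enum_ext_ge0|exact: em].
  rewrite (eq_integral (fun x => \sum_(0 <= n <oo) enum_ext 0 (fun k => (na (F k x))%:E) n)%E); last first.
    move=> x _ /=; rewrite ger0_norm ?GE'//.
    by rewrite -lee_fin GE; exact: esum_ge0.
  rewrite integral_nneseries//; last by move=> n x _; exact: enum_ext_ge0.
  rewrite (eq_eseriesr (g := enum_ext 0%E (fun k => \int[mu]_x (na (F k x))%:E)%E)); last first.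
    by move=> n _; rewrite /enum_ext; case: pickle_inv => [//|]; rewrite integral0.
  by rewrite -esum_enum.
pose u N x := \sum_(0 <= n < N) enum_ext 0 (F ^~ x) n.
have um N : cmf (u N).
  apply: cmf_sum => n _; rewrite /enum_ext; case: pickle_inv => [k|]; [exact: Fm|exact: cmf_cst].
have uc x : ccvg (u ^~ x) (csum (F ^~ x)) by exact: csum_cvg.
have ub N x : na (u N x) <= G x.
  apply: (le_trans (na_sum _ _ _)); rewrite -lee_fin GE' -sumEFin.
  rewrite (eq_bigr (enum_ext 0%E (fun k => (na (F k x))%:E))); last first.
    by move=> n _; rewrite -(enum_ext_comp (h := fun z => (na z)%:E) (z := 0))// na0.
  by apply: nneseries_lim_ge => n _ _; exact: enum_ext_ge0.
have cs : csummable (fun k => cintegral mu (F k)).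
  by apply: le_csummable Fi => k; exact: na_cintegral.
split => //; first exact: (dominated_cintegrable um uc Gi ub).
have h := dominated_ccvg um uc Gi ub.
apply: ccvg_unique h _; have := csum_cvg cs.
congr ccvg; apply/funext => N; rewrite cintegral_sum.
  apply: eq_bigr => n _; rewrite /enum_ext; case: pickle_inv => [//|].
  by rewrite /cintegral /Rintegral !integral0.
move=> n _; rewrite /enum_ext; case: pickle_inv => [k|]; first exact: Fk.
by split; [exact: cmf_cst|under eq_integral do rewrite na0; rewrite integral0].
Qed.

End CountableSums.

(** * Summability of the resolvent against the potential *)

Section Summability.
Variable R : realType.

Lemma esum_int_le (a : int -> R) (C : R) : (forall m, 0 <= a m) ->
  (forall N, \sum_(0 <= n < N) a (Posz n) <= C) -> (forall N, \sum_(0 <= n < N) a (Negz n) <= C) ->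
  (esum setT (fun m => (a m)%:E) <= (C + C)%:E)%E.
Proof.
move=> a0 hP hN.
rewrite (@reindex_esum_bij R _ _ (fun x : bool * nat => if x.1 then Posz x.2 else Negz x.2)); last first.
  by exists (fun m => match m with Posz n => (true, n) | Negz n => (false, n) end) => [[[] n]|[]].
have le (b : nat -> R) : (forall n, 0 <= b n) -> (forall N, \sum_(0 <= n < N) b n <= C) ->
    (esum setT (fun n => (b n)%:E) <= C%:E)%E.
  move=> b0 hb; rewrite -(nneseries_esumT) => [|n]; last by rewrite lee_fin.
  by apply: lime_le; [apply: is_cvg_nneseries => n _ _; rewrite lee_fin|apply: nearW => N; rewrite sumEFin lee_fin].
rewrite esum_pair; last by move=> [b n] /=; rewrite lee_fin.
rewrite (_ : [set: bool] = [set true; false]); last by apply/seteqP; split => // -[]; [left|right].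
rewrite esum_fset//=; last by move=> b _; apply: esum_ge0 => n _; rewrite lee_fin.
rewrite fsbigU//=; last by move=> x [-> /=].
by rewrite !fsbig_set1 EFinD leeD// le.
Qed.

Section Root.
Variable d : nat.
Hypothesis d0 : (0 < d)%N.

(** With the exponent [1/d], a product over [d] coordinates is at most one plus the largest
    [|m|]. *)
Definition rt (m : int) : R := (1 + `|m|%N%:R) `^ (d%:R^-1).

Lemma rtX m : rt m ^+ d = 1 + `|m|%N%:R.
Proof.
have p : 0 <= 1 + `|m|%N%:R :> R by rewrite addr_ge0.
by rewrite -powR_mulrn ?powR_ge0// /rt -powRrM mulVf ?powRr1// pnatr_eq0 -lt0n.
Qed.

Lemma rt_ge1 m : 1 <= rt m.
Proof.
rewrite leNgt; apply/negP => h.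
have : rt m ^+ d < 1 by rewrite exprn_ilt1 ?powR_ge0// -lt0n.
by rewrite rtX ltNge lerDl ler0n.
Qed.

(* With [x], [y] the [d]-th roots of consecutive integers, [1/x - 1/y] dominates
   [y ^- (d + 1) / d], so the series of [rt ^- (d + 1)] telescopes. *)
Lemma rt_telescope (x y : R) : 1 <= x -> x <= y -> y ^+ d = x ^+ d + 1 ->
  y^-1 ^+ d.+1 <= d%:R * (x^-1 - y^-1).
Proof.
move=> x1 xy e.
have x0 : 0 < x by lra. have y0 : 0 < y by lra.
have : 1 <= (y - x) * (d%:R * y ^+ d.-1).
  rewrite [X in X <= _](_ : 1 = y ^+ d - x ^+ d); last by rewrite e; lra.
  rewrite subrXX ler_wpM2l ?subr_ge0//.
  have -> : d%:R * y ^+ d.-1 = \sum_(i < d) y ^+ d.-1.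
    by rewrite sumr_const card_ord mulr_natl.
  apply: ler_sum => i _.
  have -> : y ^+ d.-1 = y ^+ (d.-1 - i) * y ^+ i.
    by rewrite -exprD subnK// -ltnS prednK.
  rewrite ler_wpM2l ?exprn_ge0 ?(ltW y0)//.
  by apply: lerXn2r; rewrite ?nnegrE ?(ltW x0) ?(ltW y0).
move=> h.
rewrite exprVn -[(y ^+ d.+1)^-1]mul1r ler_pdivrMr ?exprn_gt0//.
have -> : x^-1 - y^-1 = (y - x) / (x * y) by field; rewrite !gt_eqF.
have -> : y ^+ d.+1 = y ^+ d.-1 * y * y by rewrite -!exprSr prednK.
apply: (le_trans h).
have -> : d%:R * ((y - x) / (x * y)) * (y ^+ d.-1 * y * y) = (y - x) * (d%:R * y ^+ d.-1) * (y / x).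
  by field; rewrite !gt_eqF.
rewrite ler_peMr//; first by lra.
by rewrite ler_pdivlMr// mul1r.
Qed.

(** On each half line the telescoping part is at most [d], and the term at 0 is at most 1. [Negz n]
    has absolute value [n.+1], so the negative half consists of the telescoping part alone. *)
Lemma esum_rt : (esum setT (fun m => ((rt m)^-1 ^+ d.+1)%:E) <= ((1 + d%:R) + (1 + d%:R))%:E)%E.
Proof.
have mono n : rt (Posz n) <= rt (Posz n.+1).
  rewrite -(ler_pXn2r d0) ?nnegrE ?powR_ge0// !rtX lerD2l ler_nat//.
have key N : \sum_(0 <= n < N) (rt (Posz n.+1))^-1 ^+ d.+1 <= d%:R * ((rt 0)^-1 - (rt (Posz N))^-1).
  elim: N => [|N IH]; first by rewrite big_nil subrr mulr0.
  rewrite big_nat_recr//=.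
  have := rt_telescope (rt_ge1 (Posz N)) (mono N) _.
  rewrite !rtX /= -addrA -[in X in (X -> _)]natr1 => /(_ erefl).
  by move: IH; nra.
have rtN n : rt (Negz n) = rt (Posz n.+1) by [].
have inv0 m : 0 < (rt m)^-1 by rewrite invr_gt0 (lt_le_trans ltr01 (rt_ge1 m)).
have inv1 m : (rt m)^-1 <= 1 by rewrite invf_le1 ?rt_ge1// (lt_le_trans ltr01 (rt_ge1 m)).
have bd N : d%:R * ((rt 0)^-1 - (rt (Posz N))^-1) <= d%:R.
  by rewrite ler_piMr//; have := inv0 (Posz N); have := inv1 0; lra.
apply: esum_int_le => [m|N|N].
- by rewrite exprn_ge0// ltW.
- case: N => [|N]; first by rewrite big_nil addr_ge0.
  rewrite big_nat_recl// lerD//; first by rewrite exprn_ile1// ?(ltW (inv0 _)).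
  exact: le_trans (key N) (bd N).
- under eq_bigr do rewrite rtN.
  by apply: le_trans (key N) _; apply: le_trans (bd N) _; rewrite lerDr.
Qed.

End Root.

Lemma esum_rV_prod n (g : 'I_n -> int -> R) (c : R) : 0 <= c -> (forall j m, 0 <= g j m) ->
  (forall j, (esum setT (fun m => (g j m)%:E) <= c%:E)%E) ->
  (esum setT (fun q : 'rV[int]_n => (\prod_j g j (q 0 j))%:E) <= (c ^+ n)%:E)%E.
Proof.
move=> c0; elim: n g => [|n IH] g g0 gc.
  rewrite (_ : [set: 'rV[int]_0] = [set 0]); last first.
    by apply/seteqP; split => // q _; rewrite /= thinmx0.
  by rewrite esum_set1 ?lee_fin big_ord0 ?expr0.
rewrite (@reindex_esum_bij R _ _ (fun x : int * 'rV[int]_n => row_mx (const_mx x.1) x.2 : 'rV_(1 + n))); last first.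
  exists (fun q : 'rV_(1 + n) => (lsubmx q 0 0, rsubmx q)) => [[m q]|q] /=.
    by rewrite row_mxKl row_mxKr mxE.
  rewrite -[RHS]hsubmxK; congr row_mx; apply/rowP => j; rewrite !mxE.
  by rewrite !ord1.
rewrite esum_pair; last by move=> x /=; rewrite lee_fin prodr_ge0.
apply: (@le_trans _ _ (esum setT (fun m => (c ^+ n)%:E * (g ord0 m)%:E)%E)).
  apply: le_esum => m _ /=.
  rewrite (_ : esum _ _ = ((g ord0 m)%:E * esum setT (fun q : 'rV[int]_n => (\prod_j g (lift ord0 j) (q 0 j))%:E))%E).
    rewrite muleC; apply: lee_wpmul2r; first by rewrite lee_fin.
    by apply: (IH (fun j => g (lift ord0 j))).
  rewrite -esumZl//; last by move=> q; rewrite lee_fin prodr_ge0.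
  apply: eq_esum => q _; rewrite -EFinM big_ord_recl; congr (_ * _)%:E.
    have e1 : row_mx (const_mx m : 'rV_1) q 0 (lshift n ord0) = m by rewrite row_mxEl mxE.
    by congr g; rewrite -[RHS]e1; congr (row_mx _ _ _ _); exact: val_inj.
  apply: eq_bigr => j _; congr g.
  have e1 : row_mx (const_mx m : 'rV_1) q 0 (rshift 1 j) = q 0 j by rewrite row_mxEr.
  by rewrite -[RHS]e1; congr (row_mx _ _ _ _); exact: val_inj.
rewrite esumZl ?exprn_ge0//; last by move=> m; rewrite lee_fin.
rewrite exprSr EFinM; apply: lee_wpmul2l; first by rewrite lee_fin exprn_ge0.
exact: gc.
Qed.

End Summability.

(** * Sums over momentum paths *)

Section FunCons.
Variable (K : countType).

Definition fcons n (x : K * {ffun 'I_n -> K}) : {ffun 'I_n.+1 -> K} :=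
  [ffun j => if unlift ord0 j is Some i then x.2 i else x.1].

Lemma fcons0 n x : @fcons n x ord0 = x.1.
Proof. by rewrite ffunE unlift_none. Qed.

Lemma fconsS n x i : @fcons n x (lift ord0 i) = x.2 i.
Proof. by rewrite ffunE liftK. Qed.

Lemma fcons_bij n : bijective (@fcons n).
Proof.
exists (fun k : {ffun 'I_n.+1 -> K} => (k ord0, [ffun i => k (lift ord0 i)])).
  move=> [x k] /=; rewrite fcons0; congr pair.
  by apply/ffunP => i; rewrite ffunE fconsS.
move=> k; apply/ffunP => j; rewrite ffunE /=.
by case: unliftP => [i ->|->]; rewrite ?ffunE.
Qed.

End FunCons.

Section ChainSums.
Variables (R : realType) (d : nat).
Local Notation K := 'rV[int]_d.
Variables (r f : K -> R[i]).

Section Abs.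
Variable beta : K -> R.
Hypothesis beta0 : forall k, 0 <= beta k.

(** The chain with its factors replaced by norms and by the majorant [beta]. Its values are extended
    reals, so it can be written down before it is known to be finite. *)
Fixpoint Tabs n (k : K) : \bar R :=
  match n with
  | 0 => (na (r k) * na (f k))%:E
  | n'.+1 => ((na (r k))%:E * esum setT (fun q => (beta (k - q))%:E * Tabs n' q))%E
  end.

Definition habs n (k : {ffun 'I_n.+1 -> K}) : R :=
  (\prod_j na (r (k j))) * (\prod_l beta (kdiff k l)) * na (f (k ord_max)).

Lemma habs_ge0 n k : 0 <= @habs n k.
Proof. by rewrite !mulr_ge0 ?na_ge0// prodr_ge0// => j _; rewrite ?na_ge0. Qed.

Lemma Tabs_ge0 n k : (0 <= Tabs n k)%E.
Proof.
elim: n k => [|n IH] k /=; first by rewrite lee_fin mulr_ge0 ?na_ge0.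
by rewrite mule_ge0 ?lee_fin ?na_ge0// esum_ge0// => q _; rewrite mule_ge0 ?lee_fin.
Qed.

Lemma kdiff_fcons0 n x : kdiff (@fcons K n.+1 x) ord0 = x.1 - x.2 ord0.
Proof.
rewrite /kdiff fconsS (_ : widen_ord _ _ = ord0) ?fcons0//; exact: val_inj.
Qed.

Lemma kdiff_fconsS n x l : kdiff (@fcons K n.+1 x) (lift ord0 l) = kdiff x.2 l.
Proof.
rewrite /kdiff fconsS; congr (_ - _).
rewrite (_ : widen_ord _ (lift ord0 l) = lift ord0 (widen_ord (leqnSn n) l)) ?fconsS//.
exact: val_inj.
Qed.

Lemma habs_fcons n x : habs (@fcons K n.+1 x) = na (r x.1) * beta (x.1 - x.2 ord0) * habs x.2.
Proof.
rewrite /habs big_ord_recl fcons0 [X in _ * X * _]big_ord_recl kdiff_fcons0.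
rewrite [\prod_(i < n.+1) _](eq_bigr (fun i => na (r (x.2 i)))); last by move=> i _; rewrite fconsS.
rewrite [\prod_(i < n) _](eq_bigr (fun l => beta (kdiff x.2 l))); last by move=> l _; rewrite kdiff_fconsS.
rewrite (_ : ord_max = lift ord0 ord_max) ?fconsS; last exact: val_inj.
ring.
Qed.

Lemma esum_unique (T : choiceType) (x : T) (a : T -> \bar R) : (forall y, y = x) -> (0 <= a x)%E ->
  esum setT a = a x.
Proof.
move=> u a0; rewrite (_ : [set: T] = [set x]) ?esum_set1//.
by apply/seteqP; split => // y _; rewrite /= (u y).
Qed.

(** Tonelli, peeling off the first momentum of the path. *)
Lemma esum_habs n k : esum setT (fun kk => (habs (@fcons K n (k, kk)))%:E) = Tabs n k.
Proof.
elim: n k => [|n IH] k /=.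
  rewrite (@esum_unique _ [ffun => k]).
  - by rewrite /habs big_ord1 big_ord0 mulr1 (_ : ord_max = ord0) ?fcons0//; exact: val_inj.
  - by move=> y; apply/ffunP => -[].
  - by rewrite lee_fin habs_ge0.
rewrite (@reindex_esum_bij R _ _ (@fcons K n)); last exact: fcons_bij.
rewrite esum_pair; last by move=> x /=; rewrite lee_fin habs_ge0.
rewrite -esumZl ?na_ge0//; last by move=> q; rewrite mule_ge0 ?lee_fin ?Tabs_ge0.
apply: eq_esum => q _; rewrite -IH -esumZl//; last by move=> kk; rewrite lee_fin habs_ge0.
rewrite -esumZl ?na_ge0//; last by move=> kk; rewrite mule_ge0 ?lee_fin ?habs_ge0.
by apply: eq_esum => kk _ /=; rewrite habs_fcons /= fcons0 -!EFinM mulrA.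
Qed.

Lemma esum_habs_weight n (a : K -> R) : (forall k, 0 <= a k) ->
  esum setT (fun kk : {ffun 'I_n.+1 -> K} => (a (kk ord0) * habs kk)%:E) =
  esum setT (fun k => (a k)%:E * Tabs n k)%E.
Proof.
move=> a0; rewrite (@reindex_esum_bij R _ _ (@fcons K n)); last exact: fcons_bij.
rewrite esum_pair; last by move=> x /=; rewrite lee_fin mulr_ge0 ?habs_ge0.
apply: eq_esum => k _; rewrite -esum_habs -esumZl//; last by move=> kk; rewrite lee_fin habs_ge0.
by apply: eq_esum => kk _ /=; rewrite fcons0.
Qed.

Section Signed.
Variables (W : K -> R[i]) (S : R).
Hypothesis S0 : 0 <= S.
Hypothesis WS : forall p, na (W p) <= S * beta p.

(** With [r] the resolvent factor, [W] the convolution kernel of the potential and [f] the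
    coefficients of a function, these are the coefficients of the alternating product of resolvents
    and potentials applied to that function. *)
Fixpoint Tsum n (k : K) : R[i] :=
  match n with
  | 0 => r k * f k
  | n'.+1 => r k * csum (fun q => W (k - q) * Tsum n' q)
  end.

Definition hprod n (k : {ffun 'I_n.+1 -> K}) : R[i] :=
  (\prod_j r (k j)) * (\prod_l W (kdiff k l)) * f (k ord_max).

Lemma hprod_fcons n x : hprod (@fcons K n.+1 x) = r x.1 * W (x.1 - x.2 ord0) * hprod x.2.
Proof.
rewrite /hprod big_ord_recl fcons0 [X in _ * X * _]big_ord_recl kdiff_fcons0.
rewrite [\prod_(i < n.+1) _](eq_bigr (fun i => r (x.2 i))); last by move=> i _; rewrite fconsS.
rewrite [\prod_(i < n) _](eq_bigr (fun l => W (kdiff x.2 l))); last by move=> l _; rewrite kdiff_fconsS.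
rewrite (_ : ord_max = lift ord0 ord_max) ?fconsS; last exact: val_inj.
ring.
Qed.

(** Splitting off [S ^+ n] separates the configuration, which will enter through [S], from a
    deterministic majorant. *)
Lemma na_hprod n (k : {ffun 'I_n.+1 -> K}) : na (hprod k) <= S ^+ n * habs k.
Proof.
apply: (le_trans (naM _ _)); rewrite /habs [X in _ <= X]mulrA ler_wpM2r ?na_ge0//.
apply: (le_trans (naM _ _)); rewrite mulrCA.
apply: ler_pM; rewrite ?na_ge0 ?na_prod//.
apply: (le_trans (na_prod _ _ _)); rewrite -[X in S ^+ X]card_ord -prodr_const -big_split /=.
by apply: ler_prod => l _; rewrite na_ge0 WS.
Qed.

Hypothesis Tfin : forall n k, (Tabs n k < +oo)%E.

Lemma hprod_csummable n k : csummable (fun kk => hprod (@fcons K n (k, kk))).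
Proof.
apply: (@le_csummable _ _ _ (fun kk => (S ^+ n)%:E * (habs (@fcons K n (k, kk)))%:E)%E).
  by move=> kk; rewrite -EFinM lee_fin na_hprod.
rewrite esumZl ?exprn_ge0//; last by move=> kk; rewrite lee_fin habs_ge0.
by rewrite esum_habs lte_mul_pinfty// lee_fin exprn_ge0.
Qed.

Lemma csum_singleton (T : choiceType) (x : T) (a : T -> R[i]) : (forall y, y = x) ->
  csum a = a x.
Proof.
move=> u; have m0 (b : R) : (0 <= (Num.max b 0)%:E)%E by rewrite lee_fin le_max lexx orbT.
rewrite /csum !(esum_unique u)//= !posnegE.
by case: (a x).
Qed.

Lemma csum_hprod n k : csum (fun kk => hprod (@fcons K n (k, kk))) = Tsum n k.
Proof.
elim: n k => [|n IH] k /=.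
  rewrite (@csum_singleton _ [ffun => k]).
    by rewrite /hprod big_ord1 big_ord0 mulr1 (_ : ord_max = ord0) ?fcons0//; exact: val_inj.
  by move=> y; apply/ffunP => -[].
have cs := @hprod_csummable n.+1 k.
rewrite (csum_reindex _ (@fcons_bij _ n)).
have cs' := (csummable_reindex _ (@fcons_bij _ n)).1 cs.
rewrite csum_pair//.
have e q : csum (fun kk => hprod (fcons (k, @fcons K n (q, kk)))) = r k * (W (k - q) * Tsum n q).
  rewrite -IH -csumZ; last exact: hprod_csummable.
  rewrite -csumZ; last by apply: csummableZ; exact: hprod_csummable.
  by congr csum; apply/funext => kk; rewrite hprod_fcons /= fcons0 mulrA.
rewrite (_ : (fun q => _) = fun q => r k * (W (k - q) * Tsum n q)); last by apply/funext => q; exact: e.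
(* Summability of [W (k - q) * Tsum n q] is only known after multiplication by [r k]. It is
   recovered by division, and for [r k = 0] both sides vanish. *)
have [r0|r0] := eqVneq (r k) 0.
  rewrite r0 mul0r (_ : (fun q => _) = fun=> 0 * 0) ?csumZ ?mul0r//.
    by rewrite /csummable; under eq_esum do rewrite na0; rewrite esum1.
  by apply/funext => q; rewrite !mul0r.
rewrite csumZ//.
have := csummable_outer cs'; under eq_fun do rewrite e.
move/(csummableZ (r k)^-1); congr csummable.
by apply/funext => q; rewrite mulKf.
Qed.

Lemma csum_hprod_weight n (g : K -> R[i]) :
  (esum setT (fun k => (na (g k))%:E * Tabs n k) < +oo)%E ->
  csummable (fun k : {ffun 'I_n.+1 -> K} => g (k ord0) * hprod k) /\
  csum (fun k : {ffun 'I_n.+1 -> K} => g (k ord0) * hprod k) = csum (fun k => g k * Tsum n k).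
Proof.
move=> gfin.
have cs : csummable (fun k : {ffun 'I_n.+1 -> K} => g (k ord0) * hprod k).
  apply: (@le_csummable _ _ _ (fun k : {ffun 'I_n.+1 -> K} => (S ^+ n)%:E * (na (g (k ord0)) * habs k)%:E)%E).
    move=> k; rewrite -EFinM lee_fin (le_trans (naM _ _))// mulrCA.
    by rewrite ler_wpM2l ?na_ge0// na_hprod.
  rewrite esumZl ?exprn_ge0//; last by move=> k; rewrite lee_fin mulr_ge0 ?na_ge0 ?habs_ge0.
  by rewrite (esum_habs_weight _ (fun k => na_ge0 (g k))) lte_mul_pinfty// lee_fin exprn_ge0.
split => //.
rewrite (csum_reindex _ (@fcons_bij _ n)) csum_pair; last first.
  exact: (csummable_reindex _ (@fcons_bij _ n)).1 cs.
congr csum; apply/funext => k.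
rewrite -csum_hprod -csumZ; last exact: hprod_csummable.
by congr csum; apply/funext => kk /=; rewrite fcons0.
Qed.

End Signed.
End Abs.
End ChainSums.

(** * Schur test for the kernel weighted by the resolvent *)

Section Schur.
Variables (R : realType) (d : nat).
Hypothesis d0 : (0 < d)%N.
Local Notation K := 'rV[int]_d.

Definition rho (k : K) : R := \prod_j (rt R d (k 0 j))^-1.

Let w m : R := (rt R d m)^-1.
Let w0 m : 0 < w m. Proof. by rewrite invr_gt0 (lt_le_trans ltr01)// rt_ge1. Qed.
Let w1 m : w m <= 1.
Proof. by rewrite invf_le1 ?rt_ge1// (lt_le_trans ltr01)// rt_ge1. Qed.

Lemma rho_gt0 k : 0 < rho k.
Proof. by apply: prodr_gt0 => j _; exact: w0. Qed.

Lemma rho_le1 k : rho k <= 1.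
Proof. by apply: prodr_ile1 => j _; rewrite ltW ?w0 ?w1. Qed.

(* Each factor of [rho] is at least that of the largest coordinate of [k]. *)
Lemma rho2_ge (k : K) (A : R) : (forall j, (1 + (absz (k 0 j))%:R) ^+ 2 <= A) -> 1 <= A * rho k ^+ 2.
Proof.
move=> hA.
have [j hj] : exists j, forall i, rt R d (k 0 i) <= rt R d (k 0 j).
  have [j _ hj] := @arg_maxP _ _ _ (Ordinal d0) xpredT (fun i => rt R d (k 0 i)) isT.
  by exists j => i; exact: hj.
have p i : 0 < rt R d (k 0 i) by rewrite (lt_le_trans ltr01)// rt_ge1.
have h : \prod_i rt R d (k 0 i) <= rt R d (k 0 j) ^+ d.
  rewrite -[X in _ ^+ X]card_ord -prodr_const; apply: ler_prod => i _.
  by rewrite hj ltW.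
have e : rho k * \prod_i rt R d (k 0 i) = 1.
  by rewrite -big_split big1// => i _; rewrite /= mulVf// gt_eqF.
have h2 : (\prod_i rt R d (k 0 i)) ^+ 2 <= A.
  apply: le_trans (hA j); rewrite -(rtX R d0).
  by apply: lerXn2r; rewrite ?nnegrE ?exprn_ge0 ?prodr_ge0 ?(ltW (p _))// => i _; rewrite ltW.
by rewrite -[1](expr1n _ 2) -e exprMn mulrC ler_wpM2r// sqr_ge0.
Qed.

Let Z : R := (1 + d%:R) + (1 + d%:R).

(** The product of [d + 1] factors is at most the power [d + 1] of the larger of the two weights,
    hence at most the sum of both powers, each of which sums to at most [Z]. *)
Let one_dim (m : int) : (esum setT (fun q => (w (m - q) ^+ d * w q)%:E) <= (Z + Z)%:E)%E.
Proof.
apply: (@le_trans _ _ (esum setT (fun q => (w (m - q) ^+ d.+1)%:E + (w q ^+ d.+1)%:E)%E)).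
  apply: le_esum => q _; rewrite -EFinD lee_fin.
  have [h|h] := leP (w (m - q)) (w q).
    rewrite exprSr [w q ^+ _]exprSr.
    have : w (m - q) ^+ d <= w q ^+ d by apply: lerXn2r h; rewrite nnegrE ltW.
    move=> /(ler_wpM2r (ltW (w0 q))) => h2; apply: (le_trans h2).
    by rewrite lerDr mulr_ge0 ?exprn_ge0// ltW.
  rewrite exprSr ler_wpDr ?exprn_ge0 ?(ltW (w0 _))//.
  by rewrite ler_wpM2l ?exprn_ge0 ?(ltW (w0 _))// ltW.
rewrite esumD; try by move=> q _; rewrite lee_fin exprn_ge0 ?ltW.
rewrite EFinD; apply: leeD; last exact: esum_rt.
rewrite -(@reindex_esum_bij R _ _ (fun q => m - q) (fun q => (w q ^+ d.+1)%:E)); first exact: esum_rt.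
by exists (fun q => m - q) => q; rewrite subKr.
Qed.

Let row (k : K) : (esum setT (fun q : K => (\prod_j (w (k 0 j - q 0 j) ^+ d * w (q 0 j)))%:E) <=
  ((Z + Z) ^+ d)%:E)%E.
Proof.
have Z0 : 0 <= Z + Z by rewrite !addr_ge0.
apply: (@esum_rV_prod R d (fun j m => w (k 0 j - m) ^+ d * w m) _ Z0) => [j m|j].
  by rewrite mulr_ge0 ?exprn_ge0// ltW.
exact: one_dim.
Qed.

Variables (beta : K -> R) (Cb : R).
Hypothesis Cb0 : 0 <= Cb.
Hypothesis beta0 : forall k, 0 <= beta k.
Hypothesis betaC : forall k, beta k <= Cb * \prod_j (1 + (absz (k 0 j))%:R)^-1.

(** When [r = O(rho^2)], each resolvent lends one [rho] to the step on its left and one to the step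
    on its right; two outer copies remain. *)
Definition ker k q : R := rho k * beta (k - q) * rho q.

Let M : R := Cb * (Z + Z) ^+ d.
Let M0 : 0 <= M. Proof. by rewrite mulr_ge0// exprn_ge0// !addr_ge0. Qed.

Let beta_w k q : beta (k - q) <= Cb * \prod_j w (k 0 j - q 0 j) ^+ d.
Proof.
apply: le_trans (betaC _) _; rewrite ler_wpM2l//.
rewrite le_eqVlt; apply/orP; left; apply/eqP; apply: eq_bigr => j _.
by rewrite !mxE exprVn rtX.
Qed.

Let wN m : w (- m) = w m. Proof. by rewrite /w /rt abszN. Qed.

Let ker_ge0 k q : 0 <= ker k q.
Proof. by rewrite !mulr_ge0// ltW// rho_gt0. Qed.

Lemma ker_row k : (esum setT (fun q => (ker k q)%:E) <= M%:E)%E.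
Proof.
apply: (@le_trans _ _ (esum setT (fun q : K => Cb%:E * (\prod_j (w (k 0 j - q 0 j) ^+ d * w (q 0 j)))%:E)%E)).
  apply: le_esum => q _; rewrite -EFinM lee_fin big_split /= mulrA.
  rewrite /ker ler_wpM2r ?(ltW (rho_gt0 q))//.
  by apply: le_trans (beta_w k q); rewrite ler_piMl// rho_le1.
rewrite esumZl//; last by move=> q; rewrite lee_fin prodr_ge0// => j _; rewrite mulr_ge0 ?exprn_ge0 ?ltW.
by rewrite /M EFinM; apply: lee_wpmul2l; [rewrite lee_fin|exact: row].
Qed.

(** As for rows, except that [rho q] is now the factor bounded by 1 and [rho k] the one kept;
    evenness of [w] exchanges the two arguments. *)
Lemma ker_col q : (esum setT (fun k => (ker k q)%:E) <= M%:E)%E.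
Proof.
apply: (@le_trans _ _ (esum setT (fun k : K => Cb%:E * (\prod_j (w (q 0 j - k 0 j) ^+ d * w (k 0 j)))%:E)%E)).
  apply: le_esum => k _; rewrite -EFinM lee_fin big_split /= mulrA.
  rewrite /ker mulrAC; apply: (@le_trans _ _ (rho k * rho q * (Cb * \prod_j w (q 0 j - k 0 j) ^+ d))).
    rewrite ler_wpM2l ?mulr_ge0 ?(ltW (rho_gt0 _))//; apply: le_trans (beta_w k q) _.
    by rewrite ler_wpM2l// ler_prod// => j _; rewrite -wN opprB lexx andbT exprn_ge0// ltW.
  rewrite mulrC ler_wpM2l ?mulr_ge0 ?prodr_ge0//; first by move=> j _; rewrite exprn_ge0 ?ltW.
  by rewrite ler_piMr ?rho_le1// ltW// rho_gt0.
rewrite esumZl//; last by move=> k; rewrite lee_fin prodr_ge0// => j _; rewrite mulr_ge0 ?exprn_ge0 ?ltW.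
by rewrite /M EFinM; apply: lee_wpmul2l; [rewrite lee_fin|exact: row].
Qed.

Fixpoint kpow n (u : K -> \bar R) (k : K) : \bar R :=
  if n is n'.+1 then esum setT (fun q => (ker k q)%:E * kpow n' u q)%E else u k.

Lemma kpow_ge0 n u k : (forall k, 0 <= u k)%E -> (0 <= kpow n u k)%E.
Proof.
move=> u0; elim: n k => //= n IH k.
by apply: esum_ge0 => q _; rewrite mule_ge0 ?lee_fin.
Qed.

(* [a u <= a^2 + u^2] inside the iterated kernel: with the Schur bounds on rows
   and columns this plays the role of the L2 operator bound. *)
Lemma kpow_amgm n (a : R) (u : K -> R) k : 0 <= a -> (forall k, 0 <= u k) ->
  (a%:E * kpow n (EFin \o u) k <=
   (a ^+ 2)%:E * kpow n (fun=> 1) k + kpow n (fun k => (u k ^+ 2)%:E) k)%E.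
Proof.
move=> a0 u0; elim: n k => [|n IH] k /=.
  rewrite mule1 -EFinM -EFinD lee_fin.
  by have := sqr_ge0 (a - u k); rewrite sqrrB; nra.
have p0 q : (0 <= kpow n (EFin \o u) q)%E by apply: kpow_ge0 => x; rewrite lee_fin /=.
have p1 q : (0 <= kpow n (fun=> 1%:E) q)%E by apply: kpow_ge0 => x; rewrite lee_fin.
have p2 q : (0 <= kpow n (fun k => (u k ^+ 2)%:E) q)%E by apply: kpow_ge0 => x; rewrite lee_fin sqr_ge0.
rewrite -!esumZl ?sqr_ge0//; try by move=> q; rewrite mule_ge0 ?lee_fin.
rewrite -esumD; try by move=> q _; rewrite !mule_ge0 ?lee_fin ?sqr_ge0.
apply: le_esum => q _.
rewrite muleCA [((a ^+ 2)%:E * _)%E]muleCA -muleDr ?ge0_adde_def// ?inE ?mule_ge0 ?lee_fin ?sqr_ge0//.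
by apply: lee_wpmul2l; rewrite ?lee_fin.
Qed.

Lemma kpow_1 n k : (kpow n (fun=> 1) k <= (M ^+ n)%:E)%E.
Proof.
elim: n k => [|n IH] k /=; first by rewrite expr0.
apply: (@le_trans _ _ (esum setT (fun q => (M ^+ n)%:E * (ker k q)%:E)%E)).
  by apply: le_esum => q _; rewrite muleC; apply: lee_wpmul2r; rewrite ?lee_fin.
rewrite esumZl ?exprn_ge0//; last by move=> q; rewrite lee_fin.
by rewrite exprSr EFinM; apply: lee_wpmul2l; rewrite ?lee_fin ?exprn_ge0 ?ker_row.
Qed.

(** Exchanging the two summations brings in the column sums of the kernel. *)
Lemma kpow_esum n (u : K -> \bar R) : (forall k, 0 <= u k)%E ->
  (esum setT (kpow n u) <= (M ^+ n)%:E * esum setT u)%E.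
Proof.
move=> u0; elim: n => [|n IH] /=; first by rewrite expr0 mul1e.
have k0 q : (0 <= kpow n u q)%E by exact: kpow_ge0.
rewrite esum_swap; last by move=> x y; rewrite mule_ge0 ?lee_fin.
apply: (@le_trans _ _ (esum setT (fun q => M%:E * kpow n u q)%E)).
  apply: le_esum => q _.
  rewrite (_ : (fun x => _) = fun x => (kpow n u q * (ker x q)%:E)%E); last first.
    by apply/funext => x; rewrite muleC.
  have [fq|] := boolP (kpow n u q \is a fin_num).
    rewrite -(fineK fq) esumZl ?fine_ge0//; last by move=> x; rewrite lee_fin.
    by rewrite muleC; apply: lee_wpmul2r; rewrite ?lee_fin ?fine_ge0 ?ker_col.
  (* If the value is infinite, so is the right-hand side, unless [M = 0]; in that case the column of
     the kernel vanishes and both sides are 0 by the convention [0 * +oo = 0]. *)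
  rewrite ge0_fin_numE// -leNgt leye_eq => /eqP ->.
  have [M00|M00] := eqVneq M 0; last by rewrite mulry gtr0_sg ?mul1e ?leey// lt_def M00.
  rewrite esum1 ?M00 ?mul0e// => x _.
  have : ((ker x q)%:E <= M%:E)%E.
    by apply: le_trans (ker_col q); apply: esum_ge; exists [set x]; rewrite ?fsbig_set1.
  rewrite M00 lee_fin => h; have -> : ker x q = 0 by apply/eqP; rewrite eq_le h ker_ge0.
  by rewrite mule0.
by rewrite esumZl// exprS [(M * M ^+ n)%:E]EFinM -muleA; apply: lee_wpmul2l; rewrite ?lee_fin.
Qed.

Variables (r f : K -> R[i]) (C : R).
Hypothesis C0 : 0 <= C.
Hypothesis rC : forall k, na (r k) <= C * rho k ^+ 2.
Hypothesis f2 : (esum setT (fun k => (na (f k) ^+ 2)%:E) < +oo)%E.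

Let nf k := na (f k).

Lemma Tabs_kpow n k : (Tabs r f beta n k <= (C ^+ n.+1 * rho k)%:E * kpow n (EFin \o nf) k)%E.
Proof.
elim: n k => [|n IH] k /=.
  rewrite -EFinM lee_fin expr1 ler_wpM2r ?na_ge0//; apply: le_trans (rC k) _.
  by rewrite expr2 mulrA ler_piMr ?rho_le1// mulr_ge0// ltW// rho_gt0.
have p0 q : (0 <= kpow n (EFin \o nf) q)%E by apply: kpow_ge0 => x; rewrite lee_fin /= na_ge0.
have rk0 := ltW (rho_gt0 k).
apply: (@le_trans _ _ ((C * rho k ^+ 2)%:E *
   esum setT (fun q => (C ^+ n.+1)%:E * ((beta (k - q) * rho q)%:E * kpow n (EFin \o nf) q)))%E).
  apply: lee_pmul; rewrite ?lee_fin ?na_ge0 ?rC//.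
    by apply: esum_ge0 => q _; rewrite mule_ge0 ?lee_fin// Tabs_ge0.
  apply: le_esum => q _.
  apply: (@le_trans _ _ ((beta (k - q))%:E * ((C ^+ n.+1 * rho q)%:E * kpow n (EFin \o nf) q))%E).
    by apply: lee_wpmul2l; rewrite ?lee_fin.
  by rewrite !muleA -!EFinM mulrCA mulrA.
rewrite esumZl ?exprn_ge0//; last by move=> q; rewrite mule_ge0// lee_fin mulr_ge0// ltW// rho_gt0.
rewrite (_ : esum setT (fun q => (ker k q)%:E * _)%E = ((rho k)%:E * esum setT
   (fun q => (beta (k - q) * rho q)%:E * kpow n (EFin \o nf) q))%E).
  rewrite !muleA -!EFinM.
  have -> : C * rho k ^+ 2 * C ^+ n.+1 = C ^+ n.+2 * rho k * rho k by rewrite [C ^+ n.+2]exprS; ring.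
  exact: lexx.
rewrite -esumZl//; last by move=> q; rewrite mule_ge0// lee_fin mulr_ge0// ltW// rho_gt0.
by apply: eq_esum => q _; rewrite muleA -EFinM mulrA.
Qed.

(** After [kpow_amgm] the squares of [a] are met by the row sums and the squares of [na (f k)] by
    the column sums. *)
Lemma Tabs_weight n (a : K -> R) : (forall k, 0 <= a k) ->
  (esum setT (fun k => (a k ^+ 2)%:E) < +oo)%E ->
  (esum setT (fun k => (a k)%:E * Tabs r f beta n k) < +oo)%E.
Proof.
move=> a0 a2.
have p0 k : (0 <= kpow n (EFin \o nf) k)%E by apply: kpow_ge0 => x; rewrite lee_fin /= na_ge0.
have p2 q : (0 <= kpow n (fun k => (nf k ^+ 2)%:E) q)%E by apply: kpow_ge0 => x; rewrite lee_fin sqr_ge0.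
apply: (@le_lt_trans _ _ (esum setT (fun k => (C ^+ n.+1)%:E *
   ((M ^+ n)%:E * (a k ^+ 2)%:E + kpow n (fun k => (nf k ^+ 2)%:E) k))%E)).
  apply: le_esum => k _.
  apply: (@le_trans _ _ ((a k)%:E * ((C ^+ n.+1)%:E * kpow n (EFin \o nf) k))%E).
    apply: lee_wpmul2l; first by rewrite lee_fin.
    apply: le_trans (Tabs_kpow n k) _; apply: lee_wpmul2r => //.
    by rewrite lee_fin ler_piMr ?rho_le1// exprn_ge0.
  rewrite muleCA; apply: lee_wpmul2l; first by rewrite lee_fin exprn_ge0.
  apply: le_trans (kpow_amgm n k (a0 k) (fun k => na_ge0 (f k))) _.
  apply: leeD => //; rewrite muleC; apply: lee_wpmul2r; first by rewrite lee_fin sqr_ge0.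
  exact: kpow_1.
have Mn0 : 0 <= M ^+ n by rewrite exprn_ge0.
rewrite esumZl ?exprn_ge0//; last by move=> k; rewrite adde_ge0// mule_ge0// lee_fin ?sqr_ge0.
rewrite lte_mul_pinfty ?lee_fin ?exprn_ge0//.
rewrite esumD; try by move=> k _; rewrite ?mule_ge0 ?lee_fin ?sqr_ge0.
apply: lte_add_pinfty.
  by rewrite esumZl ?lte_mul_pinfty ?lee_fin// => k; rewrite lee_fin sqr_ge0.
apply: le_lt_trans (kpow_esum n _) _; first by move=> k; rewrite lee_fin sqr_ge0.
by rewrite lte_mul_pinfty// lee_fin.
Qed.

(** The indicator of [k], taken as the square summable weight, isolates one term. *)
Lemma Tabs_fin n k : (Tabs r f beta n k < +oo)%E.
Proof.
have h := @Tabs_weight n (fun q => (q == k)%:R) (fun q => ler0n _ _).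
apply: le_lt_trans (h _).
  apply: (@le_trans _ _ (((k == k)%:R)%:E * Tabs r f beta n k)%E); first by rewrite eqxx mul1e.
  apply: esum_ge; exists [set k]; rewrite ?fsbig_set1//; exact: (conj (finite_set1 k)).
rewrite (esumID [set k]); last by move=> q _; rewrite lee_fin sqr_ge0.
rewrite setTI esum_set1 ?lee_fin ?sqr_ge0// esum1; last first.
  by move=> q [_ /eqP/negbTE] ->; rewrite expr0n.
by rewrite adde0 ltry.
Qed.

End Schur.

(** * Mixed differences *)

Section MixedDifferences.
Variables (R : realType) (d : nat).
Implicit Types (F : 'rV[R]_d -> R) (x : 'rV[R]_d) (i j : 'I_d).

Lemma setcE x j (u : R) i : setc x j u 0 i = if i == j then u else x 0 i.
Proof. by rewrite mxE -val_eqE. Qed.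

Lemma setc_id x j : setc x j (x 0 j) = x.
Proof. by apply/rowP => i; rewrite setcE; case: eqP => [->|]. Qed.

Lemma setcC x i j (u v : R) : i != j -> setc (setc x j u) i v = setc (setc x i v) j u.
Proof.
move=> ij; apply/rowP => l; rewrite !setcE; case: (eqVneq l i) => [->|//].
by rewrite (negbTE ij).
Qed.

Lemma is_derive_setc F x j (u : R) : derivable F (setc x j u) (delta_mx 0 j) ->
  is_derive u (1 : R) (fun v => F (setc x j v)) ('D_(delta_mx 0 j) F (setc x j u)).
Proof.
have e : (fun h : R => h^-1 *: (((fun v => F (setc x j v)) \o shift u) (h *: (1 : R)) - F (setc x j u))) =
   (fun h : R => h^-1 *: ((F \o shift (setc x j u)) (h *: delta_mx 0 j) - F (setc x j u))).
  apply/funext => h; congr (_ *: (_ - _)) => /=; congr F; apply/rowP => i.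
  rewrite [RHS]mxE [X in _ = X + _]mxE [delta_mx _ _ _ _]mxE eqxx !setcE /=.
  by case: eqP => _ /=; rewrite ?mulr0 ?add0r.
move=> dF; split; first by rewrite /derivable e.
by rewrite /derive e.
Qed.

Variable psi : 'I_d -> R -> R.

(** The replacement [psi j] is an arbitrary map and not a translation, because a shift modulo the
    box jumps where it wraps around. *)
Fixpoint mdiff (J : seq 'I_d) F x : R :=
  if J is j :: J' then mdiff J' F x - mdiff J' F (setc x j (psi j (x 0 j))) else F x.

(** The substitutions only touch coordinates in [J], so differentiation in another coordinate
    commutes with them. *)
Lemma is_derive_mdiff J F x j (u : R) : j \notin J ->
  (forall y, derivable F y (delta_mx 0 j)) ->
  is_derive u (1 : R) (fun v => mdiff J F (setc x j v)) (mdiff J ('D_(delta_mx 0 j) F) (setc x j u)).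
Proof.
move=> jJ dF; elim: J jJ x => [|i J IH] /= jJ x; first exact: is_derive_setc.
move: jJ; rewrite inE negb_or => /andP[ji jJ].
have e v : setc (setc x j v) i (psi i (setc x j v 0 i)) = setc (setc x i (psi i (x 0 i))) j v.
  by rewrite setcE [i == j]eq_sym (negbTE ji) setcC// eq_sym.
rewrite e; under eq_fun do rewrite e.
exact: is_deriveB (IH jJ x) (IH jJ _).
Qed.

Lemma mdiff_step J F x j (a b C : R) : j \notin J ->
  (forall y, derivable F y (delta_mx 0 j)) ->
  (forall v, `|mdiff J ('D_(delta_mx 0 j) F) (setc x j v)| <= C) ->
  `|mdiff J F (setc x j a) - mdiff J F (setc x j b)| <= C * `|a - b|.
Proof.
move=> jJ dF hC.
wlog ab : a b / a < b.
  move=> h; have [/h//|/h|->] := ltgtP a b; last by rewrite !subrr normr0 mulr0.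
  by rewrite distrC [`|b - a|]distrC.
have dm y := is_derive_mdiff x y jJ dF.
have [|c _ e] := MVT ab (fun y _ => dm y).
  by apply: derivable_within_continuous => y _; have [] := dm y.
by rewrite distrC e normrM [`|a - b|]distrC ler_wpM2r.
Qed.

End MixedDifferences.

(* [C] does not depend on [psi]: each coordinate is handled either by the mean
   value theorem or by the triangle inequality. *)
Lemma mdiff_bound (R : realType) (d : nat) (B : 'rV[R]_d -> R) (J : seq 'I_d) (vs : seq 'rV[R]_d) :
  uniq J -> (forall vs x v, derivable (dder vs B) x v) ->
  (forall vs, exists C, forall x, `|dder vs B x| <= C) ->
  exists2 C, 0 <= C & forall (psi phi : 'I_d -> R -> R),
    (forall j u, 0 <= phi j u /\ (`|u - psi j u| <= phi j u \/ 1 <= phi j u)) ->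
    forall x, `|mdiff psi J (dder vs B) x| <= C * \prod_(j <- J) phi j (x 0 j).
Proof.
move=> + dB bB; elim: J vs => [|j J IH] vs /=.
  have [C hC] := bB vs => _; exists `|C| => // psi phi _ x.
  by rewrite big_nil mulr1; apply: le_trans (hC x) (ler_norm _).
case/andP => jJ uJ.
(* [C2] belongs to the extra derivative in direction [j] and serves the mean value theorem; [2 * C1]
   covers the triangle inequality where [phi j] is at least 1. *)
have [C1 C10 h1] := IH vs uJ; have [C2 C20 h2] := IH (delta_mx 0 j :: vs) uJ.
exists (2 * C1 + C2); first by rewrite addr_ge0// mulr_ge0.
move=> psi phi hp x; rewrite big_cons.
have p0 : 0 <= \prod_(i <- J) phi i (x 0 i) by rewrite prodr_ge0// => i _; have [] := hp i (x 0 i).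
have e v : \prod_(i <- J) phi i (setc x j v 0 i) = \prod_(i <- J) phi i (x 0 i).
  rewrite big_seq [RHS]big_seq; apply: eq_bigr => i iJ; rewrite setcE.
  by case: eqP => // ij; move: jJ; rewrite -ij iJ.
have [f0 [hs|hs]] := hp j (x 0 j).
  have := @mdiff_step R d psi J (dder vs B) x j (x 0 j) (psi j (x 0 j)) (C2 * \prod_(i <- J) phi i (x 0 i)) jJ.
  rewrite setc_id => /(_ _ _) h; apply: (le_trans (h _ _)).
  - by move=> y; exact: dB.
  - by move=> v; have := h2 psi phi hp (setc x j v); rewrite e.
  - apply: (@le_trans _ _ (C2 * \prod_(i <- J) phi i (x 0 i) * phi j (x 0 j))).
      by rewrite ler_wpM2l// mulr_ge0.
    by rewrite -mulrA [X in C2 * X]mulrC ler_wpM2r ?mulr_ge0// lerDr mulr_ge0.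
apply: (le_trans (ler_normB _ _)).
have k1 := h1 psi phi hp x; have := h1 psi phi hp (setc x j (psi j (x 0 j))); rewrite e => k2.
have k3 : \prod_(i <- J) phi i (x 0 i) <= phi j (x 0 j) * \prod_(i <- J) phi i (x 0 i).
  by rewrite ler_peMl.
have := ler_wpM2l C10 k3; have := mulr_ge0 C20 (mulr_ge0 f0 p0); lra.
Qed.

(** * Set partitions and Poisson moments *)

Section SetPartitions.
Variables (R : comNzRingType) (I : finType).
Implicit Types (S T : {set I}) (g : {set I} -> R).

Definition block_sum g S : R := \sum_(A | finset.partition A S) \prod_(a in A) g a.

Lemma block_sum0 g : block_sum g finset.set0 = 1.
Proof.
rewrite /block_sum (big_pred1 finset.set0) ?big_set0// => A /=.
by rewrite partition_set0.
Qed.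

(** Sort the partitions by the block [T] of [l0]; removing that block is a bijection onto the
    partitions of the rest. *)
Lemma block_sum_rec g S l0 : l0 \in S ->
  block_sum g S = \sum_(T : {set I} | (l0 \in T) && (T \subset S)) g T * block_sum g (S :\: T).
Proof.
move=> lS; rewrite /block_sum (partition_big (fun A : {set {set I}} => finset.pblock A l0)
  (fun T : {set I} => (l0 \in T) && (T \subset S))) /=; last first.
  move=> A Ap; have lc : l0 \in finset.cover A by rewrite (finset.cover_partition Ap).
  rewrite finset.mem_pblock lc /= -(finset.cover_partition Ap).
  by apply: (finset.bigcup_sup (finset.pblock A l0)) => //; exact: finset.pblock_mem.
apply: eq_bigr => T /andP[lT TS]; rewrite mulr_sumr.
rewrite (reindex_onto (fun A : {set {set I}} => (T |: A)%SET) (fun A : {set {set I}} => (A :\ T)%SET)) /=; last first.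
  move=> A /andP[Ap /eqP <-]; rewrite finset.setD1K//.
  by apply: finset.pblock_mem; rewrite (finset.cover_partition Ap).
have T0 : T != finset.set0 by apply/set0Pn; exists l0.
apply: eq_big => [A|A].
  apply/idP/idP.
    move=> /andP[/andP[/and3P[/eqP cA tA nA] /eqP pT] /eqP eA].
    have TnA : T \notin A by rewrite -eA !inE eqxx.
    apply/and3P; split.
    - apply/eqP; rewrite -cA /finset.cover big_setU1//= finset.setDUl finset.setDv finset.set0U.
      apply/esym/finset.setDidPl; rewrite fintype.disjoint_sym.
      apply/finset.bigcup_disjointP => B BA; rewrite fintype.disjoint_sym.
      move/finset.trivIsetP : tA; apply; rewrite ?inE ?eqxx ?BA ?orbT//.
      by apply: contraNneq TnA => <-.
    - by apply: finset.trivIsetS tA; exact: finset.subsetUr.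
    - by apply: contra nA => h; rewrite inE h orbT.
  move=> Ap; have /and3P[/eqP cA tA nA] := Ap.
  have TnA : T \notin A.
    apply/negP => TA; have : l0 \in finset.cover A by apply/finset.bigcupP; exists T.
    by rewrite cA inE lT.
  have dj B : B \in A -> [disjoint T & B]%B.
    move=> BA; rewrite disjoint_subset; apply/fintype.subsetP => x xT; rewrite inE.
    apply/negP => xB; have : x \in finset.cover A by apply/finset.bigcupP; exists B.
    by rewrite cA inE xT.
  have [tA' TA'] : finset.trivIset (T |: A) /\ T \notin A by apply: finset.trivIsetU1.
  rewrite (finset.def_pblock tA' _ lT) ?inE ?eqxx//= finset.setU1K// eqxx !andbT.
  apply/and3P; split => //.
    rewrite /finset.cover big_setU1//= -/(finset.cover A) cA; apply/eqP/setP => x; rewrite !inE.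
    by case: (boolP (x \in T)) => //= /(fintype.subsetP TS).
  by rewrite !inE negb_or eq_sym T0.
move=> /andP[/andP[Ap _] /eqP eA].
by rewrite big_setU1//= -eA !inE eqxx.
Qed.

Lemma prodD_subsets (S : {set I}) (F G : I -> R) :
  \prod_(l in S) (F l + G l) =
  \sum_(T : {set I} | T \subset S) (\prod_(l in T) F l) * \prod_(l in S :\: T) G l.
Proof.
rewrite big_mkcond /=.
rewrite (eq_bigr (fun l => (if l \in S then F l else 0) + (if l \in S then G l else 1))); last first.
  by move=> l _; case: ifP; rewrite ?add0r.
rewrite bigA_distr (bigID (fun T : {set I} => T \subset S)) /= [X in _ + X]big1 ?addr0.
  apply: eq_bigr => T TS.
  rewrite [X in _ = X * _]big_mkcond [X in _ = _ * X]big_mkcond -big_split /=.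
  apply: eq_bigr => l _; rewrite finset.in_setD; case: (boolP (l \in T)) => lT /=.
    by rewrite (fintype.subsetP TS _ lT) mulr1.
  by case: ifP; rewrite mul1r.
move=> T /fintype.subsetPn[l lT lS].
by rewrite (bigD1 l)//= lT (negbTE lS) mul0r.
Qed.

End SetPartitions.

Section SubsetRecursion.
Variables (R : comNzRingType) (I : finType) (a : {set I} -> R) (s : nat -> {set I} -> R).
Hypothesis s0 : forall S, s 0 S = (S == finset.set0)%:R.
Hypothesis sS : forall m S, s m.+1 S = \sum_(T : {set I} | T \subset S) a T * s m (S :\: T).

(* [s m S] is the [m]-fold subset convolution of [a]; distinguishing the factor
   whose block contains [l0] gives the factor [m]. *)
Lemma subset_rec_block l0 m (S : {set I}) : l0 \in S ->
  s m S = m%:R * \sum_(T : {set I} | (l0 \in T) && (T \subset S)) a T * s m.-1 (S :\: T).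
Proof.
elim: m S => [|m IH] S lS.
  by rewrite s0 mul0r; case: eqP lS => // ->; rewrite inE.
(* Either the first factor misses [l0], which is left to the induction hypothesis and gives the
   multiple [m], or it contains [l0], which is the one additional term. *)
rewrite sS (bigID (fun T : {set I} => l0 \in T)) /=.
rewrite -[in RHS]natr1 mulrDl mul1r addrC; congr (_ + _); last first.
  by apply: eq_bigl => T; rewrite andbC.
rewrite (eq_bigr (fun T : {set I} => \sum_(U : {set I} | (l0 \in U) && (U \subset S :\: T))
   m%:R * (a U * (a T * s m.-1 (S :\: U :\: T))))); last first.
  move=> T /andP[TS lT]; rewrite IH; last by rewrite finset.in_setD lT.
  rewrite mulrCA mulr_sumr mulr_sumr; apply: eq_bigr => U _.
  by rewrite !finset.setDDl finset.setUC; congr (_ * _); rewrite mulrCA.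
rewrite (exchange_big_dep (fun U : {set I} => (l0 \in U) && (U \subset S))) /=; last first.
  move=> T U /andP[TS lT] /andP[-> /fintype.subset_trans -> //].
  exact: finset.subsetDl.
rewrite mulr_sumr; apply: eq_bigr => U /andP[lU US].
rewrite -mulr_sumr -mulr_sumr.
(* For [m = 0] the index [m.-1] is not a true predecessor, but both sides carry the factor 0. *)
case: m IH => [|m] IH; first by rewrite !mul0r.
congr (_ * (_ * _)); rewrite sS; apply: eq_bigl => T.
rewrite lU /= !finset.subsetD US (disjoint_sym (mem U)).
case: (boolP (T \subset S)) => //= _; rewrite andbC.
case: (boolP [disjoint T & U]%B) => //= dTU.
by apply/negP => lT; have := disjointFr dTU lT; rewrite lU.
Qed.

End SubsetRecursion.

Section PoissonMoments.
Context d (Y : measurableType d) (R : realType).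
Variable P : {finite_measure set Y -> \bar R}.
Variables (I : finType) (w : I -> Y -> R[i]) (lam : R).
Hypothesis P1 : P setT = 1%E.
Hypothesis lam0 : 0 < lam.
Hypothesis wi : forall T : {set I}, cintegrable P (fun y => \prod_(l in T) w l y).

Definition poisson_w m : R := expR (- lam) * lam ^+ m / m`!%:R.
Definition pmom (T : {set I}) : R[i] := cintegral P (fun y => \prod_(l in T) w l y).
Definition psig m (S : {set I}) : R[i] :=
  cintegral (pw P m) (fun t => \prod_(l in S) \sum_(y <- t) w l y).

Lemma poisson_w_ge0 m : 0 <= poisson_w m.
Proof. by rewrite /poisson_w divr_ge0// mulr_ge0 ?expR_ge0// exprn_ge0// ltW. Qed.

Lemma poisson_wS m : poisson_w m.+1 * m.+1%:R = lam * poisson_w m.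
Proof.
rewrite /poisson_w exprS factS natrM invfM.
have : m.+1%:R != 0 :> R by rewrite pnatr_eq0.
have : m`!%:R != 0 :> R by rewrite pnatr_eq0 -lt0n fact_gt0.
move=> h1 h2; field; exact/andP.
Qed.

Lemma psig_tcons m (S : {set I}) (t : m.+1.-tuple Y) :
  \prod_(l in S) \sum_(y <- t) w l y =
  \sum_(T : {set I} | T \subset S) (\prod_(l in T) w l (thead t)) *
    \prod_(l in S :\: T) \sum_(y <- tbehead t) w l y.
Proof.
rewrite -prodD_subsets; apply: eq_bigr => l _.
by rewrite {1}(tcons_eta t) /= big_cons.
Qed.

(** When the sums are expanded at the first point, [T] collects the factors that select it, and
    independence splits the integral. Integrability is carried along in the same induction. *)
Lemma psig_int m (S : {set I}) :
  cintegrable (pw P m) (fun t => \prod_(l in S) \sum_(y <- t) w l y) /\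
  psig m S = if m is m'.+1 then \sum_(T : {set I} | T \subset S) pmom T * psig m' (S :\: T)
             else (S == finset.set0)%:R.
Proof.
elim: m S => [|m IH] S.
  have e : (fun t : 0.-tuple Y => \prod_(l in S) \sum_(y <- t) w l y) = fun=> (S == finset.set0)%:R.
    apply/funext => t; rewrite tuple0 /=; have [->|/set0Pn[l lS]] := eqVneq S finset.set0.
      by rewrite finset.big_set0.
    by rewrite (bigD1 l)//= big_nil mul0r.
  have ci : cintegrable (pw P 0) (fun=> (S == finset.set0)%:R).
    apply: (finite_cintegrable (C := na (S == finset.set0)%:R)) => //.
    by rewrite -ge0_fin_numE//; exact: fin_num_measure.
  rewrite /psig e; split => //.
  rewrite /cintegral /Rintegral !integral_pw0 //=.
  by case: (S == _).
have ti (T : {set I}) := cintegral_pwSM (wi T) (IH (S :\: T)).1.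
rewrite /psig (_ : (fun t : m.+1.-tuple Y => _) = fun t => \sum_(T : {set I} | T \subset S)
    (\prod_(l in T) w l (thead t)) * \prod_(l in S :\: T) \sum_(y <- tbehead t) w l y); last first.
  by apply/funext => t; exact: psig_tcons.
split; first by apply: cintegrable_sum => T _; exact: (ti T).1.
rewrite cintegral_sum; last by move=> T _; exact: (ti T).1.
by apply: eq_bigr => T _; rewrite (ti T).2.
Qed.

Lemma pmom0 : pmom finset.set0 = 1.
Proof.
rewrite /pmom /cintegral /Rintegral.
under eq_integral do rewrite finset.big_set0.
under [X in _ +i* fine X]eq_integral do rewrite finset.big_set0.
by rewrite !integral_cst//= P1 mule1 mul0e.
Qed.

Lemma psig0 m : psig m finset.set0 = 1.
Proof.
elim: m => [|m IH]; rewrite (psig_int _ _).2 ?eqxx//.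
rewrite (big_pred1 finset.set0) => [|T]; last by rewrite finset.subset0.
by rewrite pmom0 mul1r finset.set0D IH.
Qed.

Lemma poisson_w_cvg : (fun N => \sum_(0 <= m < N) poisson_w m) @ \oo --> (1 : R).
Proof.
have h := is_cvg_series_exp_coeff lam.
have -> : (fun N => \sum_(0 <= m < N) poisson_w m) =
  (fun N => expR (- lam) * series (exp_coeff lam) N).
  apply/funext => N; rewrite /series /= mulr_sumr; apply: eq_bigr => m _.
  by rewrite /poisson_w /exp_coeff /= mulrA.
rewrite -(expRxMexpNx_1 lam) mulrC; apply: cvgM; first exact: cvg_cst.
exact: h.
Qed.

Lemma poisson_moments (S : {set I}) :
  ccvg (fun N => \sum_(0 <= m < N) (poisson_w m)%:C * psig m S)
       (block_sum (fun T => lam%:C * pmom T) S).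
Proof.
have [n] := ubnP #|S|; elim: n S => // n IH S Sn.
have [->|/set0Pn[l0 lS]] := eqVneq S finset.set0.
  rewrite block_sum0; split.
    have -> : (fun N => complex.Re (\sum_(0 <= m < N) (poisson_w m)%:C * psig m finset.set0)) =
       (fun N => \sum_(0 <= m < N) poisson_w m).
      by apply/funext => N; rewrite Re_sum; apply: eq_bigr => m _; rewrite psig0 mulr1.
    exact: poisson_w_cvg.
  have -> : (fun N => complex.Im (\sum_(0 <= m < N) (poisson_w m)%:C * psig m finset.set0)) = fun=> 0.
    by apply/funext => N; rewrite Im_sum big1// => m _; rewrite psig0 mulr1.
  exact: cvg_cst.
have s0 S' : psig 0 S' = (S' == finset.set0)%:R := (psig_int 0 S').2.
have sS m S' : psig m.+1 S' = _ := (psig_int m.+1 S').2.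
rewrite (block_sum_rec _ lS).
(* The term [m = 0] vanishes because [S] is nonempty; the shift of the range by one pairs [m.+1]
   points on the left with the weight at [m] on the right. *)
have e N : \sum_(0 <= m < N.+1) (poisson_w m)%:C * psig m S =
   \sum_(T : {set I} | (l0 \in T) && (T \subset S)) lam%:C * pmom T *
     \sum_(0 <= m < N) (poisson_w m)%:C * psig m (S :\: T).
  rewrite big_nat_recl// s0 (_ : _ == _ = false) ?mulr0 ?add0r; last first.
    by apply/negbTE/set0Pn; exists l0.
  under [RHS]eq_bigr do rewrite mulr_sumr.
  rewrite [RHS]exchange_big /=; apply: eq_bigr => m _.
  rewrite (subset_rec_block s0 sS _ lS) /= mulrA.
  rewrite (_ : (poisson_w m.+1)%:C * m.+1%:R = (lam * poisson_w m)%:C); last first.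
    by rewrite -poisson_wS -(rmorph_nat (real_complex R)) -rmorphM.
  rewrite mulr_sumr; apply: eq_bigr => T _; rewrite rmorphM /=; ring.
suff h : ccvg (fun N => \sum_(0 <= m < N.+1) (poisson_w m)%:C * psig m S)
    (\sum_(T : {set I} | (l0 \in T) && (T \subset S)) lam%:C * pmom T *
      block_sum (fun T => lam%:C * pmom T) (S :\: T)).
  by case: h => h1 h2; split; rewrite -cvg_shiftS.
under eq_fun do rewrite e.
apply: ccvg_sum => T /andP[lT TS].
apply: ccvgM; first exact: ccvg_cst.
apply: IH; rewrite ltnS in Sn; apply: (leq_trans _ Sn); apply: proper_card.
rewrite properE finset.subsetDl /=; apply/fintype.subsetPn; exists l0 => //.
by rewrite finset.in_setD lT.
Qed.

End PoissonMoments.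

Lemma enum_ext_nat (V : Type) (z : V) (g : nat -> V) n : enum_ext z g n = g n.
Proof. exact: (@enum_ext_pickle nat V z g n). Qed.

(** For [n] copies of the weight [h] the moment formula is itself a convergence statement, with a
    finite block sum as its limit. *)
Lemma poisson_power_finite d (Y : measurableType d) (R : realType)
    (P : {finite_measure set Y -> \bar R}) (lam : R) (h : Y -> R) (n : nat) :
  P setT = 1%E -> 0 < lam -> (forall y, 0 <= h y) ->
  (forall k, P.-integrable setT (fun y => (h y ^+ k)%:E)) ->
  (forall m, (pw P m).-integrable setT (fun t => ((\sum_(y <- t) h y) ^+ n)%:E)) /\
  (esum setT (fun m => (poisson_w lam m)%:E *
    \int[pw P m]_t ((\sum_(y <- t) h y) ^+ n)%:E) < +oo)%E.
Proof.
move=> P1 lam0 h0 hi.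
pose w (l : 'I_n) y := (h y)%:C.
have wi (T : {set 'I_n}) : cintegrable P (fun y => \prod_(l in T) w l y).
  rewrite (_ : (fun y => _) = fun y => (h y ^+ #|T|)%:C); last first.
    by apply/funext => y; rewrite prodr_const -rmorphXn.
  apply: cintegrable_of => /=; first exact: hi.
  exact: integrable0.
have e m (t : m.-tuple Y) : \prod_(l in [set: 'I_n]%SET) \sum_(y <- t) w l y =
    ((\sum_(y <- t) h y) ^+ n)%:C.
  by rewrite /w prodr_const finset.cardsT card_ord -rmorph_sum -rmorphXn.
have pc := poisson_moments lam P1 wi [set: 'I_n]%SET.
have pin m : (pw P m).-integrable setT (fun t => ((\sum_(y <- t) h y) ^+ n)%:E).
  have [+ _] := cintegrableP (psig_int wi m [set: 'I_n]%SET).1.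
  by apply: eq_integrable => // t _; rewrite e.
split=> //.
have s0 m (t : m.-tuple Y) : 0 <= (\sum_(y <- t) h y) ^+ n.
  by rewrite exprn_ge0// sumr_ge0.
have i0 m : (0 <= \int[pw P m]_t ((\sum_(y <- t) h y) ^+ n)%:E)%E.
  by apply: integral_ge0 => t _; rewrite lee_fin.
rewrite esum_enum; last by move=> m; rewrite mule_ge0// lee_fin poisson_w_ge0.
rewrite (eq_eseriesr (g := fun m => (poisson_w lam m * complex.Re (psig P w m [set: 'I_n]%SET))%:E)); last first.
  move=> m _; rewrite enum_ext_nat [RHS]EFinM; congr (_ * _)%E.
  rewrite /psig /cintegral /= /Rintegral fineK.
    by apply: eq_integral => t _; rewrite e.
  rewrite (eq_integral (fun t : m.-tuple Y => ((\sum_(y <- t) h y) ^+ n)%:E)); last by move=> t _; rewrite e.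
  exact: integrable_fin_num.
have [pc1 _] := pc.
have : (fun N => \sum_(0 <= m < N) (poisson_w lam m * complex.Re (psig P w m [set: 'I_n]%SET))%:E)%E @ \oo -->
   (complex.Re (block_sum (fun T => lam%:C * pmom P w T) [set: 'I_n]%SET))%:E.
  under eq_fun do rewrite sumEFin.
  apply: cvg_EFin; first exact: nearW.
  apply: cvg_trans pc1; apply: near_eq_cvg; apply: nearW => N /=.
  by rewrite Re_sum; apply: eq_bigr => m _; rewrite ReM /= mul0r subr0.
by move/cvg_lim => ->//; rewrite ltry.
Qed.

(** * Expectation over Poisson configurations *)

Section PoissonExpectation.
Context d (Y : measurableType d) (R : realType).
Variables (P : {finite_measure set Y -> \bar R}) (lam : R).
Hypothesis lam0 : 0 < lam.

Definition poisson_E (F : seq Y -> R[i]) : R[i] :=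
  csum (fun m => (poisson_w lam m)%:C * cintegral (pw P m) (fun t => F t)).

Definition poisson_dom (G : seq Y -> R) : Prop :=
  [/\ forall t, 0 <= G t,
      forall m, (pw P m).-integrable setT (fun t : m.-tuple Y => (G t)%:E) &
      (esum setT (fun m => (poisson_w lam m)%:E * \int[pw P m]_t (G t)%:E) < +oo)%E].

Let w0 m : 0 <= poisson_w lam m := poisson_w_ge0 lam0 m.

Let intG0 G m : poisson_dom G -> (0 <= \int[pw P m]_t (G t)%:E)%E.
Proof. by case=> G0 _ _; apply: integral_ge0 => t _; rewrite lee_fin. Qed.

(** Fubini between the sum over [K], the sum over the number of points and the integral over the
    points; the dominating function factorizes into a summable [A] and an integrable [G]. *)
Lemma poisson_E_csum (K : countType) (F : K -> seq Y -> R[i]) (A : K -> R) (G : seq Y -> R) :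
  poisson_dom G -> (forall m k, cmf (fun t : m.-tuple Y => F k t)) ->
  (forall k, 0 <= A k) -> (esum setT (fun k => (A k)%:E) < +oo)%E ->
  (forall k t, na (F k t) <= A k * G t) ->
  [/\ forall t, csummable (F ^~ t),
      forall m, cmf (fun t : m.-tuple Y => csum (F ^~ t)),
      forall t, na (csum (F ^~ t)) <= fine (esum setT (fun k => (A k)%:E)) * G t,
      csummable (fun k => poisson_E (F k)) &
      poisson_E (fun t => csum (F ^~ t)) = csum (fun k => poisson_E (F k))].
Proof.
move=> dG Fm A0 Afin FA; have [G0 Gi Gs] := dG.
have A0' k : (0 <= (A k)%:E)%E by rewrite lee_fin.
have AE : esum setT (fun k => (A k)%:E) = (fine (esum setT (fun k => (A k)%:E)))%:E.
  by rewrite fineK// ge0_fin_numE// esum_ge0.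
have bnd t : (esum setT (fun k => (na (F k t))%:E) <=
    (fine (esum setT (fun k => (A k)%:E)) * G t)%:E)%E.
  rewrite EFinM -AE muleC -esumZl//; apply: le_esum => k _.
  by rewrite -EFinM lee_fin mulrC FA.
have Fs t : csummable (F ^~ t) by apply: le_lt_trans (bnd t) _; rewrite ltry.
have ib m k : (\int[pw P m]_t (na (F k t))%:E <= (A k)%:E * \int[pw P m]_t (G t)%:E)%E.
  rewrite -ge0_integralZl//; last 2 first.
  - by have /integrableP[] := Gi m.
  - by move=> t _; rewrite lee_fin.
  apply: ge0_le_integral => //.
  - by move=> t _; rewrite lee_fin na_ge0.
  - by apply/measurable_EFinP; exact: measurable_na.
  - by apply: measurable_funeM; have /integrableP[] := Gi m.
  - by move=> t _; rewrite -EFinM lee_fin.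
have Gfin m : (\int[pw P m]_t (G t)%:E \is a fin_num)%E by exact: integrable_fin_num.
have esfin m : (esum setT (fun k => \int[pw P m]_t (na (F k t))%:E) <=
   \int[pw P m]_t (G t)%:E * (esum setT (fun k => (A k)%:E)))%E.
  rewrite -(fineK (Gfin m)) -esumZl//; last by rewrite fine_ge0// intG0.
  by apply: le_esum => k _; rewrite fineK// muleC.
have lt m : (\int[pw P m]_t (G t)%:E * (esum setT (fun k => (A k)%:E)) < +oo)%E.
  by rewrite AE -(fineK (Gfin m)) -EFinM ltry.
have ci m := csum_integral (mu := pw P m) (F := fun k (t : m.-tuple Y) => F k t) (Fm m)
   (fun t => Fs t) (le_lt_trans (esfin m) (lt m)).
pose g (x : nat * K) := (poisson_w lam x.1)%:C * cintegral (pw P x.1) (fun t => F x.2 t).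
have Fint m k : cintegrable (pw P m) (fun t => F k t).
  split; first exact: Fm.
  apply: le_lt_trans (ib m k) _; by rewrite -(fineK (Gfin m)) -EFinM ltry.
have gs : csummable g.
  apply: (@le_csummable _ _ _ (fun x => (poisson_w lam x.1)%:E * ((A x.2)%:E * \int[pw P x.1]_t (G t)%:E))%E).
    move=> [m k]; rewrite /g /=.
    apply: (@le_trans _ _ ((poisson_w lam m)%:E * (na (cintegral (pw P m) (fun t => F k t)))%:E)%E).
      by rewrite -EFinM lee_fin (le_trans (naM _ _))// na_real ger0_norm.
    apply: lee_wpmul2l; first by rewrite lee_fin.
    exact: le_trans (na_cintegral (Fint m k)) (ib m k).
  rewrite esum_pair; last by move=> [m k]; rewrite !mule_ge0 ?lee_fin// intG0.
  rewrite (_ : esum _ _ = ((fine (esum setT (fun k => (A k)%:E)))%:E *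
     esum setT (fun m => (poisson_w lam m)%:E * \int[pw P m]_t (G t)%:E))%E).
    rewrite lte_mul_pinfty//; first by rewrite lee_fin fine_ge0// esum_ge0.
  rewrite -esumZl//; last 2 first.
  - by rewrite fine_ge0// esum_ge0.
  - by move=> m; rewrite mule_ge0 ?lee_fin// intG0.
  apply: eq_esum => m _.
  rewrite -AE [RHS]muleC -muleA -(fineK (Gfin m)) -esumZl ?fine_ge0 ?intG0// -esumZl//.
    by apply: eq_esum => k _; rewrite [((A k)%:E * _)%E]muleC.
  by move=> k; rewrite mule_ge0 ?lee_fin ?fine_ge0 ?intG0.
have gs' : csummable (g \o (fun x : K * nat => (x.2, x.1))).
  apply: (csummable_reindex _ _).1 gs.
  by exists (fun x : nat * K => (x.2, x.1)) => -[].
split => //.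
- by move=> m; have [[]] := ci m.
- move=> t; rewrite -lee_fin; exact: le_trans (na_csum (Fs t)) (bnd t).
- exact: (csummable_outer gs').
rewrite /poisson_E.
rewrite (_ : (fun m => _) = fun m => csum (fun k => g (m, k))); last first.
  apply/funext => m; have [_ cs ->] := ci m.
  by rewrite -csumZ.
rewrite -csum_pair//.
rewrite (@csum_reindex _ _ _ (fun x : K * nat => (x.2, x.1))); last first.
  by exists (fun x : nat * K => (x.2, x.1)) => -[].
by rewrite csum_pair.
Qed.

Lemma poisson_E_Z (z : R[i]) (F : seq Y -> R[i]) (G : seq Y -> R) : poisson_dom G ->
  (forall m, cmf (fun t : m.-tuple Y => F t)) -> (forall t, na (F t) <= G t) ->
  poisson_E (fun t => z * F t) = z * poisson_E F.
Proof.
move=> [G0 Gi Gs] Fm FG; rewrite /poisson_E.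
have Fint m : cintegrable (pw P m) (fun t => F t) by exact: le_cintegrable (Gi m) _.
rewrite -csumZ; last first.
  apply: (le_csummable _ Gs) => m; apply: (@le_trans _ _
    ((poisson_w lam m)%:E * (na (cintegral (pw P m) (fun t => F t)))%:E)%E).
    by rewrite -EFinM lee_fin (le_trans (naM _ _))// na_real ger0_norm.
  apply: lee_wpmul2l; first by rewrite lee_fin.
  apply: le_trans (na_cintegral (Fint m)) _; apply: ge0_le_integral => //.
  - by move=> t _; rewrite lee_fin na_ge0.
  - by apply/measurable_EFinP; exact: measurable_na.
  - by have /integrableP[] := Gi m.
  - by move=> t _; rewrite lee_fin.
by congr csum; apply/funext => m; rewrite cintegralZ// mulrCA.
Qed.

End PoissonExpectation.

(** * The torus (R / LZ)^d *)

Section Torus.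
Context (R : realType) (d : nat) (L : R) (hL : 0 < L).

Local Notation X := (d.-tuple R).

Definition toV n (t : n.-tuple R) : 'rV[R]_n := \row_j tnth t j.

Lemma measurable_rV_comp d' (T : measurableType d') n d'' (T' : measurableType d'')
    (g : 'rV[R]_n -> T') (phi : T -> 'rV[R]_n) :
  measurable_fun setT (fun t : n.-tuple R => g (toV t)) ->
  (forall j, measurable_fun setT (fun x => phi x 0 j)) ->
  measurable_fun setT (fun x => g (phi x)).
Proof.
move=> mg mphi.
have -> : (fun x => g (phi x)) =
    (fun t : n.-tuple R => g (toV t)) \o (fun x => [tuple phi x 0 j | j < n]).
  apply/funext => x /=; congr g; apply/rowP => j.
  by rewrite mxE tnth_mktuple.
apply: measurableT_comp => //; apply/measurable_fun_tnthP => j.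
rewrite (_ : _ \o _ = fun x => phi x 0 j); first exact: mphi.
by apply/funext => x /=; rewrite tnth_mktuple.
Qed.

Definition tmu : {finite_measure set X -> \bar R} := pw (mu1 hL) d.

(** The point at which [iint_aux k] ends up evaluating its integrand. *)
Definition merge k (t : k.-tuple R) (x : 'rV[R]_d) : 'rV[R]_d :=
  \row_j (if (j < k)%N then nth 0 t j else x 0 j).

Lemma merge_trcons k (s : k.-tuple R) u x :
  merge (trcons s u) x = merge s (setc x k u).
Proof.
apply/rowP => j; rewrite !mxE /= nth_rcons size_tuple ltnS leq_eqVlt.
by case: ltngtP.
Qed.

Lemma measurable_merge k (x : 'rV[R]_d) j :
  measurable_fun setT (fun t : k.-tuple R => merge t x 0 j).
Proof.
have [jk|jk] := ltnP j k.
  rewrite (_ : (fun t => _) = (@tnth _ R ^~ (Ordinal jk))); first exact: measurable_tnth.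
  by apply/funext => t; rewrite mxE jk (tnth_nth 0).
rewrite (_ : (fun t => _) = fun=> x 0 j)//.
by apply/funext => t; rewrite mxE ltnNge jk.
Qed.

(** Bridge from iterated Lebesgue integrals to a product measure, where Fubini and translation
    invariance are at hand. Since the integrand vanishes off the box, each line may be cut down to
    one period. *)
Lemma iint_auxE (f : 'rV[R]_d -> \bar R) k (x : 'rV[R]_d) : (k <= d)%N ->
  measurable_fun setT (fun t : X => f (toV t)) ->
  (forall x, 0 <= f x)%E -> (forall x, ~~ boxb L x -> f x = 0%E) ->
  iint_aux k f x = (\int[pw (mu1 hL) k]_t f (merge t x))%E.
Proof.
move=> + mf f0 fbox; elim: k x => [|k IH] x kd.
  rewrite integral_pw0; last first.
    by apply: measurable_rV_comp => // j; exact: measurable_merge.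
  by congr f; apply/rowP => j; rewrite mxE.
rewrite integral_pw_trcons//; last first.
  by apply: measurable_rV_comp => // j; exact: measurable_merge.
under [RHS]eq_integral do under eq_integral do rewrite merge_trcons.
have mj : measurable_fun setT (fun ut : R * k.-tuple R => f (merge ut.2 (setc x k ut.1))).
  apply: measurable_rV_comp => // j.
  under eq_fun do rewrite -merge_trcons.
  apply: (@measurableT_comp _ _ _ _ _ _ (fun t : k.+1.-tuple R => merge t x 0 j)
     _ (fun ut : R * k.-tuple R => trcons ut.2 ut.1)).
    exact: measurable_merge.
  exact: measurable_trcons.
rewrite (@integral_mu1 _ _ hL)//; last 2 first.
- exact: (@measurable_fun_fubini_tonelli_F _ _ _ _ _ (pw (mu1 hL) k)
    (fun ut : R * k.-tuple R => f (merge ut.2 (setc x k ut.1)))).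
- by move=> u; apply: integral_ge0.
rewrite /= [RHS]integral_mkcond; apply: eq_integral => u _.
rewrite IH; last exact: ltnW.
(* When coordinate [k] leaves its interval, the point is off the box and the inner integral is
   zero. *)
rewrite patchE; case: ifPn => // ub.
apply: integral0_eq => t _; apply: fbox.
apply/negP => /forallP/(_ (Ordinal kd)); rewrite !mxE /= ltnn eqxx.
by move=> h; move/negP : ub; apply; rewrite box1P.
Qed.

Lemma inboxE (t : X) : boxb L (toV t) = [forall j, tnth t j \in box1 L].
Proof.
by apply: eq_forallb => j; rewrite box1P mxE.
Qed.

Definition twrap (t : X) : X := tmap (fun=> wrap1 L) t.

Lemma boxb_twrap t : boxb L (toV (twrap t)).
Proof.
by rewrite inboxE; apply/forallP => j; rewrite tnth_mktuple; exact: wrap1_in.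
Qed.

Lemma twrap_box t : boxb L (toV t) -> twrap t = t.
Proof.
rewrite inboxE => /forallP h; apply: eq_from_tnth => j.
by rewrite tnth_mktuple wrap1_box.
Qed.

Lemma measurable_twrap : measurable_fun setT twrap.
Proof. by apply: measurable_tmap => i; exact: measurable_wrap1. Qed.

Lemma per_toV (T : Type) (h : 'rV[R]_d -> T) t : per L h (toV t) = h (toV (twrap t)).
Proof.
by congr h; apply/rowP => j; rewrite !mxE tnth_mktuple.
Qed.

Lemma per_box (T : Type) (h : 'rV[R]_d -> T) x : boxb L x -> per L h x = h x.
Proof.
move=> xb; have -> : x = toV [tuple x 0 j | j < d].
  by apply/rowP => j; rewrite mxE tnth_mktuple.
rewrite per_toV twrap_box// (_ : toV _ = x)//.
by apply/rowP => j; rewrite mxE tnth_mktuple.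
Qed.

(** Translation on the torus, acting on representatives in the box. *)
Definition tshift (y t : X) : X := tmap (fun i (u : R) => wrap1 L (u + nth 0 y i)) t.

Lemma tnth_tshift y t j : tnth (tshift y t) j = wrap1 L (tnth t j + tnth y j).
Proof. by rewrite tnth_mktuple (tnth_nth 0 y). Qed.

Lemma boxb_tshift y t : boxb L (toV (tshift y t)).
Proof.
by rewrite inboxE; apply/forallP => j; rewrite tnth_mktuple; exact: wrap1_in.
Qed.

Lemma measurable_tshift y : measurable_fun setT (tshift y).
Proof. by apply: measurable_tmap => i; exact: measurable_shift1. Qed.

Lemma integral_tshift y (f : X -> \bar R) : measurable_fun setT f ->
  (forall t, 0 <= f t)%E -> (\int[tmu]_t f (tshift y t) = \int[tmu]_t f t)%E.
Proof.
move=> mf f0; apply: (@integral_pw_tmap _ _ _ (mu1 hL)) => //.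
  by move=> i; exact: measurable_shift1.
by move=> i h mh h0; exact: integral_mu1_shift.
Qed.

Lemma integral_twrap (f : X -> \bar R) : measurable_fun setT f ->
  (forall t, 0 <= f t)%E -> (\int[tmu]_t f (twrap t) = \int[tmu]_t f t)%E.
Proof.
move=> mf f0; apply: (@integral_pw_tmap _ _ _ (mu1 hL)) => //.
  by move=> i; exact: measurable_wrap1.
move=> i h mh h0; rewrite -[RHS](@integral_mu1_shift _ _ hL 0)//.
by under [RHS]eq_integral do rewrite addr0.
Qed.

(** The reduction [twrap] preserves integrals against [tmu] and lands in the box, so only the values
    there count. *)
Lemma eq_box_integral (f g : X -> \bar R) : measurable_fun setT f ->
  measurable_fun setT g -> (forall t, 0 <= f t)%E -> (forall t, 0 <= g t)%E ->
  (forall t, boxb L (toV t) -> f t = g t) ->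
  (\int[tmu]_t f t = \int[tmu]_t g t)%E.
Proof.
move=> mf mg f0 g0 fg; rewrite -integral_twrap// -[RHS]integral_twrap//.
by apply: eq_integral => t _; apply: fg; exact: boxb_twrap.
Qed.

Lemma ae_inbox : {ae tmu, forall t, boxb L (toV t)}.
Proof.
have key (j : 'I_d) : {ae tmu, forall t, tnth t j \in box1 L}.
  exists [set t | ~ (tnth t j \in box1 L)]; split => //.
    rewrite (_ : [set t | _] = ~` ((@tnth _ R ^~ j) @^-1` box1 L)); last first.
      by apply/seteqP; split => t /=; rewrite inE.
    apply: measurableC; rewrite -[X in measurable X]setTI.
    exact: (@measurable_tnth _ R d j measurableT (box1 L) (measurable_box1 L)).
  set A := [set t | _].
  have mA : measurable A.
    rewrite (_ : A = ~` ((@tnth _ R ^~ j) @^-1` box1 L)); last first.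
      by apply/seteqP; split => t /=; rewrite /A /= inE.
    apply: measurableC; rewrite -[X in measurable X]setTI.
    exact: (@measurable_tnth _ R d j measurableT (box1 L) (measurable_box1 L)).
  have -> : tmu A = (\int[tmu]_t (\1_A t)%:E)%E by rewrite integral_indic// setIT.
  rewrite -integral_twrap//; last first.
    by apply/measurable_EFinP; exact: measurable_indic.
  apply: integral0_eq => t _; rewrite indicE memNset//= => h; apply: h.
  by rewrite tnth_mktuple; exact: wrap1_in.
apply: filterS (filter_forall _ key) => t h.
by rewrite inboxE; apply/forallP.
Qed.

Lemma eq_box_cintegral (f g : X -> R[i]) : cmf f -> cmf g ->
  (forall t, boxb L (toV t) -> f t = g t) -> cintegral tmu f = cintegral tmu g.
Proof.
move=> mf mg fg; apply: ae_eq_cintegral => //.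
by apply: filterS ae_inbox => t; exact: fg.
Qed.

Lemma tmu_setT : tmu setT = (L ^+ d)%:E.
Proof. by rewrite /tmu pw_setT mu1_setT EFin_expe. Qed.

Lemma nnint_box (f g : 'rV[R]_d -> \bar R) :
  measurable_fun setT (fun t : X => f (toV t)) ->
  measurable_fun setT (fun t : X => g (toV t)) ->
  (forall x, 0 <= f x)%E -> (forall x, 0 <= g x)%E ->
  (forall x, ~~ boxb L x -> f x = 0%E) ->
  (forall x, boxb L x -> f x = g x) ->
  (nnint f = \int[tmu]_t g (toV t))%E.
Proof.
move=> mf mg f0 g0 fbox fg.
rewrite /nnint iint_auxE//.
rewrite (_ : (\int[_]_t _ = \int[tmu]_t f (toV t))%E).
  by apply: eq_box_integral => // t; exact: fg.
apply: eq_integral => t _; congr f; apply/rowP => j.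
by rewrite !mxE ltn_ord (tnth_nth 0).
Qed.

Lemma cmeasE (h : 'rV[R]_d -> R[i]) : cmeas h = cmf (fun t : X => h (toV t)).
Proof. by []. Qed.

Lemma measurable_if_box (T' : measurableType default_measure_display)
    (f g : X -> T') : measurable_fun setT f -> measurable_fun setT g ->
  measurable_fun setT (fun t => if boxb L (toV t) then f t else g t).
Proof.
move=> mf mg; apply: measurable_fun_if => //.
- apply: (measurable_fun_bool true).
  rewrite (_ : _ @^-1` _ = \bigcap_(j in [set: 'I_d]) ((@tnth _ R ^~ j) @^-1` box1 L)).
    rewrite setTI; apply: fin_bigcap_measurable => // j _.
    rewrite -[X in measurable X]setTI.
    exact: (@measurable_tnth _ R d j measurableT (box1 L) (measurable_box1 L)).
  apply/seteqP; split => t /=; rewrite inboxE.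
    by move=> /forallP h j _ /=; have := h j; rewrite inE.
  by move=> h; apply/forallP => j; rewrite inE; exact: h.
- exact: measurable_funS mf.
- exact: measurable_funS mg.
Qed.

Lemma rint_box (h : 'rV[R]_d -> R) :
  tmu.-integrable setT (fun t => (h (toV t))%:E) ->
  rint (fun x => if boxb L x then h x else 0) = Rintegral tmu setT (fun t => h (toV t)).
Proof.
move=> hi; have mh : measurable_fun setT (fun t : X => h (toV t)).
  by apply/measurable_EFinP; exact: measurable_int hi.
have key (s : R -> R) : s 0 = 0 -> (forall u, 0 <= s u) ->
    measurable_fun setT (fun t : X => s (h (toV t))) ->
    nnint (fun x => (s (if boxb L x then h x else 0))%:E) =
    (\int[tmu]_t (s (h (toV t)))%:E)%E.
  move=> s0 s1 ms; apply: (nnint_box (g := fun x => (s (h x))%:E)).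
  - apply/measurable_EFinP.
    rewrite (_ : (fun t : X => _) = (fun t => if boxb L (toV t) then s (h (toV t)) else 0)).
      by apply: measurable_if_box.
    by apply/funext => t; case: ifP.
  - exact/measurable_EFinP.
  - by move=> x; rewrite lee_fin.
  - by move=> x; rewrite lee_fin.
  - by move=> x /negbTE ->; rewrite s0.
  - by move=> x ->.
rewrite /rint (key (fun u => Num.max u 0)) ?(key (fun u => Num.max (- u) 0)).
- rewrite /Rintegral [in RHS]integralE [in RHS]fineB.
  + by congr (fine _ - fine _); apply: eq_integral => t _; rewrite ?funeposE ?funenegE -?EFinN EFin_max.
  + exact: integrable_pos_fin_num.
  + exact: integrable_neg_fin_num.
- by rewrite oppr0 maxxx.
- by move=> u; rewrite le_max lexx orbT.
- by apply: measurable_maxr => //; exact: measurable_funN.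
- by rewrite maxxx.
- by move=> u; rewrite le_max lexx orbT.
- exact: measurable_maxr.
Qed.

Lemma cint_box (h : 'rV[R]_d -> R[i]) : cintegrable tmu (fun t => h (toV t)) ->
  cint (fun x => if boxb L x then h x else 0) = cintegral tmu (fun t => h (toV t)).
Proof.
move=> /cintegrableP[h1 h2]; rewrite /cint /cintegral.
rewrite -(rint_box (h := fun x => complex.Re (h x)))// -(rint_box (h := fun x => complex.Im (h x)))//.
by congr (_ +i* _); congr rint; apply/funext => x; case: ifP.
Qed.

Lemma integral_pnm (f : X -> \bar R) (tau : X -> X) : measurable_fun setT tau ->
  (forall h, measurable_fun setT h -> (forall t, 0 <= h t)%E ->
    \int[tmu]_t h (tau t) = \int[tmu]_t h t)%E ->
  measurable_fun setT f -> (\int[tmu]_t f (tau t) = \int[tmu]_t f t)%E.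
Proof.
move=> mtau htau mf; rewrite [RHS]integralE -(htau (f^\+)%E) -?(htau (f^\-)%E).
- by rewrite [LHS]integralE; congr (_ - _)%E; apply: eq_integral => t _; rewrite ?funeposE ?funenegE.
- exact: measurable_funeneg.
- by move=> t; exact: funeneg_ge0.
- exact: measurable_funepos.
- by move=> t; exact: funepos_ge0.
Qed.

Lemma cmf_tshift y (f : X -> R[i]) : cmf f -> cmf (fun t => f (tshift y t)).
Proof.
by move=> [f1 f2]; split; [exact: (measurableT_comp f1 (measurable_tshift y))|
  exact: (measurableT_comp f2 (measurable_tshift y))].
Qed.

Lemma cmf_twrap (f : X -> R[i]) : cmf f -> cmf (fun t => f (twrap t)).
Proof.
by move=> [f1 f2]; split; [exact: (measurableT_comp f1 measurable_twrap)|
  exact: (measurableT_comp f2 measurable_twrap)].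
Qed.

Lemma cintegral_tshift y (f : X -> R[i]) : cmf f ->
  cintegral tmu (fun t => f (tshift y t)) = cintegral tmu f.
Proof.
move=> [f1 f2]; apply: complex_ext; rewrite /= /Rintegral; congr fine.
  apply: (integral_pnm (f := fun t => (complex.Re (f t))%:E) (measurable_tshift y)).
    by move=> h; exact: integral_tshift.
  exact/measurable_EFinP.
apply: (integral_pnm (f := fun t => (complex.Im (f t))%:E) (measurable_tshift y)).
  by move=> h; exact: integral_tshift.
exact/measurable_EFinP.
Qed.

Lemma cintegrable_tshift y (f : X -> R[i]) : cintegrable tmu f ->
  cintegrable tmu (fun t => f (tshift y t)).
Proof.
move=> [mf fi]; split; first exact: cmf_tshift.
rewrite (integral_tshift y (f := fun t => (na (f t))%:E))//.
- by apply/measurable_EFinP; exact: measurable_na.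
- by move=> t; rewrite lee_fin na_ge0.
Qed.

Lemma expi_pi : expi (pi : R) = -1.
Proof. by rewrite /expi cospi sinpi; apply: complex_ext => /=; rewrite ?oppr0. Qed.

Lemma expi_2pi_int (m : int) : expi (2 * pi * m%:~R : R) = 1.
Proof.
have nat_case (n : nat) : expi (2 * pi * n%:R : R) = 1.
  elim: n => [|n IH]; first by rewrite mulr0 expi0.
  rewrite -(natr1 n) mulrDr mulr1 expiD IH mul1r (_ : 2 * pi = pi + pi); last by ring.
  by rewrite expiD expi_pi mulrNN mulr1.
case: m => n; first exact: nat_case.
rewrite NegzE rmorphN mulrN expiN nat_case.
by apply: complex_ext; rewrite /= ?oppr0.
Qed.

Definition ek (k : 'rV[int]_d) (t : X) : R[i] := expi (2 * pi * dotp (dual L k) (toV t)).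

Lemma dotp_dual k (t : X) :
  dotp (dual L k) (toV t) = \sum_j (k 0 j)%:~R / L * tnth t j.
Proof. by apply: eq_bigr => j _; rewrite !mxE. Qed.

Lemma ekD k l t : ek (k + l) t = ek k t * ek l t.
Proof.
rewrite /ek -expiD !dotp_dual; congr expi.
rewrite -mulrDr -big_split /=; congr (_ * _); apply: eq_bigr => j _.
by rewrite mxE intrD !mulrDl.
Qed.

Lemma ek0 t : ek 0 t = 1.
Proof.
rewrite /ek dotp_dual big1 ?mulr0 ?expi0// => j _.
by rewrite mxE !mul0r.
Qed.

Lemma ekN k t : ek (- k) t = conjc (ek k t).
Proof.
rewrite /ek -expiN !dotp_dual; congr expi.
rewrite -mulrN -sumrN; congr (_ * _); apply: eq_bigr => j _.
by rewrite mxE rmorphN !mulNr.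
Qed.

Lemma ekB k l t : ek (k - l) t = ek k t * conjc (ek l t).
Proof. by rewrite ekD ekN. Qed.

Lemma ek_sum (I : Type) (s : seq I) (P : pred I) (k : I -> 'rV[int]_d) t :
  ek (\sum_(i <- s | P i) k i) t = \prod_(i <- s | P i) ek (k i) t.
Proof. exact: (big_morph (ek^~ t) (fun k l => ekD k l t) (ek0 t)). Qed.

(** Reduction to the box moves each coordinate by an integer multiple of [L], which the character of
    a dual momentum does not see. *)
Lemma ek_tshift k y t : ek k (tshift y t) = ek k t * ek k y.
Proof.
rewrite /ek !dotp_dual.
pose q j := Num.floor ((tnth t j + tnth y j + L / 2) / L).
rewrite (_ : 2 * pi * _ = 2 * pi * (\sum_j (k 0 j)%:~R / L * tnth t j) +
  2 * pi * (\sum_j (k 0 j)%:~R / L * tnth y j) +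
  2 * pi * (- \sum_j k 0 j * q j)%:~R); last first.
  rewrite -!mulrDr rmorphN rmorph_sum -big_split -sumrB /=; congr (_ * _).
  apply: eq_bigr => j _; rewrite tnth_tshift /wrap1 -/(q j) rmorphM /=.
  by field; rewrite gt_eqF.
by rewrite expiD expi_2pi_int mulr1 expiD.
Qed.

Lemma sqn_ek k t : sqn (ek k t) = 1.
Proof. exact: sqn_expi. Qed.

Lemma na_ek k t : na (ek k t) <= 2.
Proof. exact: na_expi. Qed.

Lemma ek_conjM k t : conjc (ek k t) * ek k t = 1.
Proof. by rewrite -sqnE sqn_ek. Qed.

Lemma cmf_ek k : cmf (ek k).
Proof.
apply: cmf_expi; apply: measurable_funM => //.
under eq_fun do rewrite dotp_dual.
apply: measurable_sum => j; apply: measurable_funM => //.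
exact: measurable_tnth.
Qed.

Lemma tmu_fin : (tmu setT < +oo)%E.
Proof. by rewrite tmu_setT ltry. Qed.

Lemma cintegrable_ek k : cintegrable tmu (ek k).
Proof.
apply: (@finite_cintegrable _ _ _ _ _ 2); [exact: tmu_fin|exact: cmf_ek|exact: na_ek].
Qed.

(** For [k != 0], translation by half a period in a coordinate with [k_j != 0] multiplies the
    character by -1, while the integral is translation invariant; so it equals its own negative. *)
Lemma cintegral_ek k : cintegral tmu (ek k) = if k == 0 then (L ^+ d)%:C else 0.
Proof.
case: eqVneq => [->|k0].
  rewrite (_ : ek 0 = fun=> 1); last by apply/funext => t; rewrite ek0.
  apply: complex_ext; rewrite /= Rintegral_cst// ?mul0r//.
  by rewrite mul1r; exact: (congr1 fine tmu_setT).
have [j kj] : exists j, k 0 j != 0.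
  apply/existsP; apply: contraR k0; rewrite negb_exists => /forallP h.
  by apply/eqP/rowP => j; rewrite mxE; apply/eqP; have := h j; rewrite negbK.
pose y : X := [tuple if i == j then L / (2 * (k 0 j)%:~R) else 0 | i < d].
have yk : ek k y = -1.
  rewrite /ek dotp_dual (bigD1 j)//= big1 ?addr0; last first.
    by move=> i ij; rewrite tnth_mktuple (negbTE ij) mulr0.
  rewrite tnth_mktuple eqxx -expi_pi; congr expi; field.
  by apply/andP; split; [rewrite intr_eq0|rewrite gt_eqF].
have : cintegral tmu (fun t => ek k (tshift y t)) = cintegral tmu (ek k).
  by apply: cintegral_tshift; exact: cmf_ek.
under eq_fun do rewrite ek_tshift yk mulrN1.
rewrite cintegralN; last exact: cintegrable_ek.
set I := cintegral _ _ => /eqP; rewrite eq_sym -addr_eq0 => /eqP h.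
have h1 := congr1 (@complex.Re R) h; have h2 := congr1 (@complex.Im R) h.
rewrite ReD /= in h1; rewrite ImD /= in h2.
by apply: complex_ext => /=; lra.
Qed.

Lemma hatperE (h : 'rV[R]_d -> R[i]) k : cintegrable tmu (fun t => h (toV t)) ->
  hatper L h k = cintegral tmu (fun t => conjc (ek k t) * h (toV t)).
Proof.
move=> hi.
have e : (fun t : X => expi (- (2 * pi * dotp (dual L k) (toV t))) * h (toV t)) =
    fun t => conjc (ek k t) * h (toV t).
  by apply/funext => t; rewrite /ek -expiN.
rewrite /hatper (cint_box (h := fun x => expi (- (2 * pi * dotp (dual L k) x)) * h x)) e//.
apply: (cintegrable_bM (C := 2)) => //; first by apply: cmfJ; exact: cmf_ek.
by move=> t; rewrite naJ na_ek.
Qed.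

(** * Completeness of the characters *)

Section Completeness.
Variable f : X -> R[i].
Hypothesis fi : cintegrable tmu f.
Hypothesis f_orth : forall k, cintegral tmu (fun t => ek k t * f t) = 0.

Definition bdd (g : X -> R) := exists C, forall t, `|g t| <= C.

(* [annih] is a space of bounded weights containing the constants; [multiplier]
   is an algebra of functions closed under bounded pointwise limits, so it
   contains all bounded measurable functions as soon as it contains the
   coordinates of the torus embedding. *)
Definition annih (g : X -> R) := [/\ measurable_fun setT g, bdd g &
  forall k, cintegral tmu (fun t => ek k t * ((g t)%:C * f t)) = 0].

Definition multiplier (m : X -> R) := [/\ measurable_fun setT m, bdd m &
  forall g, annih g -> annih (fun t => m t * g t)].

Lemma bdd_ge0 (g : X -> R) : bdd g -> exists2 C, 0 <= C & forall t, `|g t| <= C.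
Proof.
move=> [C gC]; exists `|C| => // t; apply: le_trans (gC t) _; exact: ler_norm.
Qed.

Lemma bddM (g h : X -> R) : bdd g -> bdd h -> bdd (fun t => g t * h t).
Proof.
move=> /bdd_ge0[C C0 gC] /bdd_ge0[D D0 hD]; exists (C * D) => t.
by rewrite normrM ler_pM.
Qed.

Lemma bddD (g h : X -> R) : bdd g -> bdd h -> bdd (fun t => g t + h t).
Proof.
move=> [C gC] [D hD]; exists (C + D) => t.
by apply: (le_trans (ler_normD _ _)); rewrite lerD.
Qed.

Lemma weight_cintegrable (g : X -> R) : measurable_fun setT g -> bdd g ->
  cintegrable tmu (fun t => (g t)%:C * f t).
Proof.
move=> mg [C gC]; apply: (cintegrable_bM (C := C) _ _ fi); first exact: (cmf_real mg).
by move=> t; rewrite na_real; exact: gC.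
Qed.

Lemma ek_weight_cintegrable k (g : X -> R) : measurable_fun setT g -> bdd g ->
  cintegrable tmu (fun t => ek k t * ((g t)%:C * f t)).
Proof.
move=> mg bg; apply: (cintegrable_bM (C := 2)); [exact: cmf_ek|exact: na_ek|].
exact: weight_cintegrable.
Qed.

Lemma annih_cst1 : annih (fun=> 1).
Proof.
split; [exact: measurable_cst|by exists 1 => t; rewrite normr1|].
by move=> k; rewrite -[RHS](f_orth k); congr cintegral; apply/funext => t; rewrite mul1r.
Qed.

Lemma annihD g h : annih g -> annih h -> annih (fun t => g t + h t).
Proof.
move=> [mg bg g0] [mh bh h0]; split; [exact: measurable_funD|exact: bddD|].
move=> k; rewrite -[RHS](addr0 0) -{1}(g0 k) -(h0 k) -cintegralD; try exact: ek_weight_cintegrable.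
by congr cintegral; apply/funext => t; rewrite rmorphD mulrDl mulrDr.
Qed.

Lemma annihZ (a : R) g : annih g -> annih (fun t => a * g t).
Proof.
move=> [mg bg g0]; split; [exact: measurable_funM|by apply: bddM => //; exists `|a| |].
move=> k; rewrite -[RHS](mulr0 a%:C) -(g0 k) -cintegralZ; last exact: ek_weight_cintegrable.
by congr cintegral; apply/funext => t; rewrite rmorphM /=; ring.
Qed.

Lemma annih_cvg (u : nat -> X -> R) g (C : R) : (forall n, annih (u n)) ->
  (forall n t, `|u n t| <= C) -> (forall t, (u ^~ t) @ \oo --> g t) -> annih g.
Proof.
move=> ua uC ug.
have mg : measurable_fun setT g.
  apply: (measurable_fun_cvg (h := u)) => [n|t _]; last exact: ug.
  by have [] := ua n.
split => //.
  by exists C => t; apply: (cvgr_to_le (cvg_norm (ug t))); apply: nearW => n; exact: uC.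
move=> k.
have : ccvg (fun n => cintegral tmu (fun t => ek k t * ((u n t)%:C * f t)))
    (cintegral tmu (fun t => ek k t * ((g t)%:C * f t))).
  apply: (dominated_ccvg (g := fun t => 2 * (C * na (f t)))).
  - move=> n; have [mu_ bu _] := ua n; exact: (ek_weight_cintegrable _ mu_ bu).1.
  - move=> t; apply: ccvgM; first exact: ccvg_cst.
    by apply: ccvgM; [split; [exact: ug|exact: cvg_cst]|exact: ccvg_cst].
  - have := integrableZl measurableT 2 (integrableZl measurableT C (na_integrable fi)).
    by [].
  - move=> n t; apply: (le_trans (naM _ _)); apply: ler_pM; rewrite ?na_ge0 ?na_ek//.
    by apply: (le_trans (naM _ _)); rewrite na_real ler_wpM2r ?na_ge0.
have -> : (fun n => cintegral tmu (fun t => ek k t * ((u n t)%:C * f t))) = fun=> 0.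
  by apply/funext => n; have [_ _] := ua n.
by move/ccvg_unique => /(_ _ (ccvg_cst 0)).
Qed.

Lemma annih_eqbox g h : measurable_fun setT h -> bdd h ->
  (forall t, boxb L (toV t) -> g t = h t) -> annih g -> annih h.
Proof.
move=> mh bh gh [mg bg g0]; split => // k; rewrite -[RHS](g0 k).
apply: eq_box_cintegral.
- exact: (ek_weight_cintegrable _ mh bh).1.
- exact: (ek_weight_cintegrable _ mg bg).1.
- by move=> t /gh ->.
Qed.

Lemma multiplier_cst (a : R) : multiplier (fun=> a).
Proof. by split; [exact: measurable_cst|exists `|a| |move=> g; exact: annihZ]. Qed.

Lemma multiplierD m n : multiplier m -> multiplier n -> multiplier (fun t => m t + n t).
Proof.
move=> [mm bm hm] [mn bn hn]; split; [exact: measurable_funD|exact: bddD|].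
move=> g ga; under eq_fun do rewrite mulrDl.
by apply: annihD; [exact: hm|exact: hn].
Qed.

Lemma multiplierM m n : multiplier m -> multiplier n -> multiplier (fun t => m t * n t).
Proof.
move=> [mm bm hm] [mn bn hn]; split; [exact: measurable_funM|exact: bddM|].
by move=> g ga; under eq_fun do rewrite -mulrA; apply: hm; exact: hn.
Qed.

Lemma multiplier_cvg (u : nat -> X -> R) m (C : R) : (forall n, multiplier (u n)) ->
  (forall n t, `|u n t| <= C) -> (forall t, (u ^~ t) @ \oo --> m t) -> multiplier m.
Proof.
move=> ua uC um; split.
- apply: (measurable_fun_cvg (h := u)) => [n|t _]; last exact: um.
  by have [] := ua n.
- by exists C => t; apply: (cvgr_to_le (cvg_norm (um t))); apply: nearW => n; exact: uC.
- move=> g ga; have [_ /bdd_ge0[D D0 gD] _] := ga.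
  apply: (annih_cvg (u := fun n t => u n t * g t) (C := C * D)).
  + by move=> n; have [_ _] := ua n; apply.
  + by move=> n t; rewrite normrM ler_pM.
  + by move=> t; apply: cvgM; [exact: um|exact: cvg_cst].
Qed.

Lemma multiplier_eqbox m n : measurable_fun setT n -> bdd n ->
  (forall t, boxb L (toV t) -> m t = n t) -> multiplier m -> multiplier n.
Proof.
move=> mn bn mnE [mm bm hm]; split => // g ga; have [mg bg _] := ga.
apply: annih_eqbox (hm g ga); [exact: measurable_funM|exact: bddM|].
by move=> t /mnE ->.
Qed.

(** Multiplication by a character only shifts the index in the orthogonality relations, and these
    hold for every index. *)
Lemma multiplier_trig (m : X -> R) (z1 z2 : R[i]) k1 k2 :
  measurable_fun setT m -> bdd m ->
  (forall t, (m t)%:C = z1 * ek k1 t + z2 * ek k2 t) -> multiplier m.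
Proof.
move=> mm bm mE; split => // g [mg bg g0]; split; [exact: measurable_funM|exact: bddM|].
move=> k.
have -> : (fun t => ek k t * ((m t * g t)%:C * f t)) =
   (fun t => z1 * (ek (k + k1) t * ((g t)%:C * f t)) + z2 * (ek (k + k2) t * ((g t)%:C * f t))).
  by apply/funext => t; rewrite rmorphM /= mE !ekD; ring.
rewrite cintegralD; try (apply: cintegrableZ; exact: ek_weight_cintegrable).
by rewrite !cintegralZ ?g0 ?mulr0 ?addr0//; exact: ek_weight_cintegrable.
Qed.

Definition ej (j : 'I_d) : 'rV[int]_d := \row_i (i == j)%:R.

Definition theta (j : 'I_d) (t : X) : R := 2 * pi * (tnth t j / L).

Lemma ek_ej j t : ek (ej j) t = expi (theta j t).
Proof.
rewrite /ek dotp_dual (bigD1 j)//= big1 ?addr0; last first.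
  by move=> i /negbTE ij; rewrite mxE ij !mul0r.
by rewrite mxE eqxx /theta; congr expi; rewrite div1r (mulrC L^-1).
Qed.

Lemma measurable_theta j : measurable_fun setT (theta j).
Proof.
by apply: measurable_funM => //; apply: measurable_funM => //; exact: measurable_tnth.
Qed.

Lemma multiplier_cos j : multiplier (fun t => cos (theta j t)).
Proof.
apply: (@multiplier_trig _ (2^-1)%:C (2^-1)%:C (ej j) (- ej j)).
- exact: (cmf_expi (measurable_theta j)).1.
- by exists 1 => t; rewrite ler_norml cos_geN1 cos_le1.
- by move=> t; rewrite ekN ek_ej; apply: complex_ext => /=; field.
Qed.

Lemma multiplier_sin j : multiplier (fun t => sin (theta j t)).
Proof.
apply: (@multiplier_trig _ (0 -i* 2^-1) (0 +i* 2^-1) (ej j) (- ej j)).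
- exact: (cmf_expi (measurable_theta j)).2.
- by exists 1 => t; rewrite ler_norml sin_geN1 sin_le1.
- by move=> t; rewrite ekN ek_ej; apply: complex_ext => /=; field.
Qed.

(** Rescaled into [[-1, 1]], the function has its sign as a bounded limit of polynomials in it, and
    [(sg^2 + sg) / 2] is the indicator of positivity. *)
Lemma multiplier_pos m : multiplier m -> multiplier (fun t => (0 < m t)%R%:R).
Proof.
move=> mm; have [_ /bdd_ge0[C C0 mC] _] := mm.
(* [C + 1] instead of [C] keeps the divisor positive. *)
pose m' t := (C + 1)^-1 * m t.
have m'm : multiplier m' by apply: multiplierM => //; exact: multiplier_cst.
have m'1 t : -1 <= m' t <= 1.
  rewrite -ler_norml /m' normrM gtr0_norm ?invr_gt0; last by lra.
  rewrite mulrC ler_pdivrMr; last by lra.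
  by have := mC t; lra.
have sm : multiplier (fun t => Num.sg (m' t)).
  apply: (multiplier_cvg (u := fun n t => iter n (@sgn_step R) (m' t)) (C := 1)).
  - elim=> [//|n IH] /=.
    apply: multiplierM; last exact: multiplier_cst.
    apply: multiplierM => //; apply: multiplierD; first exact: multiplier_cst.
    rewrite (_ : (fun t => _) = (fun t => -1 * (iter n (@sgn_step R) (m' t) * iter n (@sgn_step R) (m' t)))).
      by apply: multiplierM; [exact: multiplier_cst|exact: multiplierM].
    by apply/funext => t; rewrite mulN1r.
  - by move=> n t; rewrite ler_norml sgn_iter_itv.
  - by move=> t; exact: sgn_iter_cvg.
rewrite (_ : (fun t => _) = (fun t => 2^-1 * (Num.sg (m' t) * Num.sg (m' t) + Num.sg (m' t)))).
  apply: multiplierM; first exact: multiplier_cst.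
  by apply: multiplierD => //; exact: multiplierM.
apply/funext => t; have C1 : 0 < (C + 1)^-1 by rewrite invr_gt0; lra.
rewrite /m' sgrM (gtr0_sg C1) mul1r.
by have [h|h|h] := sgrP (m t); rewrite ?ltxx /=; lra.
Qed.

Definition mset (S : set X) := measurable S /\ multiplier (\1_S).

Lemma mset_pos m : multiplier m -> mset [set t | 0 < m t].
Proof.
move=> mm; have [mmm _ _] := mm; split.
  exact: measurable_gt.
rewrite (_ : \1_ _ = fun t => (0 < m t)%R%:R); first exact: multiplier_pos.
apply/funext => t; rewrite indicE; have [h|h] := boolP (0 < m t).
  by rewrite mem_set.
by rewrite memNset//; exact/negP.
Qed.

Lemma bdd_indic (S : set X) : bdd (\1_S).
Proof. by exists 1 => t; rewrite indicE; case: (_ \in _); rewrite ?normr1 ?normr0. Qed.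

Lemma mset_eqbox (S S' : set X) : measurable S' ->
  (forall t, boxb L (toV t) -> S t <-> S' t) -> mset S -> mset S'.
Proof.
move=> mS' SS' [mS hS]; split => //.
apply: (multiplier_eqbox _ _ _ hS); [exact: measurable_indic|exact: bdd_indic|].
move=> t tb; rewrite !indicE; congr (_%:R).
have SS'E := SS' t tb; have [h|h] := pselect (S t).
  by rewrite !mem_set//; exact/SS'E.
by rewrite !memNset// => /SS'E.
Qed.

Lemma msetC S : mset S -> mset (~` S).
Proof.
move=> [mS hS]; split; first exact: measurableC.
rewrite (_ : \1_ _ = fun t => 1 + -1 * \1_S t).
  by apply: multiplierD; [exact: multiplier_cst|apply: multiplierM => //; exact: multiplier_cst].
by apply/funext => t; rewrite !indicE in_setC; case: (_ \in _) => /=; lra.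
Qed.

Lemma msetI S S' : mset S -> mset S' -> mset (S `&` S').
Proof.
move=> [mS hS] [mS' hS']; split; first exact: measurableI.
rewrite (_ : \1_ _ = fun t => \1_S t * \1_S' t); first exact: multiplierM.
by apply/funext => t; rewrite indicI.
Qed.

Lemma msetU S S' : mset S -> mset S' -> mset (S `|` S').
Proof.
by move=> hS hS'; rewrite -[_ `|` _]setCK setCU; apply: msetC; apply: msetI; exact: msetC.
Qed.

Lemma mset0 : mset set0.
Proof.
split => //; rewrite indic0; exact: multiplier_cst.
Qed.

Lemma mset_bigcup (F : nat -> set X) : (forall n, mset (F n)) -> mset (\bigcup_n F n).
Proof.
move=> hF.
have hU n : mset (\big[setU/set0]_(i < n) F i).
  by elim: n => [|n IH]; [rewrite big_ord0; exact: mset0|rewrite big_ord_recr; exact: msetU].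
split; first by apply: bigcup_measurable => n _; exact: (hF n).1.
apply: (multiplier_cvg (u := fun n => \1_(\big[setU/set0]_(i < n) F i)) (C := 1)).
- by move=> n; exact: (hU n).2.
- by move=> n t; rewrite indicE; case: (_ \in _); rewrite ?normr1 ?normr0.
- move=> t; have [[n _ Fn]|h] := pselect ((\bigcup_n F n) t).
    rewrite [X in _ --> X]indicE mem_set; last by exists n.
    apply: cvg_near_cst; exists n.+1 => // m /= nm.
    rewrite indicE mem_set// -bigcup_mkord; exists n => //=.
  rewrite [X in _ --> X]indicE memNset//.
  rewrite (_ : (fun n => _) = fun=> 0); first exact: cvg_cst.
  apply/funext => m; rewrite indicE memNset// -bigcup_mkord => -[k _ Fk].
  by apply: h; exists k.
Qed.

(** Cosine and sine locate the angle [theta] in [[-pi, pi)]: the sign of the sine selects a half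
    circle, on which the cosine is monotone. *)
Lemma mset_ray j (b : R) : mset [set t | b < tnth t j].
Proof.
have mS : measurable [set t : X | b < tnth t j].
  by apply: (measurable_gt (g := @tnth _ R ^~ j)); exact: measurable_tnth.
have L2 : L / 2 = L * 2^-1 by [].
have thE (t : X) : theta j t = 2 * pi * (tnth t j / L) by [].
have pi0 := @pi_gt0 R.
have th_box (t : X) : boxb L (toV t) -> - pi <= theta j t < pi.
  rewrite inboxE => /forallP/(_ j); rewrite box1P => /andP[t1 t2].
  rewrite /theta; set x := tnth t j in t1 t2 *.
  have h1 : - 2^-1 <= x / L by rewrite ler_pdivlMr//; lra.
  have h2 : x / L < 2^-1 by rewrite ltr_pdivrMr//; lra.
  by apply/andP; split; nra.
pose beta := 2 * pi * (b / L).
have bE (t : X) : (b < tnth t j) = (beta < theta j t).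
  rewrite /beta /theta ltr_pM2l; last by rewrite mulr_gt0.
  by rewrite ltr_pM2r// invr_gt0.
have mcos c : mset [set t | cos (theta j t) < c].
  rewrite (_ : [set t | _] = [set t | 0 < c + -1 * cos (theta j t)]).
    apply: mset_pos; apply: multiplierD; first exact: multiplier_cst.
    by apply: multiplierM; [exact: multiplier_cst|exact: multiplier_cos].
  by apply/seteqP; split => t /=; lra.
have msin : mset [set t | 0 < sin (theta j t)] by apply: mset_pos; exact: multiplier_sin.
have msinN : mset [set t | sin (theta j t) < 0].
  rewrite (_ : [set t | _] = [set t | 0 < -1 * sin (theta j t)]).
    by apply: mset_pos; apply: multiplierM; [exact: multiplier_cst|exact: multiplier_sin].
  by apply/seteqP; split => t /=; lra.
have [b0|b0] := leP 0 beta.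
  have [bpi|bpi] := ltP beta pi.
    (* For [0 <= beta < pi], the condition [beta < theta] forces the upper half circle, where the
       cosine decreases. *)
    apply: (mset_eqbox mS _ (msetI msin (mcos (cos beta)))) => t /th_box/andP[t1 t2] /=.
    rewrite bE; split.
      case=> s0 c0; have t0 : 0 < theta j t.
        rewrite ltNge; apply/negP => tle.
        have : 0 <= sin (- theta j t) by apply: sin_ge0_pi; lra.
        by rewrite sinN; lra.
      by move: c0; rewrite ltr_cos ?in_itv /=; lra.
    move=> bt; split; first by apply: sin_gt0_pi; lra.
    by rewrite ltr_cos ?in_itv /=; lra.
  apply: (mset_eqbox mS _ mset0) => t /th_box/andP[t1 t2] /=.
  by rewrite bE; split => //; lra.
have [bpi|bpi] := ltP beta (- pi).
  apply: (mset_eqbox mS _ (msetC mset0)) => t /th_box/andP[t1 t2] /=.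
  by rewrite bE; split => //; [lra|move=> _ []].
have mcos' c : mset [set t | c < cos (theta j t)].
  rewrite (_ : [set t | _] = [set t | 0 < - c + cos (theta j t)]).
    by apply: mset_pos; apply: multiplierD; [exact: multiplier_cst|exact: multiplier_cos].
  by apply/seteqP; split => t /=; lra.
(* The complement of [theta <= beta], a set within the lower half circle. Its end point [-pi] has
   sine 0 and is added as the set where the cosine is at most -1. *)
apply: (mset_eqbox mS _ (msetC (msetU (msetI msinN (msetC (mcos' (cos beta)))) (msetC (mcos' (-1)))))).
move=> t /th_box/andP[t1 t2] /=; rewrite bE.
have [tb|tb] := leP (theta j t) beta; split=> //.
- move=> h; exfalso; apply: h.
  move: t1; rewrite le_eqVlt => /predU1P[t1|t1].
    by right; rewrite -t1 cosN cospi ltxx.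
  left; split.
    rewrite -oppr_gt0 -sinN; apply: sin_gt0_pi; lra.
  apply/negP; rewrite -leNgt -(cosN beta) -(cosN (theta j t)).
  by rewrite leNgt ltr_cos ?in_itv /= -?leNgt; lra.
- move=> _ [[s0 /negP]|/negP]; rewrite -leNgt => h.
    have t0 : theta j t < 0.
      rewrite ltNge; apply/negP => tge.
      have : 0 <= sin (theta j t) by apply: sin_ge0_pi; lra.
      by lra.
    move: h; rewrite -(cosN beta) -(cosN (theta j t)) leNgt ltr_cos ?in_itv /= -?leNgt; lra.
  have : cos (- theta j t) = -1 by rewrite cosN; apply/eqP; rewrite eq_le h cos_geN1.
  rewrite -cospi; have [t0|t0] := leP 0 (theta j t).
    rewrite cosN => /cos_inj; rewrite !in_itv /= => hh.
    by have := hh _ _; lra.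
  move=> /cos_inj; rewrite !in_itv /= => hh.
  by have := hh _ _; lra.
Qed.

Lemma sigma_algebra_mset : sigma_algebra setT mset.
Proof.
split; [exact: mset0|by move=> S hS; rewrite setTD; exact: msetC|exact: mset_bigcup].
Qed.

(** These sets form a sigma-algebra, and the generating half-open intervals in a coordinate are
    differences of two rays. *)
Lemma measurable_mset S : measurable S -> mset S.
Proof.
apply: smallest_sub; first exact: sigma_algebra_mset.
move=> A; elim/big_rec: _ => [[]|j U _ IH [[B mB <-]|]]; last exact: IH.
rewrite setTI.
suff : measurable `<=` [set B : set R | mset ((@tnth _ R ^~ j) @^-1` B)] by apply.
apply: smallest_sub.
  split => /=.
  - by rewrite preimage_set0; exact: mset0.
  - by move=> B' hB'; rewrite setTD preimage_setC; exact: msetC.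
  - by move=> F hF; rewrite preimage_bigcup; exact: mset_bigcup.
move=> _ [[a b] _ <-] /=.
rewrite (_ : _ @^-1` _ = [set t : X | a < tnth t j] `&` ~` [set t : X | b < tnth t j]).
  by apply: msetI; [exact: mset_ray|apply: msetC; exact: mset_ray].
apply/seteqP; split => t /=; rewrite in_itv /=.
  by move=> /andP[-> h]; split => //; apply/negP; rewrite -leNgt.
by case=> -> /negP; rewrite -leNgt.
Qed.

Lemma cintegral_indic (S : set X) : measurable S ->
  cintegral tmu (fun t => (\1_S t)%:C * f t) = 0.
Proof.
move=> /measurable_mset[_ [_ _ /(_ _ annih_cst1)[_ _ /(_ 0)]]] <-.
by congr cintegral; apply/funext => t; rewrite ek0 mul1r mulr1.
Qed.

(** All measurable indicators are multipliers, so [f] integrates to 0 over every measurable set. *)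
Lemma fourier_complete : {ae tmu, forall t, f t = 0}.
Proof.
have [f1 f2] := cintegrableP fi.
have key (h : X -> R) : tmu.-integrable setT (EFin \o h) ->
    (forall S, measurable S -> Rintegral tmu setT (fun t => \1_S t * h t) = 0) ->
    {ae tmu, forall t, h t = 0}.
  move=> hi h0.
  have := integral_ae_eq measurableT hi (g := cst 0%E) (measurable_cst _).
  have hE E : E `<=` setT -> measurable E ->
      (\int[tmu]_(x in E) (EFin \o h) x = \int[tmu]_(x in E) cst 0 x)%E.
    move=> _ mE; rewrite integral0 integral_mkcond.
    rewrite (eq_integral (fun t => (\1_E t * h t)%:E)); last first.
      by move=> t _; rewrite patchE indicE; case: ifP => _ /=; rewrite ?mul1r ?mul0r.
    rewrite -[LHS]fineK; last first.
      apply: integrable_fin_num => //.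
      have mh : measurable_fun setT h by apply/measurable_EFinP; exact: measurable_int hi.
      apply: le_integrable hi => //.
        apply/measurable_EFinP; apply: measurable_funM; first exact: measurable_indic.
        exact: mh.
      move=> t _ /=; rewrite lee_fin normrM indicE.
      by case: (_ \in _); rewrite ?normr1 ?normr0 ?mul1r ?mul0r.
    by congr EFin; exact: h0.
  by move=> /(_ hE); apply: filterS => t /(_ I) /= [].
have h1 S : measurable S -> Rintegral tmu setT (fun t => \1_S t * complex.Re (f t)) = 0.
  move=> /cintegral_indic/(congr1 (@complex.Re R)) /= <-.
  by apply: eq_Rintegral => t _; rewrite Re_realM.
have h2 S : measurable S -> Rintegral tmu setT (fun t => \1_S t * complex.Im (f t)) = 0.
  move=> /cintegral_indic/(congr1 (@complex.Im R)) /= <-.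
  by apply: eq_Rintegral => t _; rewrite Im_realM.
apply: filterS2 (key _ f1 h1) (key _ f2 h2) => t e1 e2.
exact: complex_ext.
Qed.

End Completeness.

(** * Fourier series, resolvent and potential *)

(** Not normalized, in agreement with [hatper]; hence the factors [lam] and [lam^-1] in the Parseval
    and convolution formulas. *)
Definition fc (f : X -> R[i]) (k : 'rV[int]_d) : R[i] := ip tmu (ek k) f.

Local Notation lam := (L ^+ d).

Lemma vol_gt0 : 0 < lam.
Proof. exact: exprn_gt0. Qed.

Section FourierSeries.
Let lam0 := vol_gt0.

Let en n t : R[i] := enum_ext 0 (fun k : 'rV[int]_d => ek k t) n.
Let bn n := isSome (@pickle_inv 'rV[int]_d n).

Lemma sqint_ek k : sqint tmu (ek k).
Proof. by apply: (@bounded_sqint _ _ _ _ _ 2); [exact: cmf_ek|exact: na_ek]. Qed.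

Let en_cmf n : cmf (en n).
Proof. by rewrite /en /enum_ext; case: pickle_inv => [k|]; [exact: cmf_ek|exact: cmf_cst]. Qed.

Let en_le n t : na (en n t) <= 2.
Proof. by rewrite /en /enum_ext; case: pickle_inv => [k|]; [exact: na_ek|rewrite na0]. Qed.

Let en_0 n t : ~~ bn n -> en n t = 0.
Proof. by rewrite /en /enum_ext /bn; case: pickle_inv. Qed.

Lemma ip0l (f : X -> R[i]) : ip tmu (fun=> 0) f = 0.
Proof.
rewrite /ip (_ : (fun _ => _) = fun=> 0) ?cintegral0//.
  by rewrite /cintegral /Rintegral !integral0.
by apply/funext => t; rewrite conjc0 mul0r.
Qed.

Let ip_en n f : ip tmu (en n) f = enum_ext 0 (fc f) n.
Proof.
rewrite /fc /en /enum_ext; case: pickle_inv => [//|]; exact: ip0l.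
Qed.

Lemma fc_ek k l : fc (ek l) k = if k == l then lam%:C else 0.
Proof.
rewrite /fc /ip (_ : (fun t => _) = ek (l - k)); last first.
  by apply/funext => t; rewrite ekB mulrC.
by rewrite cintegral_ek subr_eq0 eq_sym.
Qed.

Let en_orth m n : ip tmu (en m) (en n) = if (m == n) && bn n then lam%:C else 0.
Proof.
rewrite ip_en /en /bn /enum_ext.
case Em : (pickle_inv m) => [k|]; case En : (pickle_inv n) => [l|] /=.
- rewrite fc_ek andbT; congr (if _ then _ else _).
  have := @pickle_invK 'rV[int]_d m; have := @pickle_invK 'rV[int]_d n; rewrite Em En /= => <- <-.
  by apply/eqP/eqP => [->//|/(pcan_inj (@pickleK _))].
- rewrite andbF /fc /ip; under [in LHS]eq_fun do rewrite mulr0.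
  by rewrite /cintegral /Rintegral !integral0.
- by rewrite andbT; case: eqP => // e; move: Em; rewrite e En.
- by rewrite andbF.
Qed.

Let en_complete f : cintegrable tmu f -> (forall n, ip tmu (en n) f = 0) ->
  {ae tmu, forall x, f x = 0}.
Proof.
move=> fi f0; apply: (fourier_complete fi) => k.
have := f0 (pickle (- k)); rewrite ip_en enum_ext_pickle => <-.
by rewrite /fc /ip; congr cintegral; apply/funext => t; rewrite ekN conjcK.
Qed.

(** An equality, since the characters are complete. *)
Lemma bessel f : sqint tmu f ->
  esum setT (fun k => (sqn (fc f k))%:E) = (lam * nrm2 tmu f)%:E.
Proof.
move=> hf; rewrite esum_enum; last by move=> k; rewrite lee_fin sqn_ge0.
have := Parseval_nrm2 lam0 en_cmf en_le en_0 en_orth en_complete hf.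
move=> /(cvgM (cvg_cst lam)) h.
apply/cvg_lim => //.
rewrite (_ : (fun N => _) = EFin \o (fun N => lam * (lam^-1 * \sum_(0 <= n < N) sqn (ip tmu (en n) f)))).
  by apply: cvg_EFin; [exact: nearW|exact: h].
apply/funext => N /=; rewrite mulVKf ?gt_eqF// -sumEFin; apply: eq_bigr => n _.
by rewrite ip_en (enum_ext_comp (h := fun z => (sqn z)%:E) (w := 0%E))// /sqn /= expr0n addr0.
Qed.

Lemma csummable_fcM f h : sqint tmu f -> sqint tmu h ->
  csummable (fun k => conjc (fc f k) * fc h k).
Proof.
move=> hf hh; apply: (@le_csummable _ _ _ (fun k => 2%:E * (sqn (fc f k))%:E + 2%:E * (sqn (fc h k))%:E)%E).
  move=> k; rewrite -!EFinM -EFinD lee_fin; apply: le_trans (naM _ _) _; rewrite naJ.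
  have := na_le_sqn (fc f k); have := na_le_sqn (fc h k).
  have := sqr_ge0 (na (fc f k) - na (fc h k)); rewrite sqrrB.
  have := sqr_ge0 (na (fc f k)); have := sqr_ge0 (na (fc h k)); lra.
rewrite esumD; try by move=> k _; rewrite mule_ge0 ?lee_fin ?sqn_ge0.
rewrite !esumZl ?bessel//; try by move=> k; rewrite lee_fin sqn_ge0.
by rewrite -!EFinM -EFinD ltry.
Qed.

Lemma parseval_csum f h : sqint tmu f -> sqint tmu h ->
  ip tmu f h = (lam^-1)%:C * csum (fun k => conjc (fc f k) * fc h k).
Proof.
move=> hf hh; have := Parseval lam0 en_cmf en_le en_0 en_orth en_complete hf hh.
move=> /ccvg_unique; apply; apply: ccvgM; first exact: ccvg_cst.
have := csum_cvg (csummable_fcM hf hh); congr ccvg; apply/funext => N.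
apply: eq_bigr => n _; rewrite !ip_en /enum_ext; case: pickle_inv => //.
by rewrite mulr0.
Qed.

Lemma fourier_exists (c : 'rV[int]_d -> R[i]) :
  (esum setT (fun k => (sqn (c k))%:E) < +oo)%E ->
  exists g, sqint tmu g /\ forall k, fc g k = lam%:C * c k.
Proof.
move=> cs; have [||g [hg gc _]] := Riesz_Fischer lam0 en_cmf en_le en_0 en_orth (c := enum_ext 0 c).
- by move=> n; rewrite /bn /enum_ext; case: pickle_inv.
- move: cs; rewrite esum_enum; last by move=> k; rewrite lee_fin sqn_ge0.
  rewrite (_ : enum_ext _ _ = fun n => (sqn (enum_ext 0 c n))%:E); last first.
    apply/funext => n.
    by rewrite (enum_ext_comp (h := fun z => (sqn z)%:E) (w := 0%E))// /sqn /= expr0n addr0.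
  move=> cs; apply: nondecreasing_is_cvgn.
    by apply: nondecreasing_series => n _ _; exact: sqn_ge0.
  exists (fine (\sum_(0 <= n <oo) (sqn (enum_ext 0 c n))%:E)%E) => _ [N _ <-].
  rewrite -lee_fin fineK.
    by rewrite /series /= -sumEFin; apply: nneseries_lim_ge => n _ _; rewrite lee_fin sqn_ge0.
  by rewrite ge0_fin_numE//; apply: nneseries_ge0 => n _ _; rewrite lee_fin sqn_ge0.
exists g; split => // k.
by have := gc (pickle k); rewrite ip_en !enum_ext_pickle.
Qed.

End FourierSeries.

Let lam0 := vol_gt0.

Definition ofV (x : 'rV[R]_d) : X := [tuple x 0 j | j < d].

Lemma toVK : cancel (@toV d) ofV.
Proof. by move=> t; apply: eq_from_tnth => j; rewrite tnth_mktuple mxE. Qed.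

Lemma ofVK : cancel ofV (@toV d).
Proof. by move=> x; apply/rowP => j; rewrite mxE tnth_mktuple. Qed.

Lemma L2boxP (g : 'rV[R]_d -> R[i]) : L2box L g <-> sqint tmu (fun t => g (toV t)).
Proof.
rewrite /L2box /sqint cmeasE; split=> -[mg h]; split=> //; move: h;
  rewrite (nnint_box (g := fun x => (sqn (g x))%:E))//; try by
    [move=> x; rewrite ?lee_fin ?sqn_ge0//; case: ifP => //; rewrite lee_fin sqn_ge0
    |move=> x /negbTE ->|move=> x ->
    |apply/measurable_EFinP; exact: measurable_sqn
    |apply: (measurable_if_box (f := fun t => (sqn (g (toV t)))%:E) (g := cst 0%E));
      [apply/measurable_EFinP; exact: measurable_sqn|exact: measurable_cst]].
Qed.

Lemma hatper_fc (h : 'rV[R]_d -> R[i]) k : sqint tmu (fun t => h (toV t)) ->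
  hatper L h k = fc (fun t => h (toV t)) k.
Proof. by move=> hs; rewrite hatperE//; exact: sqint_cintegrable. Qed.

Lemma innerL_ip (f g : 'rV[R]_d -> R[i]) : sqint tmu (fun t => f (toV t)) ->
  sqint tmu (fun t => g (toV t)) ->
  innerL L f g = ip tmu (fun t => f (toV t)) (fun t => g (toV t)).
Proof. by move=> hf hg; rewrite /innerL cint_box//; exact: ip_cintegrable. Qed.

Section Resolvent.
Variable z : R[i].
Hypothesis hz : ~ (complex.Im z = 0 /\ 0 <= complex.Re z).

Definition rk (k : 'rV[int]_d) : R[i] := ((nu (dual L k))%:C - z)^-1.

Lemma nu_ge0 (p : 'rV[R]_d) : 0 <= nu p.
Proof. by rewrite divr_ge0// sumr_ge0// => j _; rewrite sqr_ge0. Qed.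

(** On the half line [|x - z|] grows like [x] and stays away from 0, because [z] lies off it. *)
Lemma sqn_resolvent_lower :
  exists2 C : R, 0 < C & forall x : R, 0 <= x -> (1 + x) ^+ 2 <= C * sqn (x%:C - z).
Proof.
case: z hz => a b /= h0.
have [b0|b0] := eqVneq b 0.
  have a0 : a < 0 by rewrite ltNge; apply/negP => a0; apply: h0.
  (* From [m <= 1] and [m <= -a] follows [m * (1 + x) <= x - a]. *)
  pose m : R := Num.min 1 (- a); have m0 : 0 < m by rewrite lt_min ltr01 oppr_gt0.
  exists (m ^- 2); first by rewrite invr_gt0 exprn_gt0.
  move=> x x0; rewrite ler_pdivlMl ?exprn_gt0// -exprMn /sqn /= b0 oppr0 addr0 expr0n addr0.
  have m1 : m <= 1 by rewrite ge_min lexx.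
  have ma : m <= - a by rewrite ge_min lexx orbT.
  rewrite ler_pXn2r// ?nnegrE; [nra|nra|lra].
have b2 : 0 < b ^+ 2 by rewrite exprn_even_gt0.
have q0 : 0 <= 2 * (1 + a) ^+ 2 / b ^+ 2.
  by rewrite divr_ge0 ?(ltW b2)// mulr_ge0// sqr_ge0.
(* Comes from [(1 + x)^2 <= 2 (x - a)^2 + 2 (1 + a)^2], the second term being absorbed by
   [b^2 > 0]. *)
exists (2 + 2 * (1 + a) ^+ 2 / b ^+ 2); first by rewrite ltr_pwDl.
move=> x x0; rewrite /sqn /= add0r sqrrN.
have e : (2 + 2 * (1 + a) ^+ 2 / b ^+ 2) * ((x - a) ^+ 2 + b ^+ 2) =
   2 * (x - a) ^+ 2 + 2 * b ^+ 2 + 2 * (1 + a) ^+ 2 / b ^+ 2 * (x - a) ^+ 2 + 2 * (1 + a) ^+ 2.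
  by field; exact: b0.
rewrite e.
have h1 : 0 <= 2 * (1 + a) ^+ 2 / b ^+ 2 * (x - a) ^+ 2.
  by rewrite mulr_ge0// sqr_ge0.
have := sqr_ge0 b; have := sqr_ge0 ((x - a) - (1 + a)); nra.
Qed.

Lemma sqn_eq0 (w : R[i]) : sqn w = 0 -> w = 0.
Proof.
move=> /eqP; rewrite /sqn paddr_eq0 ?sqr_ge0// !sqrf_eq0 => /andP[/eqP a /eqP b].
exact: complex_ext.
Qed.

Lemma sqnV (w : R[i]) : sqn w^-1 = (sqn w)^-1.
Proof.
have [->|w0] := eqVneq w 0; first by rewrite invr0 /sqn /= expr0n addr0 invr0.
have : sqn w != 0 by apply: contra_neq w0; exact: sqn_eq0.
move=> s0; apply: (mulfI s0); rewrite -sqnM divff// divff//.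
by rewrite /sqn /= expr1n expr0n addr0.
Qed.

Lemma rk_le : exists2 C : R, 0 < C & forall k, na (rk k) * (1 + nu (dual L k)) <= C.
Proof.
(* [y^2 <= 2 C] gives [y <= 1 + 2 C], which avoids a square root. *)
have [C C0 hC] := sqn_resolvent_lower; exists (1 + 2 * C); first by lra.
move=> k; set x := nu _; have x0 : 0 <= x by exact: nu_ge0.
have := hC _ x0; rewrite -/x => h.
have s0 : 0 < sqn (x%:C - z).
  rewrite -(pmulr_rgt0 _ C0); apply: lt_le_trans h; nra.
have h2 : (na (rk k) * (1 + x)) ^+ 2 <= 2 * C.
  rewrite exprMn; apply: (@le_trans _ _ (2 * sqn (rk k) * (1 + x) ^+ 2)).
    by rewrite ler_wpM2r ?sqr_ge0// na_le_sqn.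
  rewrite /rk sqnV -/x -mulrA ler_pM2l// mulrC ler_pdivrMr//.
have := na_ge0 (rk k); set y := na _ * _ in h2 *; nra.
Qed.

(** [epsilon] is informative only once a solution is known to exist; one does by Riesz-Fischer,
    because the factors [rk z k] are bounded. *)
Lemma resolv_spec (f : 'rV[R]_d -> R[i]) : sqint tmu (fun t => f (toV t)) ->
  sqint tmu (fun t => resolv L z f (toV t)) /\
  forall k, fc (fun t => resolv L z f (toV t)) k = rk k * fc (fun t => f (toV t)) k.
Proof.
move=> hf.
suff : is_res L z f (resolv L z f).
  move=> [/L2boxP hr hk]; split => // k.
  by rewrite -(hatper_fc _ hr) hk hatper_fc// mulrC.
rewrite /resolv; apply: epsilon_spec.
have [C C0 hC] := rk_le.
have [|g [hg gc]] := fourier_exists (c := fun k => (lam^-1)%:C * (rk k * fc (fun t => f (toV t)) k)).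
  apply: (@le_lt_trans _ _ (esum setT (fun k =>
    ((lam^-1) ^+ 2 * C ^+ 2)%:E * (sqn (fc (fun t => f (toV t)) k))%:E)%E)).
    apply: le_esum => k _; rewrite -EFinM lee_fin !sqnM -mulrA.
    apply: ler_pM; rewrite ?mulr_ge0 ?sqn_ge0//.
      by rewrite /sqn /= expr0n addr0.
    rewrite ler_wpM2r ?sqn_ge0//; apply: (le_trans (sqn_le_na _)).
    rewrite ler_pXn2r// ?nnegrE ?na_ge0 ?(ltW C0)//.
    apply: le_trans (hC k); rewrite ler_peMr ?na_ge0// lerDl nu_ge0//.
  rewrite esumZl ?bessel//; first by rewrite -EFinM ltry.
    by rewrite mulr_ge0// exprn_ge0// ?ltW// invr_gt0.
  by move=> k; rewrite lee_fin sqn_ge0.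
have e : (fun t => g (ofV (toV t))) = g by apply/funext => t; rewrite toVK.
exists (fun x => g (ofV x)); split; first by apply/L2boxP; rewrite e.
move=> k; rewrite !hatper_fc ?e// gc mulrA -rmorphM /= divff ?gt_eqF// mul1r mulrC.
by [].
Qed.

End Resolvent.

(** Parseval applied to [conjc V * ek p] and [g]: the conjugate of the coefficient of the first at
    [q] is the coefficient of [V] at [p - q]. *)
Lemma fc_mul (V g : X -> R[i]) (C : R) p : cmf V -> (forall t, na (V t) <= C) ->
  sqint tmu g ->
  [/\ sqint tmu (fun t => V t * g t),
      csummable (fun q => fc V (p - q) * fc g q) &
      fc (fun t => V t * g t) p = (lam^-1)%:C * csum (fun q => fc V (p - q) * fc g q)].
Proof.
move=> mV VC gs.
have Vs : sqint tmu V by exact: bounded_sqint VC.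
have hs : sqint tmu (fun t => conjc (V t) * ek p t).
  apply: (sqint_bM (C := C)); [exact: cmfJ|by move=> t; rewrite naJ|exact: sqint_ek].
have e q : conjc (fc (fun t => conjc (V t) * ek p t) q) = fc V (p - q).
  rewrite /fc /ip -cintegralJ; last by apply: ip_cintegrable => //; exact: sqint_ek.
  congr cintegral; apply/funext => t.
  by rewrite ekB !rmorphM /= !conjcK; ring.
have := csummable_fcM hs gs; under eq_fun do rewrite e; move=> cs.
split => //; first exact: (sqint_bM mV VC gs).
have := parseval_csum hs gs; under [in X in _ = X -> _]eq_fun do rewrite e.
move=> <-; rewrite /fc /ip; congr cintegral; apply/funext => t.
by rewrite rmorphM /= conjcK; ring.
Qed.

Lemma measurable_countable_fun (K : countType) d' (T : measurableType d') d'' (T' : measurableType d'')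
    (phi : T -> K) (h : K -> T') :
  (forall k, measurable [set t | phi t = k]) -> measurable_fun setT (fun t => h (phi t)).
Proof.
move=> mphi _ S mS; rewrite setTI.
rewrite (_ : _ @^-1` S = \bigcup_n (if @pickle_inv K n is Some k then
    (if `[< S (h k) >] then [set t | phi t = k] else set0) else set0)).
  apply: bigcupT_measurable => n; case: pickle_inv => [k|//].
  by case: ifP => _.
apply/seteqP; split => t /=.
  by move=> St; exists (pickle (phi t)) => //; rewrite pickleK_inv; case: ifPn => // /asboolPn.
by move=> [n _]; case: pickle_inv => // k; case: ifPn => // /asboolP Sk /= ->.
Qed.

(* [f] is the pointwise limit of its values at the points of [Z^d / n]. *)
Lemma measurable_continuous_rV (f : 'rV[R]_d -> R) : continuous f ->
  measurable_fun setT (fun t : X => f (toV t)).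
Proof.
move=> cf.
pose phi n (t : X) : 'rV[int]_d := \row_j Num.floor (n.+1%:R * tnth t j).
pose pt n (k : 'rV[int]_d) : 'rV[R]_d := \row_j ((k 0 j)%:~R / n.+1%:R).
apply: (@measurable_fun_cvg _ _ _ _ (fun n (t : X) => f (pt n (phi n t)))).
  move=> n; apply: (@measurable_countable_fun _ _ _ _ _ (phi n) (fun k => f (pt n k))) => k.
  rewrite (_ : [set t | _] = \bigcap_(j in [set: 'I_d])
     ((fun t : X => n.+1%:R * tnth t j) @^-1` `[(k 0 j)%:~R, (k 0 j + 1)%:~R[)).
    apply: fin_bigcap_measurable => // j _; rewrite -[_ @^-1` _]setTI.
    apply: (measurable_funM (measurable_cst _) (measurable_tnth j)) => //.
  apply/seteqP; split => t /=.
    move=> <- j _ /=; rewrite mxE in_itv /=.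
    exact: floor_itv.
  move=> h; apply/rowP => j; rewrite mxE; have := h j I; rewrite /= in_itv /= => hj.
  exact: floor_def.
move=> t _; apply: (continuous_cvg _ (cf (toV t))).
apply/cvg_ballP => e e0; near=> n; split=> // i j.
rewrite /ball /= !mxE.
have n0 : 0 < n.+1%:R :> R by rewrite ltr0n.
have /andP[h1 h2] : (Num.floor (n.+1%:R * tnth t j))%:~R <= n.+1%:R * tnth t j <
  (Num.floor (n.+1%:R * tnth t j) + 1)%:~R by exact: floor_itv.
have hn : n.+1%:R^-1 < e by near: n; exact: near_infty_natSinv_lt (PosNum e0).
have -> : tnth t j - (Num.floor (n.+1%:R * tnth t j))%:~R / n.+1%:R =
   (n.+1%:R * tnth t j - (Num.floor (n.+1%:R * tnth t j))%:~R) / n.+1%:R.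
  by field; rewrite gt_eqF.
rewrite ger0_norm ?divr_ge0 ?subr_ge0// ?(ltW n0)//.
apply: le_lt_trans hn; rewrite ler_pdivrMr// mulVf ?gt_eqF//.
by move: h2; rewrite intrD; lra.
Unshelve. all: by end_near.
Qed.

Section Potential.
Variables (B : 'rV[R]_d -> R) (CB : R).
Hypothesis Bc : continuous B.
Hypothesis Bb : forall x, `|B x| <= CB.

Definition bhat (k : 'rV[int]_d) : R[i] := fc (fun t => (per L B (toV t))%:C) k.

Let mB : measurable_fun setT (fun t : X => B (toV t)).
Proof. exact: measurable_continuous_rV. Qed.

Lemma per_shift (y : 'rV[R]_d) t : per L B (toV t - y) = B (toV (tshift (ofV (- y)) t)).
Proof.
rewrite -[toV t - y]ofVK per_toV; congr (B (toV _)).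
by apply: eq_from_tnth => j; rewrite tnth_tshift !tnth_mktuple !mxE.
Qed.

Lemma cmf_perB y : cmf (fun t : X => (per L B (toV t - y))%:C).
Proof.
apply: cmf_real; under eq_fun do rewrite per_shift.
exact: (measurableT_comp mB (measurable_tshift _)).
Qed.

(** By translation invariance of [tmu], moving the bump to [y] only costs a phase. *)
Lemma fc_perB y k : fc (fun t => (per L B (toV t - y))%:C) k = conjc (ek k (ofV y)) * bhat k.
Proof.
have e t : (per L B (toV t))%:C = (B (toV (twrap t)))%:C by rewrite per_toV.
have mG : cmf (fun t : X => conjc (ek k t) * (B (toV (twrap t)))%:C).
  apply: cmfM; first exact/cmfJ/cmf_ek.
  by apply: cmf_real; exact: (measurableT_comp mB measurable_twrap).
rewrite /bhat /fc /ip; under [in RHS]eq_fun do rewrite e.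
rewrite -(cintegral_tshift (ofV (- y)) mG) -cintegralZ.
  congr cintegral; apply/funext => t; rewrite per_shift.
  have eN : ek k (ofV (- y)) = conjc (ek k (ofV y)).
    rewrite /ek -expiN; congr expi; rewrite !ofVK /dotp -mulrN -sumrN.
    by congr (_ * _); apply: eq_bigr => j _; rewrite [(- y) 0 j]mxE mulrN.
  rewrite twrap_box ?boxb_tshift// ek_tshift eN.
  have := ek_conjM k (ofV y); move: (ek k t) (ek k _) (_%:C) => a b v ab.
  rewrite rmorphM /= conjcK.
  by rewrite -[LHS]mul1r -ab; ring.
apply: (@cintegrable_tshift (ofV (- y)) (fun t => conjc (ek k t) * (B (toV (twrap t)))%:C)); apply: (@finite_cintegrable _ _ _ _ _ (2 * CB)); [exact: tmu_fin|exact: mG|].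
move=> t; apply: (le_trans (naM _ _)); rewrite naJ na_real.
by apply: ler_pM; rewrite ?na_ge0 ?normr_ge0 ?na_ek.
Qed.

Lemma sqint_perB : sqint tmu (fun t => (per L B (toV t))%:C).
Proof.
have := cmf_perB 0; under eq_fun do rewrite subr0; move=> m.
by apply: (@bounded_sqint _ _ _ _ _ CB) => // t; rewrite na_real per_toV.
Qed.

Definition vw (p : 'rV[int]_d) (q : 'rV[R]_d * R) : R[i] := (q.2)%:C * conjc (ek p (ofV q.1)).

Lemma Vpot_fc (s : config R d) :
  [/\ cmf (fun t : X => (Vpot L B s (toV t))%:C),
   (exists C, forall t : X, na (Vpot L B s (toV t))%:C <= C) &
   forall k, fc (fun t => (Vpot L B s (toV t))%:C) k = (\sum_(q <- s) vw k q) * bhat k].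
Proof.
have e : (fun t : X => (Vpot L B s (toV t))%:C) =
    (fun t : X => \sum_(q <- s) (q.2)%:C * (per L B (toV t - q.1))%:C).
  by apply/funext => t; rewrite /Vpot rmorph_sum /=; apply: eq_bigr => q _; rewrite rmorphM.
have si q : sqint tmu (fun t => (per L B (toV t - q))%:C).
  apply: (@bounded_sqint _ _ _ _ _ CB) => [|t]; first exact: cmf_perB.
  by rewrite na_real per_shift.
split.
- rewrite e; apply: cmf_sum => q _; apply: cmfM; [exact: cmf_cst|exact: cmf_perB].
- exists (\sum_(q <- s) `|q.2| * CB) => t; rewrite (congr1 (fun f => f t) e).
  apply: (le_trans (na_sum _ _ _)); apply: ler_sum => q _.
  apply: (le_trans (naM _ _)); rewrite !na_real per_shift ler_wpM2l//.
move=> k; rewrite e /fc ip_sumr; last 2 first.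
- exact: sqint_ek.
- by move=> q _; exact: sqintZ.
rewrite mulr_suml; apply: eq_bigr => q _.
rewrite (ipZr _ (sqint_ek k) (si q.1)).
by rewrite -/(fc _ _) fc_perB mulrA.
Qed.

End Potential.

(** * Decay of the Fourier coefficients of the potential *)

(** Tonelli for a product integrand. [phi] and [c] are indexed by [nat], which lets the induction on
    [m] shift them. *)
Lemma integral_pw_prod_le d' (T : measurableType d') (P : {finite_measure set T -> \bar R}) m
    (phi : nat -> T -> R) (c : nat -> R) :
  (forall i, measurable_fun setT (phi i)) -> (forall i u, 0 <= phi i u) -> (forall i, 0 <= c i) ->
  (forall i, (\int[P]_u (phi i u)%:E <= (c i)%:E)%E) ->
  (\int[pw P m]_t (\prod_(i < m) phi i (tnth t i))%:E <= (\prod_(i < m) c i)%:E)%E.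
Proof.
move=> + + + ; elim: m phi c => [|m IH] phi c mphi phi0 c0 hc.
  rewrite integral_pw0 ?big_ord0//.
  by under eq_fun do rewrite big_ord0; exact: measurable_cst.
have mp n (ph : nat -> T -> R) : (forall i, measurable_fun setT (ph i)) ->
    measurable_fun setT (fun t : n.-tuple T => (\prod_(i < n) ph i (tnth t i))%:E).
  move=> mph; apply/measurable_EFinP; apply: measurable_prod => i _.
  exact: (measurableT_comp (mph i) (measurable_tnth i)).
rewrite integral_pwS; [|exact: mp|by move=> t; rewrite lee_fin prodr_ge0].
rewrite (eq_integral (fun u => (phi 0%N u)%:E *
   \int[pw P m]_t (\prod_(i < m) phi i.+1 (tnth t i))%:E)%E); last first.
  move=> u _; rewrite -ge0_integralZl//; [|exact: (mp _ (fun i => phi i.+1))|by move=> t _; rewrite lee_fin prodr_ge0|by rewrite lee_fin].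
  apply: eq_integral => t _; rewrite -EFinM big_ord_recl; congr (_ * _)%:E.
  by apply: eq_bigr => i _; rewrite tnthS.
rewrite ge0_integralZr//; last 3 first.
- by apply/measurable_EFinP.
- by move=> u _; rewrite lee_fin.
- by apply: integral_ge0 => t _; rewrite lee_fin prodr_ge0.
rewrite big_ord_recl EFinM; apply: lee_pmul => //.
- by apply: integral_ge0 => t _; rewrite lee_fin.
- by apply: integral_ge0 => t _; rewrite lee_fin prodr_ge0.
- exact: (IH (fun i => phi i.+1) (fun i => c i.+1)).
Qed.

(* Bound for the effect of the periodic shift by [s]: the shift itself, except
   where it wraps around the box, an event of measure [|s|]. *)
Definition wrap_cost (s u : R) : R := if (u + s) \in box1 L then `|s| else 1.

Lemma wrap_cost_ge0 s u : 0 <= wrap_cost s u.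
Proof. by rewrite /wrap_cost; case: ifP. Qed.

Lemma wrap_cost_dist s u : `|u - wrap1 L (u + s)| <= wrap_cost s u \/ 1 <= wrap_cost s u.
Proof.
rewrite /wrap_cost; case: ifPn => h; last by right.
by left; rewrite wrap1_box// opprD addNKr normrN.
Qed.

Let mbox s : measurable [set u : R | u + s \in box1 L].
Proof.
have : measurable_fun setT (fun u : R => u + s).
  by apply: measurable_funD => //; exact: measurable_cst.
move=> /(_ measurableT _ (measurable_box1 L)); rewrite setTI.
by congr measurable; apply/seteqP; split => u /=; rewrite in_setE.
Qed.

Let inbox s u : (u \in [set v : R | v + s \in box1 L]) = (u + s \in box1 L).
Proof. by apply/idP/idP; rewrite inE. Qed.

Lemma measurable_wrap_cost s : measurable_fun setT (wrap_cost s).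
Proof.
rewrite (_ : wrap_cost s = fun u => `|s| * \1_[set v : R | v + s \in box1 L] u +
    \1_(~` [set v : R | v + s \in box1 L]) u); last first.
  apply/funext => u; rewrite !indicE in_setC inbox /wrap_cost.
  by case: ifP => _ /=; rewrite ?mulr1 ?mulr0 ?addr0 ?add0r.
apply: measurable_funD; last by apply: measurable_indic; apply: measurableC; exact: mbox.
by apply: measurable_funM; [exact: measurable_cst|apply: measurable_indic; exact: mbox].
Qed.

(** [L |s|] comes from the value [|s|] on a box of length [L], and another [|s|] from the wrapping
    points, which lie in an interval of that length at one end. *)
Lemma integral_wrap_cost s : (\int[mu1 hL]_u (wrap_cost s u)%:E <= ((L + 1) * `|s|)%:E)%E.
Proof.
pose A := ~` [set u : R | u + s \in box1 L].
have mA : measurable A by apply: measurableC; exact: mbox.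
apply: (@le_trans _ _ (\int[mu1 hL]_u ((`|s|)%:E + (\1_A u)%:E))%E).
  apply: ge0_le_integral => //.
  - by move=> u _; rewrite lee_fin wrap_cost_ge0.
  - by apply/measurable_EFinP; exact: measurable_wrap_cost.
  - by apply/measurable_EFinP; apply: measurable_funD; [exact: measurable_cst|exact: measurable_indic].
  - move=> u _; rewrite -EFinD lee_fin indicE in_setC inbox /wrap_cost.
    by case: ifP => _; rewrite /= ?addr0// lerDr.
rewrite ge0_integralD//; last by apply/measurable_EFinP; exact: measurable_indic.
rewrite integral_cst// integral_indic// setIT mulrDl mul1r EFinD.
apply: leeD; first by rewrite [X in (_ * X <= _)%E](mu1_setT hL) -EFinM mulrC.
rewrite [X in (X <= _)%E](mu1E hL A).
(* The sign of [s] decides at which end of the box the points leave it. *)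
have [s0|s0] := leP 0 s.
  apply: (@le_trans _ _ (lebesgue_measure `[L / 2 - s, L / 2[%classic)).
    apply: le_measure; rewrite ?inE//; first by apply: measurableI => //; exact: measurable_box1.
    move=> u [h] /mem_set; rewrite box1P => /andP[h1 h2].
    rewrite /= in_itv /= h2 andbT leNgt; apply/negP => h3; apply: h.
    by rewrite /= box1P; lra.
  rewrite lebesgue_measure_itv/= lte_fin; case: ifP => _; last by rewrite lee_fin.
  by rewrite -EFinD lee_fin ger0_norm//; lra.
apply: (@le_trans _ _ (lebesgue_measure `[- (L / 2), - (L / 2) - s[%classic)).
  apply: le_measure; rewrite ?inE//; first by apply: measurableI => //; exact: measurable_box1.
  move=> u [h] /mem_set; rewrite box1P => /andP[h1 h2].
  rewrite /= in_itv /= h1 /= ltNge; apply/negP => h3; apply: h.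
  by rewrite /= box1P; lra.
rewrite lebesgue_measure_itv/= lte_fin; case: ifP => _; last by rewrite lee_fin.
by rewrite -EFinD lee_fin ltr0_norm//; lra.
Qed.

Section Decay.
Variable k : 'rV[int]_d.

(* A shift by half a period of the [j]-th oscillation flips the sign of [ek k]. *)
Definition half_step (j : 'I_d) : R := L / (2 * (k 0 j)%:~R).
Definition half_shift (j : 'I_d) : X := [tuple if i == j then half_step j else 0 | i < d].
Definition half_psi (j : 'I_d) (u : R) : R := wrap1 L (u + half_step j).

Lemma ek_half_shift j : k 0 j != 0 -> ek k (half_shift j) = -1.
Proof.
move=> kj; rewrite /ek dotp_dual (bigD1 j)//= big1 ?addr0; last first.
  by move=> i /negbTE ij; rewrite tnth_mktuple ij mulr0.
rewrite tnth_mktuple eqxx /half_step -expi_pi; congr expi.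
have k0 : (k 0 j)%:~R != 0 :> R by rewrite intr_eq0.
by field; rewrite k0 gt_eqF.
Qed.

Lemma setc_tshift (j : 'I_d) t : boxb L (toV t) ->
  setc (toV t) j (half_psi j (toV t 0 j)) = toV (tshift (half_shift j) t).
Proof.
rewrite inboxE => /forallP bt; apply/rowP => i; rewrite setcE [RHS]mxE tnth_tshift tnth_mktuple.
case: eqP => [->|_]; first by rewrite /half_psi mxE.
by rewrite addr0 wrap1_box// mxE.
Qed.

Lemma mdiff_bounded (J : seq 'I_d) (psi : 'I_d -> R -> R) (F : 'rV[R]_d -> R) C :
  (forall x, `|F x| <= C) -> forall x, `|mdiff psi J F x| <= 2 ^+ size J * C.
Proof.
move=> FC; elim: J => [|j J IH] x /=; first by rewrite mul1r.
apply: (le_trans (ler_normB _ _)); rewrite exprS -mulrA mulr_natl mulr2n.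
exact: lerD.
Qed.

Lemma measurable_mdiff (J : seq 'I_d) (F : 'rV[R]_d -> R) :
  measurable_fun setT (fun t : X => F (toV t)) ->
  measurable_fun setT (fun t : X => mdiff half_psi J F (toV t)).
Proof.
move=> mF; elim: J => [//|j J IH] /=.
apply: measurable_funB => //.
apply: (measurable_rV_comp (g := mdiff half_psi J F) (phi := fun t : X => setc (toV t) j (half_psi j (toV t 0 j)))) => // i.
under eq_fun do rewrite setcE.
case: eqP => _; last by under eq_fun do rewrite mxE; exact: measurable_tnth.
rewrite /half_psi; under eq_fun do rewrite mxE.
have h := measurableT_comp (measurable_shift1 hL (half_step j)) (@measurable_tnth _ R d j).
exact: h.
Qed.

(** Under the half-period shift the character changes sign, so each difference doubles the
    integral. *)
Lemma cintegral_mdiff (J : seq 'I_d) (F : 'rV[R]_d -> R) C :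
  measurable_fun setT (fun t : X => F (toV t)) -> (forall x, `|F x| <= C) ->
  (forall j, j \in J -> k 0 j != 0) ->
  cintegral tmu (fun t => conjc (ek k t) * (mdiff half_psi J F (toV t))%:C) =
  2 ^+ size J * cintegral tmu (fun t => conjc (ek k t) * (F (toV t))%:C).
Proof.
move=> mF FC; elim: J => [|j J IH] hJ; first by rewrite mul1r.
have {}IH := IH (fun i iJ => hJ i (mem_behead (s := j :: J) iJ)).
pose M := mdiff half_psi J F.
have mM : measurable_fun setT (fun t : X => M (toV t)) by exact: measurable_mdiff.
have MC x : `|M x| <= 2 ^+ size J * C by exact: mdiff_bounded.
have mphi (psi : 'rV[R]_d -> R) : measurable_fun setT (fun t : X => psi (toV t)) ->
    cmf (fun t : X => conjc (ek k t) * (psi (toV t))%:C).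
  by move=> mp; apply: cmfM; [exact/cmfJ/cmf_ek|exact: cmf_real].
have iM : cintegrable tmu (fun t => conjc (ek k t) * (M (toV t))%:C).
  apply: (@finite_cintegrable _ _ _ _ _ (2 * (2 ^+ size J * C))); [exact: tmu_fin|exact: mphi|].
  move=> t; apply: (le_trans (naM _ _)); rewrite naJ na_real.
  by apply: ler_pM; rewrite ?na_ge0 ?normr_ge0 ?na_ek.
pose N x := M (setc x j (half_psi j (x 0 j))).
have mN : measurable_fun setT (fun t : X => N (toV t)).
  have mB := measurable_mdiff (j :: J) mF.
  rewrite (_ : (fun t => _) = fun t : X => M (toV t) - mdiff half_psi (j :: J) F (toV t)).
    exact: measurable_funB.
  by apply/funext => t /=; rewrite opprB addrC subrK.
have iN : cintegrable tmu (fun t => conjc (ek k t) * (N (toV t))%:C).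
  apply: (@finite_cintegrable _ _ _ _ _ (2 * (2 ^+ size J * C))); [exact: tmu_fin|exact: mphi|].
  move=> t; apply: (le_trans (naM _ _)); rewrite naJ na_real /N.
  by apply: ler_pM; rewrite ?na_ge0 ?normr_ge0 ?na_ek.
have eN : cintegral tmu (fun t => conjc (ek k t) * (N (toV t))%:C) =
    - cintegral tmu (fun t => conjc (ek k t) * (M (toV t))%:C).
  rewrite -(cintegral_tshift (half_shift j) (mphi M mM)) -cintegralN; last first.
    exact: (cintegrable_tshift (half_shift j) iM).
  apply: eq_box_cintegral; first exact: mphi.
    by apply: cmfN; exact: (cmf_tshift (half_shift j) (mphi M mM)).
  move=> t bt; rewrite /N setc_tshift// ek_tshift ek_half_shift; last first.
    by apply: hJ; rewrite inE eqxx.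
  by rewrite mulrN1 rmorphN /= mulNr opprK.
rewrite (_ : (fun t => _) = fun t => conjc (ek k t) * (M (toV t))%:C - conjc (ek k t) * (N (toV t))%:C).
  by rewrite cintegralB// eN opprK IH exprS; ring.
by apply/funext => t; rewrite -mulrBr -rmorphB.
Qed.

End Decay.

(** Differencing by half a period in every coordinate with [k_j != 0] only enlarges the coefficient,
    while the mixed difference of [B] is bounded by a product of wrap costs, whose integrals are of
    order [1 / |k_j|]. *)
Lemma bhat_decay (B : 'rV[R]_d -> R) :
  (forall vs x v, derivable (dder vs B) x v) ->
  (forall vs, exists C, forall x, `|dder vs B x| <= C) ->
  measurable_fun setT (fun t : X => B (toV t)) ->
  exists2 C, 0 <= C & forall k, na (bhat B k) <= C * \prod_j (1 + (absz (k 0 j))%:R)^-1.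
Proof.
move=> dB bB mB.
(* The constant has to precede [k]. It depends only on the set of coordinates with nonzero
   frequency, and the sum over all such sets bounds it uniformly. *)
have hJ (S : {set 'I_d}) : exists C : R, 0 <= C /\ forall (psi phi : 'I_d -> R -> R),
    (forall j u, 0 <= phi j u /\ (`|u - psi j u| <= phi j u \/ 1 <= phi j u)) ->
    forall x, `|mdiff psi (enum S) B x| <= C * \prod_(j <- enum S) phi j (x 0 j).
  by have [C C0 h] := @mdiff_bound R d B (enum S) [::] (enum_uniq _) dB bB; exists C.
have [Cf hCf] := boolp.choice hJ.
have [CB hCB] := bB [::]; rewrite /= in hCB.
pose D := \sum_(S : {set 'I_d}) Cf S.
have D0 : 0 <= D by apply: sumr_ge0 => S _; have [] := hCf S.
exists (2 * D * ((L + 1) ^+ 2) ^+ d).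
  by rewrite !mulr_ge0// !exprn_ge0// addr_ge0// ltW.
move=> k.
pose S := [set j : 'I_d | k 0 j != 0]%SET.
pose phi (j : 'I_d) (u : R) : R := wrap_cost (half_step k j) u.
have [C0 hC] := hCf S.
have CD : Cf S <= D.
  by rewrite /D (bigD1 S)//= lerDl sumr_ge0// => T _; have [] := hCf T.
have hphi j u : 0 <= phi j u /\ (`|u - half_psi k j u| <= phi j u \/ 1 <= phi j u).
  by split; [exact: wrap_cost_ge0|exact: wrap_cost_dist].
have bd := hC (half_psi k) phi hphi.
pose ph (i : nat) (u : R) : R := if insub i is Some j then (if j \in S then phi j u else 1) else 1.
(* [(L + 1)^2 / (1 + |k_j|)] covers both [(L + 1) L / (2 |k_j|)] for [k_j != 0] and the length [L]
   of the box for [k_j = 0]. Beyond the last coordinate [ph] is 1, with integral [L]. *)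
pose c (i : nat) : R := if insub i is Some j then (L + 1) ^+ 2 * (1 + (absz (k 0 (j : 'I_d)))%:R)^-1 else L.
have L1 : 1 <= L + 1 by rewrite lerDr ltW.
have phj (j : 'I_d) u : ph j u = if j \in S then phi j u else 1 by rewrite /ph valK.
have intph : (\int[tmu]_t (\prod_(i < d) ph i (tnth t i))%:E <= (\prod_(i < d) c i)%:E)%E.
  apply: integral_pw_prod_le.
  - move=> i; rewrite /ph; case: insub => [j|]; last exact: measurable_cst.
    by case: (j \in S); [exact: measurable_wrap_cost|exact: measurable_cst].
  - by move=> i u; rewrite /ph; case: insub => // j; case: (j \in S) => //; exact: wrap_cost_ge0.
  - move=> i; rewrite /c; case: insub => [j|]; last exact: ltW.
    by rewrite mulr_ge0 ?sqr_ge0// invr_ge0 addr_ge0.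
  - move=> i; rewrite /ph /c; case: insub => [j|]; last first.
      by rewrite integral_cst// mul1e [X in (X <= _)%E](mu1_setT hL).
    rewrite inE; case: (eqVneq (k 0 j) 0) => [kj|kj] /=.
      have a0 : (absz (k 0 j))%:R = 0 :> R by rewrite kj.
      rewrite integral_cst// mul1e [X in (X <= _)%E](mu1_setT hL) lee_fin a0 addr0 invr1 mulr1.
      by rewrite expr2; have := hL; nra.
    apply: le_trans (integral_wrap_cost _) _; rewrite lee_fin.
    rewrite expr2 -mulrA ler_wpM2l ?(le_trans ler01 L1)//.
    have m1 : 1 <= (absz (k 0 j))%:R :> R by rewrite ler1n absz_gt0.
    have -> : `|half_step k j| = L / (2 * (absz (k 0 j))%:R).
      rewrite /half_step normrM (gtr0_norm hL) normfV normrM (ger0_norm (ler0n _ 2)).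
      by rewrite natr_absz intr_norm.
    move: m1; move: (_%:R) => m m1.
    apply: (@le_trans _ _ (L / (1 + m))).
      by rewrite ler_pM2l// lef_pV2 ?posrE; lra.
    by rewrite ler_wpM2r ?invr_ge0 ?lerDl//; lra.
have e1 : bhat B k = cintegral tmu (fun t => conjc (ek k t) * (B (toV t))%:C).
  rewrite /bhat /fc /ip; apply: eq_box_cintegral.
  - apply: cmfM; [exact/cmfJ/cmf_ek|apply: cmf_real].
    under eq_fun do rewrite per_toV.
    exact: (measurableT_comp mB measurable_twrap).
  - by apply: cmfM; [exact/cmfJ/cmf_ek|exact: cmf_real].
  - by move=> t bt; rewrite per_box.
have hS j : j \in enum S -> k 0 j != 0 by rewrite mem_enum inE.
have := cintegral_mdiff mB hCB hS; rewrite -e1.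
set z := cintegral _ _ => zE.
have mM : cmf (fun t : X => conjc (ek k t) * (mdiff (half_psi k) (enum S) B (toV t))%:C).
  by apply: cmfM; [exact/cmfJ/cmf_ek|apply: cmf_real; exact: measurable_mdiff].
have iM : cintegrable tmu (fun t : X => conjc (ek k t) * (mdiff (half_psi k) (enum S) B (toV t))%:C).
  apply: (@finite_cintegrable _ _ _ _ _ (2 * (2 ^+ size (enum S) * CB))); [exact: tmu_fin|exact: mM|].
  move=> t; apply: (le_trans (naM _ _)); rewrite naJ na_real.
  by apply: ler_pM; rewrite ?na_ge0 ?normr_ge0 ?na_ek// mdiff_bounded.
have zb : na (bhat B k) <= na z.
  have -> : bhat B k = (2 ^- size (enum S))%:C * z.
    rewrite zE mulrA [X in _ = X * _](_ : _ = 1) ?mul1r//.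
    have -> : (2 : R[i]) ^+ size (enum S) = ((2 : R) ^+ size (enum S))%:C.
      by rewrite [RHS]rmorphXn; congr (_ ^+ _); rewrite /= rmorph_nat.
    rewrite -[LHS](rmorphM (real_complex R)) /= mulVf//.
  apply: (le_trans (naM _ _)); rewrite na_real ler_piMl ?na_ge0// ger0_norm ?invr_ge0 ?exprn_ge0//.
  by rewrite invf_le1 ?exprn_gt0// exprn_ege1// ler1n.
apply: (le_trans zb); rewrite -lee_fin; apply: (le_trans (na_cintegral iM)).
have mph : measurable_fun setT (fun t : X => (\prod_(i < d) ph i (tnth t i))%:E).
  apply/measurable_EFinP; apply: measurable_prod => i _.
  have mphi : measurable_fun setT (ph i).
    rewrite /ph; case: insub => [j|]; last exact: measurable_cst.
    by case: (j \in S); [exact: measurable_wrap_cost|exact: measurable_cst].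
  have h := measurableT_comp mphi (@measurable_tnth _ R d i); exact: h.
have ph0 (t : X) : 0 <= \prod_(i < d) ph i (tnth t i).
  apply: prodr_ge0 => i _; rewrite phj; case: (i \in S) => //; exact: wrap_cost_ge0.
apply: (@le_trans _ _ (\int[tmu]_t ((2 * D)%:E * (\prod_(i < d) ph i (tnth t i))%:E))%E).
  apply: ge0_le_integral => //.
  - by move=> t _; rewrite lee_fin na_ge0.
  - by apply/measurable_EFinP; exact: measurable_na.
  - exact: measurable_funeM.
  - move=> t _; rewrite -EFinM lee_fin; apply: (le_trans (naM _ _)); rewrite naJ na_real.
    rewrite -mulrA; apply: ler_pM; rewrite ?na_ge0 ?normr_ge0 ?na_ek//.
    apply: (le_trans (bd (toV t))).
    rewrite (_ : \prod_(j <- enum S) _ = \prod_(i < d) ph i (tnth t i)).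
      by rewrite ler_wpM2r.
    rewrite big_enum /= [LHS]big_mkcond; apply: eq_bigr => j _.
    by rewrite phj [toV t 0 j]mxE.
rewrite ge0_integralZl//; last 2 first.
- by move=> t _; rewrite lee_fin.
- by rewrite lee_fin mulr_ge0.
apply: (@le_trans _ _ ((2 * D)%:E * (\prod_(i < d) c i)%:E)%E).
  by apply: lee_wpmul2l => //; rewrite lee_fin mulr_ge0.
rewrite -EFinM lee_fin -[X in _ <= X]mulrA ler_wpM2l ?mulr_ge0//.
rewrite le_eqVlt; apply/orP; left; apply/eqP.
have -> : ((L + 1) ^+ 2) ^+ d = \prod_(i < d) (L + 1) ^+ 2 by rewrite prodr_const card_ord.
by rewrite -big_split; apply: eq_bigr => j _; rewrite /c valK.
Qed.

(** * Random configurations *)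

Section Configurations.
Variable mu : probability R R.

Local Notation Y := (R * X)%type.

Lemma vol_inv_ge0 : 0 <= lam^-1.
Proof. by rewrite invr_ge0 ltW// vol_gt0. Qed.

Definition vol_inv : {nonneg R} := NngNum vol_inv_ge0.

(* The joint law of one pair [(v_gamma, y_gamma)]. *)
Definition kap : set Y -> \bar R := mscale vol_inv (mu \x tmu)%E.

HB.instance Definition _ := Measure.on kap.

Lemma kap_setT : kap setT = 1%E.
Proof.
rewrite /kap /mscale /= -setXTT product_measure1E//.
rewrite [X in (_ * (X * _))%E](probability_setT mu) mul1e [X in (_ * X)%E]tmu_setT.
by rewrite -EFinM mulVf// gt_eqF// vol_gt0.
Qed.

Let kap_fin : fin_num_fun kap.
Proof.
move=> A mA; rewrite ge0_fin_numE//.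
apply: (@le_lt_trans _ _ (kap setT)); first by apply: le_measure => //; rewrite inE.
by rewrite kap_setT ltry.
Qed.

HB.instance Definition _ := Measure_isFinite.Build _ _ _ kap kap_fin.

Lemma integral_kap (f : Y -> \bar R) : measurable_fun setT f -> (forall q, 0 <= f q)%E ->
  (\int[kap]_q f q = \int[mu]_v ((lam^-1)%:E * \int[tmu]_u f (v, u)))%E.
Proof.
move=> mf f0; rewrite ge0_integral_mscale//= fubini_tonelli1//.
rewrite ge0_integralZl//.
- exact: measurable_fun_fubini_tonelli_F.
- by move=> v _; apply: integral_ge0.
- by rewrite lee_fin vol_inv_ge0.
Qed.

Definition conf (t : seq Y) : config R d := [seq (toV q.2, q.1) | q <- t].

(** [sint] draws one pair at a time, [v] outside [y], which matches the order of the factors of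
    [kap]. Measurability is asked at every length because the recursion prepends a pair. *)
Lemma sint_pw m (F : config R d -> \bar R) : (forall s, 0 <= F s)%E ->
  (forall m, measurable_fun setT (fun t : m.-tuple Y => F (conf t))) ->
  sint L mu m F = (\int[pw kap m]_t F (conf t))%E.
Proof.
elim: m F => [|m IH] F F0 mF; first by rewrite (integral_pw0 kap (mF 0%N)).
have mF2 v y k : measurable_fun setT (fun t : k.-tuple Y => F ((toV y, v) :: conf t)).
  exact: (measurableT_comp (mF k.+1) (measurable_tcons2 (v, y))).
rewrite [sint _ _ _ _]/= (integral_pwS kap (mF m.+1))//.
have mI : measurable_fun setT (fun q : Y => \int[pw kap m]_t F (conf (tcons (q, t))))%E.
  exact: (@measurable_pw_tcons _ _ _ kap m (fun t => F (conf t))).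
have I0 q : (0 <= \int[pw kap m]_t F (conf (tcons (q, t))))%E by apply: integral_ge0.
rewrite (integral_kap mI I0).
apply: eq_integral => v _.
have sE y : sint L mu m (fun s => F ((y, v) :: s)) = (\int[pw kap m]_t F (conf (tcons ((v, ofV y), t))))%E.
  rewrite IH//; first by apply: eq_integral => t _; rewrite /conf /= ofVK.
  by move=> k; have := mF2 v (ofV y) k; rewrite ofVK.
have mg : measurable_fun setT (fun u : X => \int[pw kap m]_t F (conf (tcons ((v, u), t))))%E.
  exact: (measurableT_comp mI (measurable_pair1 v)).
rewrite (nnint_box (g := fun y => ((lam^-1)%:E * sint L mu m (fun s => F ((y, v) :: s)))%E)).
- under eq_integral do rewrite sE toVK.
  by rewrite ge0_integralZl// lee_fin vol_inv_ge0.
- apply: measurable_if_box; last exact: measurable_cst.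
  under eq_fun do rewrite sE toVK.
  exact: measurable_funeM.
- under eq_fun do rewrite sE toVK.
  exact: measurable_funeM.
- by move=> x; case: ifP => // _; rewrite sE mule_ge0// lee_fin vol_inv_ge0.
- by move=> x; rewrite sE mule_ge0// lee_fin vol_inv_ge0.
- by move=> x /negbTE ->.
- by move=> x ->.
Qed.

(** [rE] splits [F] by sign before averaging over the configuration, while [csum] splits the
    averages at fixed [m]; by [esum_posB] the results agree. *)
Lemma rE_pw (F : config R d -> R) (G : seq Y -> R) :
  poisson_dom kap lam G ->
  (forall m, measurable_fun setT (fun t : m.-tuple Y => F (conf t))) ->
  (forall t, `|F (conf t)| <= G t) ->
  rE L mu F =
  fine (esum setT (fun m => (Num.max (poisson_w lam m * Rintegral (pw kap m) setT (fun t => F (conf t))) 0)%:E)) -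
  fine (esum setT (fun m => (Num.max (- (poisson_w lam m * Rintegral (pw kap m) setT (fun t => F (conf t)))) 0)%:E)).
Proof.
move=> [G0 Gi Gs] mF FG.
have w0 m := poisson_w_ge0 vol_gt0 m.
have m0 (x : R) : 0 <= Num.max x 0 by rewrite le_max lexx orbT.
have fi m : (pw kap m).-integrable setT (fun t => (F (conf t))%:E).
  apply: (le_integrable measurableT _ _ (Gi m)) => [|t _]; first by apply/measurable_EFinP; exact: mF.
  by rewrite /= lee_fin (le_trans (FG t)) ?ler_norm.
have maxG (h : R -> R) t : (forall x, `|h x| = `|x|) -> Num.max (h (F (conf t))) 0 <= G t.
  by move=> hx; rewrite ge_max G0 andbT (le_trans (ler_norm _))// hx.
(* Used with [h] the identity and the negation, for the positive and the negative part of [F]. *)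
have part (h : R -> R) : (forall x, `|h x| = `|x|) -> measurable_fun setT h ->
  [/\ nnE L mu (fun s => (Num.max (h (F s)) 0)%:E) =
      esum setT (fun m => (poisson_w lam m * Rintegral (pw kap m) setT (fun t => Num.max (h (F (conf t))) 0))%:E),
      (nnE L mu (fun s => (Num.max (h (F s)) 0)%:E) \is a fin_num)%E &
      forall m, (pw kap m).-integrable setT (fun t => (Num.max (h (F (conf t))) 0)%:E)].
  move=> hx mh.
  have mm m : measurable_fun setT (fun t : m.-tuple Y => Num.max (h (F (conf t))) 0).
    apply: measurable_maxr; last exact: measurable_cst.
    exact: (measurableT_comp mh (mF m)).
  have ii m : (pw kap m).-integrable setT (fun t => (Num.max (h (F (conf t))) 0)%:E).
    apply: (le_integrable measurableT _ _ (Gi m)) => [|t _]; first by apply/measurable_EFinP; exact: mm.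
    by rewrite /= lee_fin ger0_norm// (le_trans (maxG _ _ hx))// ler_norm.
  have e : nnE L mu (fun s => (Num.max (h (F s)) 0)%:E) =
      esum setT (fun m => (poisson_w lam m * Rintegral (pw kap m) setT (fun t => Num.max (h (F (conf t))) 0))%:E).
    rewrite /nnE esum_enum; last first.
      by move=> m; rewrite lee_fin mulr_ge0// fine_ge0// integral_ge0// => t _; rewrite lee_fin.
    apply: eq_eseriesr => m _; rewrite enum_ext_nat sint_pw//; last 2 first.
    - by move=> s; rewrite lee_fin.
    - by move=> k; apply/measurable_EFinP; exact: mm.
    rewrite [RHS]EFinM /Rintegral fineK//; exact: (integrable_fin_num measurableT (ii m)).
  split=> //.
  rewrite e ge0_fin_numE; last first.
    by apply: esum_ge0 => m _; rewrite lee_fin mulr_ge0// fine_ge0// integral_ge0// => t _; rewrite lee_fin.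
  apply: le_lt_trans Gs; apply: le_esum => m _.
  rewrite EFinM /Rintegral fineK; last exact: (integrable_fin_num measurableT (ii m)).
  apply: lee_wpmul2l; first by rewrite lee_fin.
  apply: ge0_le_integral => //.
  - by move=> t _; rewrite lee_fin.
  - by apply/measurable_EFinP; exact: mm.
  - by have /integrableP[] := Gi m.
  - by move=> t _; rewrite lee_fin maxG.
have [e1 f1 i1] := part id (fun=> erefl) (@measurable_id _ _ _).
have [e2 f2 i2] := part -%R (@normrN _ _) (@oppr_measurable _ _).
rewrite /rE e1 e2 -esum_posB.
- have eF m : Rintegral (pw kap m) setT (fun t => F (conf t)) =
     Rintegral (pw kap m) setT (fun t => Num.max (F (conf t)) 0) -
     Rintegral (pw kap m) setT (fun t => Num.max (- F (conf t)) 0).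
    rewrite -RintegralB//; by apply: eq_Rintegral => t _; rewrite posnegE.
  by congr (fine _ - fine _); apply: eq_esum => m _; rewrite eF mulrBr.
- by move=> m; rewrite mulr_ge0// fine_ge0// integral_ge0// => t _; rewrite lee_fin.
- by move=> m; rewrite mulr_ge0// fine_ge0// integral_ge0// => t _; rewrite lee_fin.
- by rewrite -e1.
- by rewrite -e2.
Qed.

Lemma cE_poisson (F : config R d -> R[i]) (G : seq Y -> R) :
  poisson_dom kap lam G ->
  (forall m, cmf (fun t : m.-tuple Y => F (conf t))) ->
  (forall t, na (F (conf t)) <= G t) ->
  cE L mu F = poisson_E kap lam (fun t => F (conf t)).
Proof.
move=> dG mF FG; rewrite /cE /poisson_E /csum.
rewrite (rE_pw dG (fun m => (mF m).1)); last by move=> t; exact: le_trans (na_Re _) (FG t).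
rewrite (rE_pw dG (fun m => (mF m).2)); last by move=> t; exact: le_trans (na_Im _) (FG t).
by congr (_ +i* _); congr (fine _ - fine _); apply: eq_esum => m _; rewrite ?Re_realM ?Im_realM.
Qed.

Hypothesis hmom : forall k : nat, mu.-integrable setT (fun x : R => (x ^+ k)%:E).

Definition vy (p : 'rV[int]_d) (y : Y) : R[i] := (y.1)%:C * conjc (ek p y.2).

Lemma vw_conf p (t : seq Y) : \sum_(q <- conf t) vw p q = \sum_(y <- t) vy p y.
Proof. by rewrite big_map; apply: eq_bigr => y _; rewrite /vw /vy toVK. Qed.

Lemma cmf_vy p : cmf (vy p).
Proof.
apply: cmfM; first by apply: cmf_real; exact: measurable_fst.
apply: cmfJ; have [h1 h2] := cmf_ek p.
by split; [exact: (measurableT_comp h1 measurable_snd)|exact: (measurableT_comp h2 measurable_snd)].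
Qed.

(** The factor 2 is the bound of [na] on characters. *)
Definition absv (y : Y) : R := 2 * `|y.1|.

Lemma na_vy p y : na (vy p y) <= absv y.
Proof.
apply: (le_trans (naM _ _)); rewrite naJ na_real /absv mulrC.
by rewrite ler_wpM2r// na_ek.
Qed.

Lemma absv_integrable k : kap.-integrable setT (fun y => (absv y ^+ k)%:E).
Proof.
have ma : measurable_fun setT absv.
  apply: measurable_funM; first exact: measurable_cst.
  exact: (measurableT_comp (@normr_measurable _ _) measurable_fst).
apply/integrableP; split; first by apply/measurable_EFinP; exact: measurable_funX.
have a0 y : 0 <= absv y by rewrite mulr_ge0.
rewrite (eq_integral (fun y => (absv y ^+ k)%:E)); last first.
  by move=> y _; rewrite /= ger0_norm// exprn_ge0.
rewrite integral_kap; last 2 first.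
- by apply/measurable_EFinP; exact: measurable_funX.
- by move=> q; rewrite lee_fin exprn_ge0.
rewrite (eq_integral (fun v : R => (2 ^+ k)%:E * (`|v ^+ k|)%:E)%E); last first.
  move=> v _; rewrite /absv /= integral_cst// [X in (_ * (_ * X))%E]tmu_setT muleCA -!EFinM mulVf ?gt_eqF ?vol_gt0// mulr1.
  by rewrite exprMn EFinM normrX.
rewrite ge0_integralZl//; last first.
  by apply/measurable_EFinP; apply: measurableT_comp => //; have /integrableP[/measurable_EFinP] := hmom k.
rewrite lte_mul_pinfty ?lee_fin ?exprn_ge0//.
by have /integrableP[] := hmom k.
Qed.

Definition Gn n (t : seq Y) : R := (\sum_(y <- t) absv y) ^+ n.

Lemma Gn_dom n : poisson_dom kap lam (Gn n).
Proof.
have a0 y : 0 <= absv y by rewrite mulr_ge0.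
have [h1 h2] := poisson_power_finite n kap_setT vol_gt0 a0 absv_integrable.
by split => // t; rewrite exprn_ge0// sumr_ge0.
Qed.

Lemma cintegral_kap f : cintegrable (mu \x tmu)%E f ->
  cintegrable kap f /\ cintegral kap f = (lam^-1)%:C * cintegral (mu \x tmu)%E f.
Proof.
move=> fi; have [mf ff] := fi.
have key (g : Y -> R) : (mu \x tmu)%E.-integrable setT (fun y => (g y)%:E) ->
    Rintegral kap setT g = lam^-1 * Rintegral (mu \x tmu)%E setT g.
  move=> gi; have gm : measurable_fun setT (fun y => (g y)%:E) by have /integrableP[] := gi.
  have p1 := integrable_fin_num measurableT (integrable_funepos measurableT gi).
  have p2 := integrable_fin_num measurableT (integrable_funeneg measurableT gi).
  rewrite /Rintegral integralE [in RHS]integralE.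
  rewrite !ge0_integral_mscale//; last 2 first.
  - exact: measurable_funeneg.
  - exact: measurable_funepos.
  by rewrite -(fineK p1) -(fineK p2) -!EFinM -!EFinB /= mulrBr.
split.
  split=> //; rewrite ge0_integral_mscale//; last 2 first.
  - by apply/measurable_EFinP; exact: measurable_na.
  - by move=> y _; rewrite lee_fin na_ge0.
  by rewrite lte_mul_pinfty// lee_fin vol_inv_ge0.
have [i1 i2] := cintegrableP fi.
by apply: complex_ext; rewrite ?Re_realM ?Im_realM; exact: key.
Qed.

Section Moments.
Variables (n : nat) (p : 'I_n -> 'rV[int]_d).

Lemma vy_prod (T : {set 'I_n}) y : \prod_(l in T) vy (p l) y =
  (y.1 ^+ #|T|)%:C * conjc (ek (\sum_(l in T) p l) y.2).
Proof.
rewrite ek_sum (rmorph_prod conjc) -prodr_const rmorph_prod.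
by rewrite -big_split.
Qed.

(** Mark and position of a point are independent: the mark gives the moment, and the character has
    mean 1 or 0 over the box, which [lam] turns into [deltaL]. *)
Lemma pmom_vy (T : {set 'I_n}) : cintegrable kap (fun y => \prod_(l in T) vy (p l) y) /\
  lam%:C * pmom kap (fun l => vy (p l)) T =
  (moment mu #|T|)%:C * (deltaL L (\sum_(l in T) p l))%:C.
Proof.
have ai : cintegrable mu (fun v : R => (v ^+ #|T|)%:C).
  by apply: cintegrable_of => /=; [exact: hmom|exact: integrable0].
have [pi pe] := cintegral_prodM ai (cintegrableJ (cintegrable_ek (\sum_(l in T) p l))).
have [ki ke] := cintegral_kap pi.
rewrite /pmom (_ : (fun y => \prod_(l in T) vy (p l) y) = fun y : Y =>
   (y.1 ^+ #|T|)%:C * conjc (ek (\sum_(l in T) p l) y.2)); last by apply/funext => y; exact: vy_prod.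
split => //.
rewrite ke pe (cintegralJ (cintegrable_ek _)) cintegral_ek mulrA -rmorphM /= divff ?gt_eqF ?vol_gt0// mul1r.
have -> : cintegral mu (fun v : R => (v ^+ #|T|)%:C) = (moment mu #|T|)%:C.
  by apply: complex_ext => //=; rewrite /Rintegral integral0.
by rewrite /deltaL; case: ifP => _; rewrite ?conjc_real// conjc0.
Qed.

Lemma poisson_E_prod :
  poisson_E kap lam (fun t => \prod_(l < n) \sum_(y <- t) vy (p l) y) =
  \sum_(A : {set {set 'I_n}} | finset.partition A [set: 'I_n])
    \prod_(a in A) ((moment mu #|a|)%:C * (deltaL L (\sum_(l in a) p l))%:C).
Proof.
have wi (T : {set 'I_n}) := (pmom_vy T).1.
have pm := poisson_moments lam kap_setT wi [set: 'I_n]%SET.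
have e : (fun t : seq Y => \prod_(l < n) \sum_(y <- t) vy (p l) y) =
    (fun t : seq Y => \prod_(l in [set: 'I_n]%SET) \sum_(y <- t) vy (p l) y).
  by apply/funext => t; apply: eq_bigl => l; rewrite finset.in_setT.
rewrite e /poisson_E.
have -> : \sum_(A : {set {set 'I_n}} | finset.partition A [set: 'I_n])
    \prod_(a in A) ((moment mu #|a|)%:C * (deltaL L (\sum_(l in a) p l))%:C) =
    block_sum (fun T => lam%:C * pmom kap (fun l => vy (p l)) T) [set: 'I_n]%SET.
  by apply: eq_bigr => A _; apply: eq_bigr => a _; rewrite (pmom_vy a).2.
have [G0 Gi Gs] := Gn_dom n.
have cs : csummable (fun m => (poisson_w lam m)%:C * psig kap (fun l => vy (p l)) m [set: 'I_n]%SET).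
  apply: (le_csummable _ Gs) => m.
  have si := (psig_int wi m [set: 'I_n]%SET).1.
  apply: (@le_trans _ _ ((poisson_w lam m)%:E * (na (psig kap (fun l => vy (p l)) m [set: 'I_n]%SET))%:E)%E).
    by rewrite -EFinM lee_fin (le_trans (naM _ _))// na_real ger0_norm// (poisson_w_ge0 vol_gt0).
  apply: lee_wpmul2l; first by rewrite lee_fin (poisson_w_ge0 vol_gt0).
  apply: le_trans (na_cintegral si) _; apply: ge0_le_integral => //.
  - by move=> t _; rewrite lee_fin na_ge0.
  - by apply/measurable_EFinP; apply: measurable_na; have [] := si.
  - by have /integrableP[] := Gi m.
  - move=> t _; rewrite lee_fin; apply: (le_trans (na_prod _ _ _)).
    rewrite /Gn -[X in _ ^+ X](card_ord n) -finset.cardsT -prodr_const; apply: ler_prod => l _.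
    rewrite na_ge0 /=; apply: (le_trans (na_sum _ _ _)); apply: ler_sum => y _; exact: na_vy.
apply: (csum_unique cs); move: pm; congr ccvg; apply/funext => N.
by apply: eq_bigr => m _; rewrite enum_ext_nat.
Qed.

End Moments.

Lemma poisson_domZ (c : R) G : 0 <= c -> poisson_dom kap lam G ->
  poisson_dom kap lam (fun t => c * G t).
Proof.
move=> c0 [G0 Gi Gs]; split.
- by move=> t; rewrite mulr_ge0.
- by move=> m; under eq_fun do rewrite EFinM; exact: integrableZl.
have w0 m := poisson_w_ge0 vol_gt0 m.
rewrite (eq_esum (b := fun m => (c%:E * ((poisson_w lam m)%:E * \int[pw kap m]_t (G t)%:E))%E)).
  rewrite esumZl//; first by rewrite lte_mul_pinfty.
  by move=> m; rewrite mule_ge0 ?lee_fin// integral_ge0// => t _; rewrite lee_fin.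
move=> m _; rewrite muleCA; congr (_ * _)%E.
under eq_integral do rewrite EFinM.
rewrite ge0_integralZl//; first by have /integrableP[] := Gi m.
by move=> t _; rewrite lee_fin.
Qed.

(** Proved from the definition as a supremum over simple functions, since the partial integrals
    inside [nnint] come with no measurability. *)
Lemma le_nonneg_integral d' (T : measurableType d') (m : {measure set T -> \bar R}) (f g : T -> \bar R) :
  (forall x, 0 <= f x <= g x)%E -> (\int[m]_x f x <= \int[m]_x g x)%E.
Proof.
move=> fg; rewrite !ge0_integralTE//; last 2 first.
- by move=> x; have /andP[h1 h2] := fg x; exact: le_trans h1 h2.
- by move=> x; have /andP[] := fg x.
apply: le_ereal_sup => _ [h hf <-]; exists h => // x.
by apply: le_trans (hf x) _; have /andP[] := fg x.
Qed.

Lemma le_nnint (f g : 'rV[R]_d -> \bar R) : (forall x, 0 <= f x <= g x)%E ->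
  (nnint f <= nnint g)%E.
Proof.
move=> fg.
have key k x : (0 <= iint_aux k f x <= iint_aux k g x)%E.
  elim: k x => [|k IH] x /=; first exact: fg.
  apply/andP; split; last by apply: le_nonneg_integral => t; exact: IH.
  by apply: integral_ge0 => t _; have /andP[] := IH (setc x k t).
by have /andP[] := key d 0.
Qed.

Lemma sqint_per (psi : 'rV[R]_d -> R[i]) : L2Rd psi -> sqint tmu (fun t => per L psi (toV t)).
Proof.
move=> [mp fp]; rewrite cmeasE in mp.
rewrite (_ : (fun t => _) = fun t : X => psi (toV (twrap t))); last first.
  by apply/funext => t; rewrite per_toV.
have ms : measurable_fun setT (fun t : X => (sqn (psi (toV t)))%:E).
  by apply/measurable_EFinP; exact: measurable_sqn.
split; first exact: (cmf_twrap mp).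
rewrite (integral_twrap ms); last by move=> t; rewrite lee_fin sqn_ge0.
apply: le_lt_trans fp.
rewrite -(nnint_box (f := fun x => if boxb L x then (sqn (psi x))%:E else 0%E)
  (g := fun x => (sqn (psi x))%:E)) => //.
- by apply: le_nnint => x; case: ifP => _; rewrite ?lexx ?lee_fin sqn_ge0.
- exact: (measurable_if_box (g := cst 0%E)).
- by move=> x; case: ifP => // _; rewrite lee_fin sqn_ge0.
- by move=> x; rewrite lee_fin sqn_ge0.
- by move=> x /negbTE ->.
- by move=> x ->.
Qed.

(** * The chain of resolvents as a sum over paths, and its expectation *)

Section Assembly.
Hypothesis d0 : (0 < d)%N.
Variables (B : 'rV[R]_d -> R) (z : R[i]) (psi1 psi2 : 'rV[R]_d -> R[i]).
Hypothesis hBs : schwartz B.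
Hypothesis hz : ~ (complex.Im z = 0 /\ 0 <= complex.Re z).
Hypothesis hpsi1 : L2Rd psi1.
Hypothesis hpsi2 : L2Rd psi2.

Let f1 := fc (fun t => per L psi1 (toV t)).
Let f2 := fc (fun t => per L psi2 (toV t)).
Let r := rk z.
Let beta (p : 'rV[int]_d) : R := lam^-1 * na (bhat B p).
(** The convolution kernel of multiplication by the potential, including the [lam^-1] of
    [fc_mul]. *)
Let W (t : seq Y) (p : 'rV[int]_d) : R[i] := (lam^-1)%:C * ((\sum_(y <- t) vy p y) * bhat B p).

Let Bder vs x v : derivable (dder vs B) x v. Proof. by have [] := hBs vs. Qed.
Let Bbnd vs : exists C, forall x, `|dder vs B x| <= C.
Proof.
have [_ [_ h]] := hBs vs; have [C hC] := h 0%N; exists C => x.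
by have := hC x; rewrite expr0 mul1r.
Qed.
Let Bcont : continuous B. Proof. by have [_ []] := hBs [::]. Qed.
Let BC : exists C, forall x, `|B x| <= C. Proof. exact: (Bbnd [::]). Qed.

Let beta0 p : 0 <= beta p.
Proof. by rewrite mulr_ge0 ?na_ge0// vol_inv_ge0. Qed.

Let beta_decay : exists2 C, 0 <= C & forall k, beta k <= C * \prod_j (1 + (absz (k 0 j))%:R)^-1.
Proof.
have [C C0 hC] := bhat_decay Bder Bbnd (measurable_continuous_rV Bcont).
exists (lam^-1 * C); first by rewrite mulr_ge0// vol_inv_ge0.
by move=> k; rewrite -mulrA ler_wpM2l// vol_inv_ge0.
Qed.

Let r_rho : exists2 C, 0 <= C & forall k, na (r k) <= C * rho R k ^+ 2.
Proof.
have [C C0 hC] := rk_le hz.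
(* From [(1 + m)^2 <= 2 + 2 m^2], where [m = |k_j|] satisfies [m^2 = L^2 p_j^2 <= 2 L^2 nu(p)] at
   [p = k / L]. *)
pose D : R := 2 + 4 * L ^+ 2.
have D0 : 0 < D by rewrite ltr_pwDl// mulr_ge0// sqr_ge0.
exists (C * D); first by rewrite mulr_ge0 ?ltW.
move=> k; set x := nu (dual L k).
have x0 : 0 <= x by exact: nu_ge0.
have h1 : 1 <= D * (1 + x) * rho R k ^+ 2.
  apply: rho2_ge => // j; rewrite natr_absz intr_norm.
  set m : R := `|_|.
  have mE : m ^+ 2 = L ^+ 2 * (dual L k 0 j) ^+ 2.
    by rewrite /m real_normK ?num_real// mxE exprMn exprVn mulrC mulfVK// expf_neq0// gt_eqF.
  have hx : (dual L k 0 j) ^+ 2 <= 2 * x.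
    rewrite /x /nu mulrC mulfVK// (bigD1 j)//= lerDl sumr_ge0// => i _; exact: sqr_ge0.
  have := ler_wpM2l (sqr_ge0 L) hx; rewrite -mE.
  have := sqr_ge0 (m - 1); have := sqr_ge0 L; rewrite sqrrB /D; nra.
have nr := na_ge0 (r k).
apply: (@le_trans _ _ (na (r k) * (D * (1 + x) * rho R k ^+ 2))); first by rewrite ler_peMr.
rewrite (_ : _ * (D * _ * _) = na (r k) * (1 + x) * (D * rho R k ^+ 2)); last by ring.
by rewrite -[X in _ <= X]mulrA ler_wpM2r ?hC// mulr_ge0 ?sqr_ge0// ltW.
Qed.

Let na2_fin f : sqint tmu f -> (esum setT (fun k => (na (fc f k) ^+ 2)%:E) < +oo)%E.
Proof.
move=> hf; apply: (@le_lt_trans _ _ (esum setT (fun k => 2%:E * (sqn (fc f k))%:E)%E)).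
  by apply: le_esum => k _; rewrite -EFinM lee_fin na_le_sqn.
rewrite esumZl// ?bessel//; last by move=> k; rewrite lee_fin sqn_ge0.
by rewrite -EFinM ltry.
Qed.

Let f1_sq := na2_fin (sqint_per hpsi1).
Let f2_sq := na2_fin (sqint_per hpsi2).

Let Tfin n k : (Tabs r f2 beta n k < +oo)%E.
Proof.
have [Cb Cb0 hb] := beta_decay; have [C C0 hr] := r_rho.
exact: (Tabs_fin d0 Cb0 beta0 hb C0 hr f2_sq).
Qed.

Let Tweight n : (esum setT (fun k => (na (conjc (f1 k)))%:E * Tabs r f2 beta n k) < +oo)%E.
Proof.
have [Cb Cb0 hb] := beta_decay; have [C C0 hr] := r_rho.
under eq_esum do rewrite naJ.
exact: (Tabs_weight d0 Cb0 beta0 hb C0 hr f2_sq n (fun k => na_ge0 (f1 k)) f1_sq).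
Qed.

Let S0 (t : seq Y) : 0 <= \sum_(y <- t) absv y.
Proof. by apply: sumr_ge0 => y _; rewrite mulr_ge0. Qed.

Let WS t p : na (W t p) <= (\sum_(y <- t) absv y) * beta p.
Proof.
rewrite /W /beta; apply: (le_trans (naM _ _)); rewrite na_real ger0_norm ?vol_inv_ge0//.
rewrite mulrCA ler_wpM2l ?vol_inv_ge0//; apply: (le_trans (naM _ _)).
rewrite ler_wpM2r ?na_ge0//; apply: (le_trans (na_sum _ _ _)).
by apply: ler_sum => y _; exact: na_vy.
Qed.

Lemma chain_fc n (t : seq Y) :
  sqint tmu (fun u => chain L z B (conf t) (per L psi2) n (toV u)) /\
  forall k, fc (fun u => chain L z B (conf t) (per L psi2) n (toV u)) k = Tsum r f2 (W t) n k.
Proof.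
have [CB hCB] := BC.
elim: n => [|n [IHs IHf]] /=; first exact: (resolv_spec hz (sqint_per hpsi2)).
have [mV [CV hV] fV] := Vpot_fc Bcont hCB (conf t).
have hm k := fc_mul k mV hV IHs.
(* Square integrability of the product is part of [fc_mul] at any momentum, here at 0. *)
have [hs hc] := resolv_spec hz (f := fun x => (Vpot L B (conf t) x)%:C *
  chain L z B (conf t) (per L psi2) n x) (let: And3 s _ _ := hm 0 in s).
split => // k; rewrite hc; congr (_ * _).
have [_ cs ->] := hm k.
rewrite -csumZ//; congr csum; apply/funext => q.
by rewrite fV vw_conf IHf /W !mulrA.
Qed.

Let F n (k : {ffun 'I_n.+1 -> 'rV[int]_d}) (t : seq Y) : R[i] :=
  (lam^-1)%:C * (conjc (f1 (k ord0)) * hprod r f2 (W t) k).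

(** Besides the path expansion this gives measurability in the configuration: each term is explicit
    in [t], whereas [resolv] is a mere choice. *)
Lemma inner_chain n (t : seq Y) :
  innerL L (per L psi1) (chain L z B (conf t) (per L psi2) n) = csum (fun k => @F n k t).
Proof.
have [cs cf] := chain_fc n t.
rewrite (innerL_ip (sqint_per hpsi1) cs) (parseval_csum (sqint_per hpsi1) cs).
under [in LHS]eq_fun do rewrite cf.
have [s1 e1] := csum_hprod_weight beta0 (S0 t) (WS t) (Tfin) (g := fun k => conjc (f1 k)) (Tweight n).
by rewrite -e1 -csumZ.
Qed.

(** All that does not depend on the configuration: [n] powers of [lam^-1] come from the convolutions
    and one from Parseval. *)
Let coef n (k : {ffun 'I_n.+1 -> 'rV[int]_d}) : R[i] :=
  (lam^-1)%:C ^+ n.+1 * (conjc (f1 (k ord0)) * f2 (k ord_max) *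
  (\prod_j r (k j)) * \prod_(l < n) bhat B (kdiff k l)).

Lemma FE n (k : {ffun 'I_n.+1 -> 'rV[int]_d}) t :
  F k t = coef k * \prod_(l < n) \sum_(y <- t) vy (kdiff k l) y.
Proof.
rewrite /F /coef /hprod /W big_split /= prodr_const card_ord big_split /= exprS.
ring.
Qed.

Lemma cmf_prod_vy n (p : 'I_n -> 'rV[int]_d) m :
  cmf (fun t : m.-tuple Y => \prod_(l < n) \sum_(y <- t) vy (p l) y).
Proof.
apply: cmf_prod => l _; under eq_fun do rewrite big_tuple.
apply: cmf_sum => i _; have [h1 h2] := cmf_vy (p l).
have mt := @measurable_tnth _ Y m i.
by split; [have := measurableT_comp h1 mt|have := measurableT_comp h2 mt]; apply.
Qed.

Lemma na_prod_vy n (p : 'I_n -> 'rV[int]_d) t :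
  na (\prod_(l < n) \sum_(y <- t) vy (p l) y) <= Gn n t.
Proof.
apply: (le_trans (na_prod _ _ _)).
rewrite /Gn -[X in _ ^+ X](card_ord n) -prodr_const; apply: ler_prod => l _.
by rewrite na_ge0 /=; apply: (le_trans (na_sum _ _ _)); apply: ler_sum => y _; exact: na_vy.
Qed.

(** The coefficients of [B] in [PAL], grouped by blocks, multiply to the same product over all [l]
    for every partition; what remains is the moment sum of [poisson_E_prod]. *)
Lemma poisson_E_F n (k : {ffun 'I_n.+1 -> 'rV[int]_d}) :
  poisson_E kap lam (F k) = (lam^-1)%:C ^+ n.+1 *
   ((\sum_(A : {set {set 'I_n}} | finset.partition A [set: 'I_n]) PAL L mu B A k) *
    conjc (hatper L (per L psi1) (k ord0)) * hatper L (per L psi2) (k ord_max) *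
    \prod_(j < n.+1) ((nu (dual L (k j)))%:C - z)^-1).
Proof.
rewrite (_ : F k = fun t => coef k * \prod_(l < n) \sum_(y <- t) vy (kdiff k l) y); last first.
  by apply/funext => t; exact: FE.
rewrite (poisson_E_Z vol_gt0 _ (Gn_dom n)); last 2 first.
- by move=> m; exact: cmf_prod_vy.
- by move=> t; exact: na_prod_vy.
rewrite poisson_E_prod.
rewrite (hatper_fc _ (sqint_per hpsi1)) (hatper_fc _ (sqint_per hpsi2)).
have -> : \sum_(A : {set {set 'I_n}} | finset.partition A [set: 'I_n]) PAL L mu B A k =
   (\prod_(l < n) bhat B (kdiff k l)) *
   \sum_(A : {set {set 'I_n}} | finset.partition A [set: 'I_n])
    \prod_(a in A) ((moment mu #|a|)%:C * (deltaL L (\sum_(l in a) kdiff k l))%:C).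
  rewrite mulr_sumr; apply: eq_bigr => A Ap; rewrite /PAL big_split /= mulrC; congr (_ * _).
  have [CB hCB] := BC.
  have hb l : hatper L (fun x => (per L B x)%:C) (kdiff k l) = bhat B (kdiff k l).
    by rewrite hatper_fc//; exact: (sqint_perB Bcont hCB).
  rewrite (eq_bigr (fun a : {set 'I_n} => \prod_(l in a) bhat B (kdiff k l))); last first.
    by move=> a _; apply: eq_bigr => l _; exact: hb.
  rewrite -finset.big_trivIset ?(finset.partition_trivIset Ap)// (finset.cover_partition Ap).
  by apply: eq_bigl => l; rewrite finset.in_setT.
rewrite /coef -!/(f1 _) -!/(f2 _) -/r.
rewrite -mulrA; congr (_ * _).
rewrite (_ : \prod_(j < n.+1) ((nu (dual L (k j)))%:C - z)^-1 = \prod_j r (k j))//.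
ring.
Qed.

Lemma Tn_eq_Tpart n : Tn n L z mu B psi1 psi2 = Tpart n L z mu B psi1 psi2.
Proof.
(* The deterministic part of the bound on [F]; the configuration enters only through [Gn n]. *)
pose A (k : {ffun 'I_n.+1 -> 'rV[int]_d}) : R := lam^-1 * (na (conjc (f1 (k ord0))) * habs r f2 beta k).
have A0' (k : {ffun 'I_n.+1 -> 'rV[int]_d}) : 0 <= na (conjc (f1 (k ord0))) * habs r f2 beta k.
  by rewrite mulr_ge0 ?na_ge0// (habs_ge0 r f2 beta0).
have A0 k : 0 <= A k by rewrite mulr_ge0// vol_inv_ge0.
have Afin : (esum setT (fun k => (A k)%:E) < +oo)%E.
  under eq_esum do rewrite EFinM.
  rewrite esumZl ?vol_inv_ge0//.
  rewrite lte_mul_pinfty ?lee_fin ?vol_inv_ge0//.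
  by rewrite (esum_habs_weight r f2 beta0 n (fun k => na_ge0 (conjc (f1 k)))).
have FA k t : na (@F n k t) <= A k * Gn n t.
  rewrite /F /A; apply: (le_trans (naM _ _)); rewrite na_real ger0_norm ?vol_inv_ge0//.
  rewrite -[X in _ <= X]mulrA ler_wpM2l ?vol_inv_ge0//; apply: (le_trans (naM _ _)).
  rewrite -[X in _ <= X]mulrA ler_wpM2l ?na_ge0// [X in _ <= X]mulrC.
  exact: (na_hprod r f2 (WS t) k).
have Fm m k : cmf (fun t : m.-tuple Y => @F n k t).
  under eq_fun do rewrite FE.
  by apply: cmfM; [exact: cmf_cst|exact: cmf_prod_vy].
have [Fs csm csb pcs pE] := poisson_E_csum vol_gt0 (Gn_dom n) Fm A0 Afin FA.
have ie : (fun t => innerL L (per L psi1) (chain L z B (conf t) (per L psi2) n)) = (fun t => csum (@F n ^~ t)).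
  by apply/funext => t; exact: inner_chain.
have cA0 : 0 <= fine (esum setT (fun k => (A k)%:E)).
  by rewrite fine_ge0// esum_ge0// => k _; rewrite lee_fin.
rewrite /Tn (cE_poisson (poisson_domZ cA0 (Gn_dom n))); last 2 first.
- by move=> m; under eq_fun do rewrite inner_chain; exact: csm.
- by move=> t; rewrite inner_chain; exact: csb.
rewrite ie pE /Tpart.
(* The prefactor is divided out below: summability is known for the terms that contain it and has to
   be passed to the terms without it. *)
have lC0 : (lam^-1)%:C ^+ n.+1 != 0 :> R[i].
  rewrite expf_neq0//; apply/eqP => /(congr1 (@complex.Re R)) /=; apply/eqP.
  by rewrite invr_eq0 gt_eqF// vol_gt0.
have -> : (vol d L ^- n.+1)%:C = (lam^-1)%:C ^+ n.+1 by rewrite -rmorphXn /= exprVn.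
move: pcs; under eq_fun do rewrite poisson_E_F.
move=> /(csummableZ ((lam^-1)%:C ^+ n.+1)^-1); under eq_fun do rewrite mulKf//.
by move=> cs; rewrite -csumZ.
Qed.

End Assembly.
End Configurations.
End Torus.

Theorem theorem1 (R : realType) (d : nat) (hd : (0 < d)%N)
    (B : 'rV[R]_d -> R)
    (hBs : schwartz B)
    (hBsym : compact_support B \/ reflection_invariant B)
    (mu : probability R R)
    (hmom : forall k : nat, mu.-integrable setT (fun x : R => (x ^+ k)%:E))
    (n : nat) (L : R) (hL : 0 < L)
    (z : R[i]) (hz : ~ (complex.Im z = 0 /\ 0 <= complex.Re z))
    (psi1 psi2 : 'rV[R]_d -> R[i])
    (hpsi1 : L2Rd psi1) (hpsi2 : L2Rd psi2) :
  Tn n L z mu B psi1 psi2 = Tpart n L z mu B psi1 psi2.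
Proof. exact: Tn_eq_Tpart. Qed.
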